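(* For every $m\in\mathbb{Z}$, the sequence of empirical measures $(\ell_n)_{n\in\mathbb{N}}$ satisfies, under $\mathbb{P}_m$, a (full) large deviation principle on $\mathcal{P}(\overline{\mathbb{Z}})$ (endowed with the topology of weak convergence) with good rate function $I:\mathcal{P}(\overline{\mathbb{Z}})\to[0,+\infty]$ given by $$I(\mu)=\alpha_0 I_{\mathrm{DV}}(\mu_0)+\min\Big\{\alpha_- I^{p_-}_{\mathrm{Cr}}(0)+\alpha_+\inf_{x\in[0,1]}I^{p_+}_{\mathrm{Cr}}(x)\ ;\ \alpha_+ I^{p_+}_{\mathrm{Cr}}(0)+\alpha_-\inf_{x\in[-1,0]}I^{p_-}_{\mathrm{Cr}}(x)\Big\},$$ where $\mu=\alpha_-\delta_{-\infty}+\alpha_0\mu_0+\alpha_+\delta_{+\infty}$ is the decomposition described in the context.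
   Context: $\overline{\mathbb{Z}}=\mathbb{Z}\cup\{-\infty,+\infty\}$ is the two-point compactification of $\mathbb{Z}$, whose topology is generated by the sets $\{k\in\overline{\mathbb{Z}}:k\le n\}$ and $\{k\in\overline{\mathbb{Z}}:k\ge n\}$, $n\in\mathbb{Z}$; it is compact and metrisable. $\mathcal{P}(\overline{\mathbb{Z}})$ is the set of Borel probability measures on $\overline{\mathbb{Z}}$ and $\mathcal{P}(\mathbb{Z})$ is identified with the measures giving no mass to $\pm\infty$. Let $p:\mathbb{Z}\to[0,1]$ satisfy $0<p(k)<1$ for all $k\in\mathbb{Z}$, and assume the limits $p_-=\lim_{k\to-\infty}p(k)$ and $p_+=\lim_{k\to+\infty}p(k)$ exist and belong to $(0,1)$. For $m\in\mathbb{Z}$, $\mathbb{P}_m$ is a probability measure on $\overline{\mathbb{Z}}^{\mathbb{N}}$ (with product Borel $\sigma$-algebra) under which the coordinate process $(S_n)_{n\in\mathbb{N}}$ is a Markov chain with $S_1=m$, with $\pm\infty$ absorbing, and for $k\in\mathbb{Z}$ with transitions $k\to k+1$ with probability $p(k)$ and $k\to k-1$ with probability $1-p(k)$. The empirical measures are $\ell_n=\frac1n\sum_{j=1}^n\delta_{S_j}$. Every $\mu\in\mathcal{P}(\overline{\mathbb{Z}})$ can be written $\mu=\alpha_-\delta_{-\infty}+\alpha_0\mu_0+\alpha_+\delta_{+\infty}$ with $\alpha_\sigma\ge0$, $\alpha_-+\alpha_0+\alpha_+=1$, $\mu_0\in\mathcal{P}(\mathbb{Z})$ (unique if $\mu(\mathbb{Z})>0$;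 if $\mu(\mathbb{Z})=0$ then $\alpha_0=0$, $\mu_0$ is arbitrary and $I(\mu)$ does not depend on the choice). Convention: $0\cdot\infty=0$. $I_{\mathrm{DV}}:\mathcal{P}(\mathbb{Z})\to[0,+\infty]$ is $I_{\mathrm{DV}}(\nu)=\sup\big\{\sum_{k\in\mathbb{Z}}\nu(k)\log\frac{u_k}{p(k)u_{k+1}+(1-p(k))u_{k-1}}\ :\ (u_k)_{k\in\mathbb{Z}},\ u_k\ge1\ \forall k\big\}$. For $q\in(0,1)$, $I^q_{\mathrm{Cr}}(x)=\frac{1-x}{2}\log\frac{1-x}{2(1-q)}+\frac{1+x}{2}\log\frac{1+x}{2q}$ for $x\in[-1,1]$ and $+\infty$ otherwise (the Cramér rate function of a $\pm1$-valued variable with $\mathbb{P}(X=1)=q$). A large deviation principle with rate function $I$ (lower semicontinuous) means: $-\inf_U I\le\liminf_n\frac1n\log\mathbb{P}_m(\ell_n\in U)$ for all open $U$ and $\limsup_n\frac1n\log\mathbb{P}_m(\ell_n\in F)\le-\inf_F I$ for all closed $F$; good means all level sets $\{I\le\alpha\}$ are compact. *)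

(* Defs.v *)
From HB Require Import structures.
From mathcomp Require Import all_boot all_order all_algebra.
From mathcomp Require Import all_classical all_reals all_analysis.
Set Implicit Arguments. Unset Strict Implicit. Unset Printing Implicit Defensive.
Import Order.TTheory GRing.Theory Num.Theory.
Local Open Scope classical_set_scope.
Local Open Scope ring_scope.

Inductive zbar := ZNInf | ZFin of int | ZPInf.

Definition zbar_eqb (x y : zbar) : bool :=
  match x, y with
  | ZNInf, ZNInf => true
  | ZPInf, ZPInf => true
  | ZFin a, ZFin b => a == b
  | _, _ => false
  end.

Section Defs.
Variable R : realType.
Local Open Scope ereal_scope.

Definition zsum_nn (a : int -> \bar R) : \bar R :=
  ereal_sup [set (\sum_(0 <= i < (2 * N).+1) a (i%:Z - N%:Z)%R) | N in [set: nat]].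

(* Sum over Z of a signed extended-real family: (sum of positive parts) minus
   (sum of negative parts) -- i.e. the Lebesgue integral w.r.t. counting measure
   (with MathComp's convention +oo - +oo = -oo when both parts diverge). *)
Definition zsum (a : int -> \bar R) : \bar R :=
  zsum_nn (fun k => Order.max (a k) 0) - zsum_nn (fun k => Order.max (- a k) 0).

(* Zbar is countable and T1, so its Borel sigma-algebra is the full power set:
   a Borel probability measure on Zbar is the same as a mass function. *)
Definition is_prob (mu : zbar -> R) : Prop :=
  (forall x, (0 <= mu x)%R) /\
  (mu ZNInf)%:E + (mu ZPInf)%:E + zsum_nn (fun k => (mu (ZFin k))%:E) = 1.

(* Continuity of f : Zbar -> R for the topology generated by the sets
   {k <= n} and {k >= n}: integers are isolated points, and the neighbourhoods
   of +oo (resp. -oo) are generated by {k >= n} (resp. {k <= n}). *)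
Definition zbar_continuous (f : zbar -> R) : Prop :=
  (forall e : R, (0 < e)%R -> exists n : int, forall k : int, (n <= k)%R ->
      (`|f (ZFin k) - f ZPInf| < e)%R) /\
  (forall e : R, (0 < e)%R -> exists n : int, forall k : int, (k <= n)%R ->
      (`|f (ZFin k) - f ZNInf| < e)%R).

Definition zbar_integral (mu : zbar -> R) (f : zbar -> R) : R :=
  (f ZNInf * mu ZNInf + f ZPInf * mu ZPInf +
   fine (zsum (fun k => (f (ZFin k) * mu (ZFin k))%:E)))%R.

(* Open sets of P(Zbar) for the topology of weak convergence (the coarsest
   topology making mu |-> int f dmu continuous for all continuous f). *)
Definition weak_open (U : set (zbar -> R)) : Prop :=
  U `<=` is_prob /\
  forall mu, U mu -> exists (fs : seq (zbar -> R)) (e : R),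
    (0 < e)%R /\ (forall f, f \in fs -> zbar_continuous f) /\
    forall nu, is_prob nu ->
      (forall f, f \in fs -> (`|zbar_integral nu f - zbar_integral mu f| < e)%R) ->
      U nu.

Definition weak_closed (F : set (zbar -> R)) : Prop :=
  F `<=` is_prob /\ weak_open (is_prob `\` F).

Definition weak_compact (K : set (zbar -> R)) : Prop :=
  K `<=` is_prob /\
  forall C : set (set (zbar -> R)), (forall G, C G -> weak_open G) ->
    K `<=` \bigcup_(G in C) G ->
    exists s : seq (set (zbar -> R)),
      (forall G, G \in s -> C G) /\ K `<=` \bigcup_(G in [set G | G \in s]) G.

Definition elog (x : R) : \bar R := if (0 < x)%R then (ln x)%:E else -oo.

(* Law of the first n positions (S_1,...,S_n) of the nearest-neighbour chain
   started at S_1 = m, with P(k -> k+1) = p k, P(k -> k-1) = 1 - p k: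
   path_prob p m n E = P_m((S_1,...,S_n) \in E), defined by the Markov
   (first step) decomposition. From m \in Z the chain never reaches +-oo in
   finite time, so the absorbing states play no role for finite n. *)
Fixpoint path_prob (p : int -> R) (m : int) (n : nat) (E : seq int -> Prop) : R :=
  match n with
  | 0%N => (if `[< E [::] >] then 1 else 0)%R
  | 1%N => (if `[< E [:: m] >] then 1 else 0)%R
  | n'.+1 =>
      (p m * path_prob p (m + 1)%R n' (fun s => E (m :: s)) +
       (1 - p m) * path_prob p (m - 1)%R n' (fun s => E (m :: s)))%R
  end.

Definition empirical (s : seq int) : zbar -> R :=
  fun x => ((count (fun k => zbar_eqb (ZFin k) x) s)%:R / (size s)%:R)%R.

Definition emp_prob (p : int -> R) (m : int) (n : nat) (U : set (zbar -> R)) : R :=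
  path_prob p m n (fun s => U (empirical s)).

(* Cramer rate function of a +-1 variable with P(X = 1) = q
   (with 0 log 0 = 0 at the endpoints x = -1, 1). *)
Definition I_Cr (q x : R) : \bar R :=
  if ((-1 <= x) && (x <= 1))%R then
    ((1 - x) / 2 * ln ((1 - x) / (2 * (1 - q))) +
     (1 + x) / 2 * ln ((1 + x) / (2 * q)))%:E
  else +oo.

Definition I_DV (p : int -> R) (nu : int -> R) : \bar R :=
  ereal_sup [set zsum (fun k => (nu k * ln (u k /
        (p k * u (k + 1)%R + (1 - p k) * u (k - 1)%R)))%:E)
            | u in [set u : int -> R | forall k, (1 <= u k)%R]].

Definition rate_I (p : int -> R) (pm pp : R) (mu : zbar -> R) : \bar R :=
  let am := mu ZNInf in
  let ap := mu ZPInf in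
  let a0 := (1 - am - ap)%R in
  let mu0 := fun k : int => (mu (ZFin k) / a0)%R in
  a0%:E * I_DV p mu0 +
  Order.min
    (am%:E * I_Cr pm 0 + ap%:E * ereal_inf [set I_Cr pp x | x in [set x | (0 <= x <= 1)%R]])
    (ap%:E * I_Cr pp 0 + am%:E * ereal_inf [set I_Cr pm x | x in [set x | (-1 <= x <= 0)%R]]).

Definition good_rate_function (I : (zbar -> R) -> \bar R) : Prop :=
  (forall mu, is_prob mu -> 0 <= I mu) /\
  (forall a : R, weak_closed [set mu | is_prob mu /\ I mu <= a%:E]) /\
  (forall a : R, weak_compact [set mu | is_prob mu /\ I mu <= a%:E]).

Definition LDP (p : int -> R) (m : int) (I : (zbar -> R) -> \bar R) : Prop :=
  good_rate_function I /\
  (forall U, weak_open U ->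
     - ereal_inf (I @` U) <=
     limn_einf (fun n : nat => (n%:R^-1)%:E * elog (emp_prob p m n U))) /\
  (forall F, weak_closed F ->
     limn_esup (fun n : nat => (n%:R^-1)%:E * elog (emp_prob p m n F)) <=
     - ereal_inf (I @` F)).

End Defs.

(* Main.v *)
(* Upper bound.  For [u = exp w], [E (prod_j (u / P u) (S_j) * u (S_(n+1))) = u m].
   Chernoff's inequality therefore works as soon as [u] is bounded below where the
   walk ends, so on [S_(n+1) >= 0] the function [u] may decay at [-oo], and vice versa.
   Taking [w] affine near both ends, the optimal slopes produce the two linear
   expressions of the minimum in the rate function, and compactness of the space of
   probability measures concludes.

   Lower bound.  If [I_DV mu] is finite, the alternating sums
   [r k = mu k - mu (k - 1) + mu (k - 2) - ...] are nonnegative: [r] is the flux of a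
   reversible nearest-neighbour chain with occupation [mu], and [I_DV mu] dominates the
   relative entropy rate of that chain.  Truncate [r], spread the masses of the two
   ends over long stretches of constant flux (at the cost of the Cramer functions at
   [0]), add a little uniform flux for irreducibility, and tilt the walk to the
   resulting finite chain, whose law of large numbers comes from an explicit solution
   of the Poisson equation.  When the drift at one end points outwards, the mass of
   that end is instead gained for free by a final escape. *)
Require Import Defs.
From HB Require Import structures.
From mathcomp Require Import all_boot all_order all_algebra.
From mathcomp Require Import all_classical all_reals all_analysis.
From mathcomp Require Import ring lra zify.
Set Implicit Arguments. Unset Strict Implicit. Unset Printing Implicit Defensive.
Import Order.TTheory GRing.Theory Num.Theory.
Import numFieldNormedType.Exports.
Local Open Scope classical_set_scope.
Local Open Scope ring_scope.

(** * Expectations over the walk *)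

(** In general the rate function is not convex: of the two ends, only the one where the walk
    finishes can receive mass at a reduced cost. So no single family of test functions yields it,
    and every half-space below carries a pair of them. The topology is handled through the tail
    function [upmass], which identifies the probability measures on the extended integers with the
    nonincreasing functions from the integers to [[0, 1]]. Finitely many tail values control a weak
    neighbourhood, so compactness reduces to Tychonoff's theorem and the lower bound to finitely
    many counts of visits above a level. The flux, rather than the measure, is approximated because
    its entropy is a sum over sites of [cost], which is subadditive and homogeneous: pieces of flux
    can be added and their costs bounded separately, and cutting the flux only creates two boundary
    terms, controlled by the mass outside the window. Series over the integers are compared with
    their sums over a window, up to a multiple of the mass outside. *)

Section Walk.
Variable R : realType.
Implicit Types (q p : int -> R) (x y : int) (n : nat) (s : seq int) (a b c K : R).

(* [walkE q x n F] is the expectation of [F (S_1, ..., S_n) S_(n+1)]; recording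
   the position reached after the last step makes the Markov property and the
   martingale identities exact. *)
Fixpoint walkE q x n (F : seq int -> int -> R) : R :=
  if n is n'.+1 then
    q x * walkE q (x + 1) n' (fun s y => F (x :: s) y) +
    (1 - q x) * walkE q (x - 1) n' (fun s y => F (x :: s) y)
  else F [::] x.

Definition pind (P : Prop) : R := if `[< P >] then 1 else 0.

Lemma pind_ge0 P : 0 <= pind P.
Proof. by rewrite /pind; case: ifP. Qed.

Lemma pind_le1 P : pind P <= 1.
Proof. by rewrite /pind; case: ifP. Qed.

Lemma pindT (P : Prop) : P -> pind P = 1.
Proof. by move=> h; rewrite /pind asboolT. Qed.

Lemma pindF (P : Prop) : ~ P -> pind P = 0.
Proof. by move=> h; rewrite /pind asboolF. Qed.

Lemma pind_le (P Q : Prop) : (P -> Q) -> pind P <= pind Q.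
Proof.
move=> h; have [hP|hP] := pselect P; first by rewrite !pindT //; exact: h.
by rewrite (pindF hP) pind_ge0.
Qed.

Lemma walkE_ext q x n F G : (forall s y, F s y = G s y) ->
  walkE q x n F = walkE q x n G.
Proof.
move=> h; congr walkE; apply/funext => s; apply/funext => y; exact: h.
Qed.

Lemma path_probE q x n (E : seq int -> Prop) :
  path_prob q x n E = walkE q x n (fun s _ => pind (E s)).
Proof.
elim: n x E => [|n IH] x E //=.
(* At length one [path_prob] stops, while [walkE] takes one more step whose two probabilities add up
   to one. *)
case: n IH => [|n] IH; first by rewrite /= /pind; case: ifP => _; lra.
by rewrite IH IH.
Qed.

Lemma walkE_lin q x n a b F G :
  walkE q x n (fun s y => a * F s y + b * G s y) =
  a * walkE q x n F + b * walkE q x n G.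
Proof.
elim: n x F G => [|n IH] x F G //=.
rewrite (IH _ (fun s y => F (x :: s) y)) (IH _ (fun s y => F (x :: s) y)).
ring.
Qed.

Lemma walkED q x n F G :
  walkE q x n (fun s y => F s y + G s y) = walkE q x n F + walkE q x n G.
Proof.
rewrite (walkE_ext _ _ _ (G := fun s y => 1 * F s y + 1 * G s y)).
  by rewrite walkE_lin !mul1r.
by move=> s y; rewrite !mul1r.
Qed.

Lemma walkEZ q x n a F :
  walkE q x n (fun s y => a * F s y) = a * walkE q x n F.
Proof.
rewrite (walkE_ext _ _ _ (G := fun s y => a * F s y + 0 * F s y)).
  by rewrite walkE_lin mul0r addr0.
by move=> s y; rewrite mul0r addr0.
Qed.

Lemma walkE_cst q x n a : walkE q x n (fun _ _ => a) = a.
Proof.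
elim: n x => [|n IH] x //=; rewrite !IH; ring.
Qed.

(** The Markov property at time [n1]; it joins a phase that follows a flux to a phase of escape. *)
Lemma walkE_cat q x n1 n2 F :
  walkE q x (n1 + n2) F =
  walkE q x n1 (fun s y => walkE q y n2 (fun s' z => F (s ++ s') z)).
Proof.
elim: n1 x F => [|n IH] x F //=.
by rewrite !IH.
Qed.

(** The values [0] and [1] are allowed because the chain of a finite flux is reflected at the two
    ends of its window. *)
Definition stochastic q := forall x, 0 <= q x <= 1.

(* Only walks that stay in [I] matter when the chain cannot leave [I]. *)
Lemma walkE_le_in (I : int -> Prop) q x n F G :
  stochastic q ->
  (forall x, I x -> q x != 0 -> I (x + 1)) ->
  (forall x, I x -> q x != 1 -> I (x - 1)) ->
  I x ->
  (forall s y, size s = n -> head y s = x -> {in s, forall z, I z} -> I y ->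
     F s y <= G s y) ->
  walkE q x n F <= walkE q x n G.
Proof.
move=> q01 Iup Idn; elim: n x F G => [|n IH] x F G Ix FG /=; first exact: FG.
have /andP[q0 q1] := q01 x.
apply: lerD.
- have [->|qn0] := eqVneq (q x) 0; first by rewrite !mul0r.
  apply: ler_wpM2l => //; apply: IH; first exact: Iup.
  move=> s y ss hs Is Iy; apply: FG => //=; first by rewrite ss.
  by move=> z; rewrite inE => /predU1P[->//|/Is].
- have [->|qn0] := eqVneq (q x) 1; first by rewrite !subrr !mul0r.
  apply: ler_wpM2l; first by rewrite subr_ge0.
  apply: IH; first exact: Idn.
  move=> s y ss hs Is Iy; apply: FG => //=; first by rewrite ss.
  by move=> z; rewrite inE => /predU1P[->//|/Is].
Qed.

Lemma walkE_le q x n F G :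
  stochastic q ->
  (forall s y, size s = n -> head y s = x -> F s y <= G s y) ->
  walkE q x n F <= walkE q x n G.
Proof.
by move=> q01 FG; apply: (@walkE_le_in (fun _ => True)) => // s y ss hs _ _; exact: FG.
Qed.

Lemma walkE_ge0 q x n F :
  stochastic q -> (forall s y, size s = n -> 0 <= F s y) -> 0 <= walkE q x n F.
Proof.
by move=> q01 F0; rewrite -(walkE_cst q x n 0); apply: walkE_le => // s y /F0.
Qed.

Definition mirror p : int -> R := fun k => 1 - p (- k).

(** Lets the escape to the left be deduced from the escape to the right. *)
Lemma walkE_mirror p x n F :
  walkE p x n F =
  walkE (mirror p) (- x) n (fun s y => F (map -%R s) (- y)).
Proof.
elim: n x F => [|n IH] x F /=; first by rewrite opprK.
rewrite !IH /mirror opprK !opprD opprK addrC; congr (_ + _).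
congr (_ * _); ring.
Qed.

(** A functional of the transitions rather than of the sites, as the log-likelihood ratio [llr]
    requires; the last transition leads to [y]. *)
Fixpoint stepsum (f : int -> int -> R) s y : R :=
  if s is x :: s' then f x (head y s') + stepsum f s' y else 0.

Lemma walkE_consE q x n F :
  walkE q x n.+1 F =
    q x * walkE q (x + 1) n (fun s y => F (x :: s) y) +
    (1 - q x) * walkE q (x - 1) n (fun s y => F (x :: s) y).
Proof. by []. Qed.

Lemma walkE_head q x n F G :
  (forall s y, head y s = x -> F s y = G s y) ->
  walkE q x n F = walkE q x n G.
Proof.
elim: n x F G => [|n IH] x F G FG /=; first exact: FG.
by congr (_ * _ + _ * _); apply: IH => s y hs; apply: FG.
Qed.

(** When [g] solves the Poisson equation, [c + stepsum f s y + g y] is a martingale, and each step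
    adds at most [K] to its second moment. The constant [c] carries the part of the sum already
    read, which makes the induction on [n] work. *)
Lemma chebyshev_walk q (I : int -> Prop) (f : int -> int -> R) (g : int -> R) K x n c :
  stochastic q ->
  (forall x, I x -> q x != 0 -> I (x + 1)) ->
  (forall x, I x -> q x != 1 -> I (x - 1)) ->
  (forall x, I x -> q x * (f x (x + 1) + g (x + 1)) +
                    (1 - q x) * (f x (x - 1) + g (x - 1)) = g x) ->
  (forall x, I x -> (f x (x + 1) + g (x + 1) - f x (x - 1) - g (x - 1)) ^+ 2 <= K) ->
  I x ->
  walkE q x n (fun s y => (c + stepsum f s y + g y) ^+ 2) <= (c + g x) ^+ 2 + n%:R * K.
Proof.
move=> q01 Iup Idn hg hK; elim: n x c => [|n IH] x c Ix /=.
  by rewrite addr0 mul0r addr0.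
have /andP[q0 q1] := q01 x.
set u := f x (x + 1) + g (x + 1) in hg *.
set d := f x (x - 1) + g (x - 1) in hg *.
have e1 : walkE q (x + 1) n (fun s y => (c + (f x (head y s) + stepsum f s y) + g y) ^+ 2)
  = walkE q (x + 1) n (fun s y => (c + f x (x + 1) + stepsum f s y + g y) ^+ 2).
  by apply: walkE_head => s y ->; congr (_ ^+ 2); ring.
have e2 : walkE q (x - 1) n (fun s y => (c + (f x (head y s) + stepsum f s y) + g y) ^+ 2)
  = walkE q (x - 1) n (fun s y => (c + f x (x - 1) + stepsum f s y + g y) ^+ 2).
  by apply: walkE_head => s y ->; congr (_ ^+ 2); ring.
have b1 : q x * walkE q (x + 1) n (fun s y => (c + f x (x + 1) + stepsum f s y + g y) ^+ 2)
    <= q x * ((c + u) ^+ 2 + n%:R * K).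
  have [->|qn0] := eqVneq (q x) 0; first by rewrite !mul0r.
  apply: ler_wpM2l => //.
  by have := IH (x + 1) (c + f x (x + 1)) (Iup _ Ix qn0); rewrite -!addrA.
have b2 : (1 - q x) * walkE q (x - 1) n (fun s y => (c + f x (x - 1) + stepsum f s y + g y) ^+ 2)
    <= (1 - q x) * ((c + d) ^+ 2 + n%:R * K).
  have [->|qn1] := eqVneq (q x) 1; first by rewrite subrr !mul0r.
  apply: ler_wpM2l; first by rewrite subr_ge0.
  by have := IH (x - 1) (c + f x (x - 1)) (Idn _ Ix qn1); rewrite -!addrA.
rewrite e1 e2; apply: le_trans (lerD b1 b2) _.
rewrite -(hg _ Ix) -/u -/d -natr1.
have vK : q x * (1 - q x) * (u - d) ^+ 2 <= K.
  have hud : (u - d) ^+ 2 <= K by have := hK _ Ix; rewrite /u /d opprD addrA.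
  have w0 : 0 <= (u - d) ^+ 2 by exact: sqr_ge0.
  have w1 : q x * (1 - q x) <= 1 by nra.
  have w2 : 0 <= q x * (1 - q x) by nra.
  nra.
have -> : (n%:R + 1) * K = n%:R * K + K by ring.
(* Second moment of a two-point variable: squared mean plus variance. *)
have -> : q x * ((c + u) ^+ 2 + n%:R * K) + (1 - q x) * ((c + d) ^+ 2 + n%:R * K) =
  (c + (q x * u + (1 - q x) * d)) ^+ 2 + (n%:R * K + q x * (1 - q x) * (u - d) ^+ 2) by ring.
by rewrite lerD2l lerD2l.
Qed.

(* Steps with [q]-probability zero contribute nothing to a [q]-expectation, so the
   junk value of [ln] at [0] is harmless. *)
Definition llr p q x y : R :=
  if y == x + 1 then ln (q x / p x) else ln ((1 - q x) / (1 - p x)).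

(** Change of measure from [p] to [q]. Only an inequality, since the paths that [q] forbids are
    lost. *)
Lemma walkE_tilt p q x n F :
  (forall x, 0 < p x < 1) -> stochastic q ->
  (forall s y, 0 <= F s y) ->
  walkE q x n (fun s y => F s y * expR (- stepsum (llr p q) s y)) <= walkE p x n F.
Proof.
move=> p01 q01; elim: n x F => [|n IH] x F F0 /=.
  by rewrite oppr0 expR0 mulr1.
have /andP[p0 p1] := p01 x; have /andP[q0 q1] := q01 x.
have H y0 (a b : R) : 0 < a -> 0 <= b -> (b != 0 -> llr p q x y0 = ln (b / a)) ->
   b * walkE q y0 n (fun s y => F (x :: s) y *
     expR (- (llr p q x (head y s) + stepsum (llr p q) s y))) <=
   a * walkE p y0 n (fun s y => F (x :: s) y).
  move=> a0 b0 hb; have pstoch : stochastic p.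
    by move=> z; have /andP[/ltW -> /ltW ->] := p01 z.
  have [->|bn0] := eqVneq b 0.
    by rewrite mul0r mulr_ge0 ?(ltW a0)//; apply: walkE_ge0.
  have bp : 0 < b by rewrite lt_def bn0.
  rewrite (@walkE_head _ _ _ _ (fun s y => (a / b) * (F (x :: s) y *
     expR (- stepsum (llr p q) s y)))); last first.
    move=> s y ->; rewrite hb // opprD expRD.
    rewrite [expR (- ln _)]expRN lnK ?posrE ?divr_gt0 // invf_div.
    by rewrite mulrCA.
  rewrite walkEZ mulrA mulrCA mulfV ?gt_eqF // mulr1.
  by apply: ler_wpM2l; [exact: ltW|apply: IH].
apply: lerD; apply: H => //.
- by move=> _; rewrite /llr eqxx.
- by rewrite subr_gt0.
- by rewrite subr_ge0.
- move=> _; rewrite /llr; case: eqP => // e; exfalso; lia.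
Qed.

End Walk.

(** * Sums over the integers *)

Section WindowSum.
Variable R : realType.
Implicit Types (a b F G z : int -> R) (N : nat) (c e x y K L T : R).

Definition wsum N F : R := \sum_(0 <= i < (2 * N).+1) F (i%:Z - N%:Z).

Lemma wsumS N F : wsum N.+1 F = wsum N F + F N.+1%:Z + F (- N.+1%:Z).
Proof.
rewrite /wsum mulnS 2!addSn add0n big_nat_recr //= big_nat_recl //=.
rewrite (eq_bigr (fun i => F (i%:Z - N%:Z))); last by move=> i _; congr F; lia.
have -> : 0%:Z - N.+1%:Z = - N.+1%:Z by lia.
have -> : (2 * N).+2%:Z - N.+1%:Z = N.+1%:Z by lia.
lra.
Qed.

Lemma wsum0 F : wsum 0 F = F 0.
Proof. by rewrite /wsum muln0 big_nat1. Qed.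

Lemma wsumD N F G : wsum N (fun k => F k + G k) = wsum N F + wsum N G.
Proof. by rewrite /wsum big_split. Qed.

Lemma wsumZ N c F : wsum N (fun k => c * F k) = c * wsum N F.
Proof. by rewrite /wsum mulr_sumr. Qed.

Lemma wsumN N F : wsum N (fun k => - F k) = - wsum N F.
Proof. by rewrite /wsum sumrN. Qed.

Lemma eq_wsum N F G : (forall k, - N%:Z <= k <= N%:Z -> F k = G k) ->
  wsum N F = wsum N G.
Proof.
move=> h; rewrite /wsum big_nat_cond [RHS]big_nat_cond; apply: eq_bigr => i.
rewrite andbT => /andP[_ hi]; apply: h; lia.
Qed.

Lemma ler_wsum N F G : (forall k, - N%:Z <= k <= N%:Z -> F k <= G k) ->
  wsum N F <= wsum N G.
Proof.
move=> h; rewrite /wsum big_nat_cond [leRHS]big_nat_cond; apply: ler_sum => i.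
rewrite andbT => /andP[_ hi]; apply: h; lia.
Qed.

Lemma wsum_ge0 N F : (forall k, - N%:Z <= k <= N%:Z -> 0 <= F k) -> 0 <= wsum N F.
Proof.
move=> h; apply: le_trans (ler_wsum h).
by rewrite /wsum big1.
Qed.

Lemma ler_norm_wsum N F : `|wsum N F| <= wsum N (fun k => `|F k|).
Proof. exact: ler_norm_sum. Qed.

Lemma ler_wsum_win M N F : (forall k, 0 <= F k) -> (M <= N)%N ->
  wsum M F <= wsum N F.
Proof.
move=> F0 /subnK <-; elim: (N - M)%N => [|d IH] //; rewrite addSn wsumS.
by have := F0 (d + M).+1%:Z; have := F0 (- (d + M).+1%:Z); lra.
Qed.

Lemma wsum_win_diff M N F G : (forall k, `|F k| <= G k) -> (M <= N)%N ->
  `|wsum N F - wsum M F| <= wsum N G - wsum M G.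
Proof.
move=> FG /subnK <-; elim: (N - M)%N => [|d IH]; first by rewrite !subrr normr0.
rewrite addSn !wsumS.
have := FG (d + M).+1%:Z; have := FG (- (d + M).+1%:Z).
move: IH; rewrite !ler_norml => /andP[? ?] /andP[? ?] /andP[? ?].
apply/andP; split; lra.
Qed.

Lemma wsum_delta N (j : int) F : - N%:Z <= j <= N%:Z ->
  wsum N (fun k => if k == j then F k else 0) = F j.
Proof.
move=> hj; rewrite /wsum.
have jN : absz (j + N%:Z) \in index_iota 0 (2 * N).+1.
  by rewrite mem_index_iota; lia.
rewrite (bigD1_seq _ jN (iota_uniq _ _)) /=.
have -> : (absz (j + N%:Z))%:Z - N%:Z = j by lia.
rewrite eqxx big_nat_cond big1 ?addr0 // => i /andP[_ hi].
case: eqP => // h; move: hi; lia.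
Qed.

Lemma wsum_telescope N F : wsum N (fun k => F k - F (k - 1)) = F N%:Z - F (- N%:Z - 1).
Proof.
elim: N => [|N IH]; first by rewrite wsum0 oppr0.
rewrite wsumS IH.
have -> : N.+1%:Z - 1 = N%:Z :> int by lia.
have -> : - N.+1%:Z = - N%:Z - 1 :> int by lia.
lra.
Qed.

Lemma zsum_nnE z : zsum_nn (fun k => (z k)%:E) = ereal_sup [set (wsum N z)%:E | N in [set: nat]].
Proof.
congr ereal_sup; apply/seteqP; split => _ [N _ <-]; exists N => //=.
  by rewrite sumEFin.
by rewrite sumEFin.
Qed.

(** A summable weight. The signed series below are dominated by a multiple of such a weight, and the
    tail [T - wsum N z] measures their truncation error. *)
Definition zfin (z : int -> R) (T : R) :=
  (forall k, 0 <= z k) /\ zsum_nn (fun k => (z k)%:E) = T%:E.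

Lemma zfin_le z T N : zfin z T -> wsum N z <= T.
Proof.
move=> [z0 zT]; rewrite -lee_fin -zT zsum_nnE; apply: ereal_sup_ubound.
by exists N.
Qed.

Lemma zfin_tail z T e : zfin z T -> 0 < e ->
  exists N, forall n, (N <= n)%N -> T - wsum n z < e.
Proof.
move=> zT e0; have [z0 zE] := zT.
have : ((T - e)%:E < ereal_sup [set (wsum N z)%:E | N in [set: nat]])%E.
  by rewrite -zsum_nnE zE lte_fin; lra.
move/ereal_sup_gt => [_ [N _ <-]]; rewrite lte_fin => h; exists N => n Nn.
have := ler_wsum_win z0 Nn; lra.
Qed.

Lemma zfin_bounded z c : (forall k, 0 <= z k) -> (forall N, wsum N z <= c) ->
  exists T, zfin z T /\ T <= c.
Proof.
move=> z0 zc; rewrite /zfin zsum_nnE; set S := ereal_sup _.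
have Sc : (S <= c%:E)%E by apply: ge_ereal_sup => _ [N _ <-]; rewrite lee_fin.
have S0 : (0 <= S)%E.
  apply: (@le_trans _ _ (wsum 0 z)%:E); first by rewrite lee_fin wsum_ge0.
  by apply: ereal_sup_ubound; exists 0%N.
have Sfin : S \is a fin_num by rewrite ge0_fin_numE // (le_lt_trans Sc) // ltry.
exists (fine S); rewrite fineK //; split => //.
by rewrite -lee_fin fineK.
Qed.

Lemma zfin_between z T b K : zfin z T -> (forall k, 0 <= b k <= K * z k) ->
  exists S, zfin b S /\ forall N, wsum N b <= S <= wsum N b + K * (T - wsum N z).
Proof.
move=> zT hb; have [z0 _] := zT.
have b0 k : 0 <= b k by have /andP[] := hb k.
have K0 : forall N M, wsum M b <= wsum N b + K * (T - wsum N z).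
  move=> N M; set L := maxn N M.
  apply: le_trans (ler_wsum_win b0 (leq_maxr N M)) _.
  have h : `|wsum L b - wsum N b| <= wsum L (fun k => K * z k) - wsum N (fun k => K * z k).
    apply: wsum_win_diff; last exact: leq_maxl.
    by move=> k; rewrite ger0_norm //; have /andP[] := hb k.
  rewrite !wsumZ -mulrBr in h.
  have zL := zfin_le L zT.
  have [K_ge0|K_lt0] := leP 0 K.
    have : K * (wsum L z - wsum N z) <= K * (T - wsum N z) by rewrite ler_wpM2l //; lra.
    by move: h; rewrite ler_norml => /andP[_]; lra.
  (* A negative [K] is compatible with [0 <= b k <= K * z k] only if [z] vanishes. *)
  have zz k : z k = 0.
    have /andP[h1 h2] := hb k; have := z0 k => h3; nra.
  have w0 n : wsum n z = 0 by rewrite /wsum big1.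
  have T0 : T = 0.
    apply/eqP; rewrite eq_le; apply/andP; split; last by rewrite -(w0 0%N) zfin_le.
    rewrite leNgt; apply/negP => T0; have [n hn] := zfin_tail zT T0.
    by have := hn n (leqnn n); rewrite w0; lra.
  move: h; rewrite !w0 T0 subrr mulr0 ler_norml => /andP[_]; lra.
have [S [bS Sle]] := zfin_bounded b0 (fun M => K0 0%N M).
exists S; split => // N; rewrite (zfin_le N bS) /=.
have [T' [bT' T'le]] := zfin_bounded b0 (K0 N).
suff -> : S = T' by [].
by case: bS => _; case: bT' => _ -> [].
Qed.

Definition Zs a : R := fine (zsum (fun k => (a k)%:E)).

(** Domination makes the sums of positive and negative parts both finite, so the convention on
    [+oo - +oo] in [zsum] never intervenes. *)
Lemma zsum_approx z T a K : zfin z T -> (forall k, `|a k| <= K * z k) ->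
  zsum (fun k => (a k)%:E) = (Zs a)%:E /\
  forall N, `|Zs a - wsum N a| <= K * (T - wsum N z).
Proof.
move=> zT ha.
have hp k : 0 <= Num.max (a k) 0 <= K * z k.
  rewrite le_max lexx orbT /= ge_max; have := ha k; rewrite ler_norml => /andP[h1 h2].
  rewrite h2 /=; lra.
have hn k : 0 <= Num.max (- a k) 0 <= K * z k.
  rewrite le_max lexx orbT /= ge_max; have := ha k; rewrite ler_norml => /andP[h1 h2].
  apply/andP; split; lra.
have [P [zP hP]] := zfin_between zT hp.
have [Q [zQ hQ]] := zfin_between zT hn.
have E : zsum (fun k => (a k)%:E) = (P - Q)%:E.
  rewrite /zsum EFinB; have [_ <-] := zP; have [_ <-] := zQ.
  by congr (zsum_nn _ - zsum_nn _)%E; apply/funext => k; rewrite EFin_max.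
have -> : Zs a = P - Q by rewrite /Zs E.
split => // N.
have -> : wsum N a = wsum N (fun k => Num.max (a k) 0) - wsum N (fun k => Num.max (- a k) 0).
  rewrite -wsumN -wsumD; apply: eq_wsum => k _.
  by case: (leP (a k) 0) => h; case: (leP (- a k) 0) => h'; lra.
have /andP[p1 p2] := hP N; have /andP[q1 q2] := hQ N.
rewrite ler_norml; apply/andP; split; lra.
Qed.

(** Replaces a passage to the limit in the window: the tail of [z] falls below [e / (1 + |K|)] for
    every positive [e], whatever the sign of [K]. *)
Lemma le_of_tail z T (c d K : R) : zfin z T ->
  (exists M, forall N, (M <= N)%N -> c <= d + K * (T - wsum N z)) -> c <= d.
Proof.
move=> zT [M h]; apply/ler_addgt0Pr => e e0.
have [N hN] := zfin_tail zT (divr_gt0 e0 (ltr_pwDl ltr01 (normr_ge0 K))).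
pose L := maxn M N.
have h1 := h L (leq_maxl _ _); have h2 := hN L (leq_maxr _ _).
have h3 := zfin_le L zT.
apply: le_trans h1 _; rewrite lerD2l.
have K1 : 0 < 1 + `|K| by have := normr_ge0 K; lra.
rewrite ltr_pdivlMr // in h2.
have := ler_norm K; have := normr_ge0 K; set t := T - _ in h2 *.
have t0 : 0 <= t by rewrite /t; lra.
nra.
Qed.

Lemma Zs_linear z T a b K L x y : zfin z T ->
  (forall k, `|a k| <= K * z k) -> (forall k, `|b k| <= L * z k) ->
  Zs (fun k => x * a k + y * b k) = x * Zs a + y * Zs b.
Proof.
move=> zT ha hb.
have [_ h1] := zsum_approx zT ha; have [_ h2] := zsum_approx zT hb.
have hab k : `|x * a k + y * b k| <= (`|x| * K + `|y| * L) * z k.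
  apply: le_trans (ler_normD _ _) _; rewrite !normrM mulrDl -!mulrA.
  by apply: lerD; apply: ler_wpM2l.
have [_ h3] := zsum_approx zT hab.
suff : `|Zs (fun k => x * a k + y * b k) - (x * Zs a + y * Zs b)| <= 0.
  by rewrite normr_le0 subr_eq0 => /eqP.
apply: (@le_of_tail z T _ _ (2 * (`|x| * K + `|y| * L))) => //.
exists 0%N => N _; rewrite add0r.
have {h3} := h3 N; rewrite wsumD !wsumZ => h3.
have {}h1 := ler_wpM2l (normr_ge0 x) (h1 N).
have {}h2 := ler_wpM2l (normr_ge0 y) (h2 N).
rewrite -normrM in h1; rewrite -normrM in h2.
set A := Zs _ in h3 *; set t := T - _ in h1 h2 h3 *.
have -> : A - (x * Zs a + y * Zs b) = (A - (x * wsum N a + y * wsum N b))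
  - (x * (Zs a - wsum N a)) - (y * (Zs b - wsum N b)) by ring.
apply: le_trans (ler_normB _ _) _.
apply: le_trans (lerD (ler_normB _ _) (lexx _)) _.
lra.
Qed.

Lemma Zs_le z T a b K L : zfin z T ->
  (forall k, `|a k| <= K * z k) -> (forall k, `|b k| <= L * z k) ->
  (forall k, a k <= b k) -> Zs a <= Zs b.
Proof.
move=> zT ha hb ab.
have [_ h1] := zsum_approx zT ha; have [_ h2] := zsum_approx zT hb.
apply: (@le_of_tail z T _ _ (K + L)) => //; exists 0%N => N _.
have := h1 N; have := h2 N; rewrite !ler_norml => /andP[? ?] /andP[? ?].
have := @ler_wsum N a b (fun k _ => ab k); lra.
Qed.

Lemma Zs_eq_wsum z T a K M : zfin z T -> (forall k, `|a k| <= K * z k) ->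
  (forall k, M%:Z < `|k| -> a k = 0) -> Zs a = wsum M a.
Proof.
move=> zT ha a0; have [_ h1] := zsum_approx zT ha.
have wE N : (M <= N)%N -> wsum N a = wsum M a.
  move=> /subnK <-; elim: (N - M)%N => [|d IH] //.
  rewrite addSn wsumS !a0 ?addr0 //; lia.
suff : `|Zs a - wsum M a| <= 0 by rewrite normr_le0 subr_eq0 => /eqP.
apply: (@le_of_tail z T _ _ K) => //; exists M => N MN.
by rewrite add0r -(wE N MN).
Qed.

End WindowSum.

(** * Probability measures on the extended integers *)

Section Prob.
Variable R : realType.
Implicit Types (mu nu : zbar -> R) (f g : zbar -> R) (N : nat) (s : seq int) (c d e K L : R).

Lemma dist3 (a b a' b' e1 e2 : R) : `|a - a'| <= e1 -> `|b - b'| <= e1 ->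
  `|a' - b'| <= e2 -> `|a - b| <= e1 + e1 + e2.
Proof.
move=> h1 h2 h3.
have -> : a - b = (a - a') - (b - b') + (a' - b') by ring.
apply: le_trans (ler_normD _ _) _; apply: lerD h3.
exact: le_trans (ler_normB _ _) (lerD h1 h2).
Qed.

Definition fin_mass mu : R := 1 - mu ZNInf - mu ZPInf.
Definition zmass mu : int -> R := fun k => mu (ZFin k).

Lemma prob_zfin mu : is_prob mu -> zfin (zmass mu) (fin_mass mu).
Proof.
move=> [mu0 mu1]; split; first by move=> k; exact: mu0.
move: mu1; set Z := zsum_nn _ => mu1.
have Zfin : Z \is a fin_num.
  move: mu1; rewrite -EFinD; case: Z => [r| |] //=.
rewrite -(fineK Zfin) in mu1 *; move: mu1; rewrite -!EFinD => -[h].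
by congr EFin; rewrite /fin_mass; lra.
Qed.

Lemma zfin_prob mu : (forall x, 0 <= mu x) -> zfin (zmass mu) (fin_mass mu) ->
  is_prob mu.
Proof.
move=> mu0 [_ h]; split => //.
rewrite [zsum_nn _]h -!EFinD; congr EFin; rewrite /fin_mass; lra.
Qed.

Definition bounded_fun f := exists K, forall x, `|f x| <= K.

Lemma bounded_cst (c : R) : bounded_fun (fun _ => c).
Proof. by exists `|c|. Qed.

Lemma bounded_lin x y f g : bounded_fun f -> bounded_fun g ->
  bounded_fun (fun t => x * f t + y * g t).
Proof.
move=> [K hK] [L hL]; exists (`|x| * K + `|y| * L) => t.
apply: le_trans (ler_normD _ _) _; rewrite !normrM.
by apply: lerD; apply: ler_wpM2l.
Qed.

Lemma bounded_mass mu f K : is_prob mu -> (forall x, `|f x| <= K) ->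
  forall k, `|f (ZFin k) * mu (ZFin k)| <= K * zmass mu k.
Proof.
move=> [mu0 _] hK k; rewrite normrM (ger0_norm (mu0 _)).
by apply: ler_wpM2r; [exact: mu0|exact: hK].
Qed.

Lemma zbar_integralE mu f :
  zbar_integral mu f = f ZNInf * mu ZNInf + f ZPInf * mu ZPInf +
    Zs (fun k => f (ZFin k) * mu (ZFin k)).
Proof. by []. Qed.

Lemma integral_lin mu f g x y : is_prob mu -> bounded_fun f -> bounded_fun g ->
  zbar_integral mu (fun t => x * f t + y * g t) =
  x * zbar_integral mu f + y * zbar_integral mu g.
Proof.
move=> pmu [K hK] [L hL]; rewrite !zbar_integralE.
have := Zs_linear x y (prob_zfin pmu) (bounded_mass pmu hK) (bounded_mass pmu hL).
set S := Zs _; have -> : S = Zs (fun k => (x * f (ZFin k) + y * g (ZFin k)) * mu (ZFin k)).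
  by congr Zs; apply/funext => k; ring.
by move=> ->; ring.
Qed.

Lemma integral_le mu f g : is_prob mu -> bounded_fun f -> bounded_fun g ->
  (forall x, f x <= g x) -> zbar_integral mu f <= zbar_integral mu g.
Proof.
move=> pmu [K hK] [L hL] fg; rewrite !zbar_integralE; have [mu0 _] := pmu.
apply: lerD; first by apply: lerD; apply: ler_wpM2r.
apply: (Zs_le (prob_zfin pmu) (bounded_mass pmu hK) (bounded_mass pmu hL)) => k.
exact: ler_wpM2r.
Qed.

Lemma integral_window mu f K : is_prob mu -> (forall x, `|f x| <= K) ->
  forall N, `|zbar_integral mu f - (f ZNInf * mu ZNInf + f ZPInf * mu ZPInf +
     wsum N (fun k => f (ZFin k) * mu (ZFin k)))|
    <= K * (fin_mass mu - wsum N (zmass mu)).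
Proof.
move=> pmu hK N.
have [_ h] := zsum_approx (prob_zfin pmu) (bounded_mass pmu hK).
by apply: le_trans (h N); rewrite zbar_integralE opprD addrACA subrr add0r.
Qed.

Lemma Zs_mass mu : is_prob mu -> Zs (zmass mu) = fin_mass mu.
Proof.
move=> pmu; have pz := prob_zfin pmu; have [z0 zT] := pz.
have h k : `|zmass mu k| <= 1 * zmass mu k by rewrite mul1r ger0_norm.
have [_ {}h] := zsum_approx pz h.
apply/eqP; rewrite eq_le; apply/andP; split.
  apply: (@le_of_tail _ _ _ _ _ 0 pz); exists 0%N => N _.
  by have := h N; rewrite ler_norml => /andP[_]; lra.
apply: (@le_of_tail _ _ _ _ _ 2 pz); exists 0%N => N _.
by have := h N; rewrite ler_norml => /andP[+ _]; lra.
Qed.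

Lemma integral_cst mu c : is_prob mu -> zbar_integral mu (fun _ => c) = c.
Proof.
move=> pmu; rewrite zbar_integralE.
have pz := prob_zfin pmu; have [z0 zT] := pz.
have h k : `|zmass mu k| <= 1 * zmass mu k by rewrite mul1r ger0_norm.
have := Zs_linear c 0 pz h h; set S := Zs _.
have -> : S = Zs (fun k => c * mu (ZFin k)).
  by congr Zs; apply/funext => k; rewrite mul0r addr0.
by move=> ->; rewrite Zs_mass // /fin_mass; ring.
Qed.

Definition halfline k : zbar -> R := fun x =>
  match x with ZNInf => 0 | ZPInf => 1 | ZFin j => if k <= j then 1 else 0 end.

(** The upper tail, with the mass of [+oo] included. Indicators of half-lines are continuous on the
    extended integers, so tails are weakly continuous coordinates on the measures. *)
Definition upmass mu k : R := zbar_integral mu (halfline k).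

Lemma halfline_bounded k : bounded_fun (halfline k).
Proof.
by exists 1 => -[|j|] /=; rewrite ?normr0 ?normr1 //; case: ifP; rewrite ?normr0 ?normr1.
Qed.

Lemma halfline_ge0 k x : 0 <= halfline k x.
Proof. by case: x => [|j|] //=; case: ifP. Qed.

Lemma halfline_le1 k x : halfline k x <= 1.
Proof. by case: x => [|j|] //=; case: ifP. Qed.

Lemma upmass_ge0 mu k : is_prob mu -> 0 <= upmass mu k.
Proof.
move=> pmu; rewrite -[leLHS](integral_cst 0 pmu).
apply: integral_le => //; [exact: bounded_cst|exact: halfline_bounded|exact: halfline_ge0].
Qed.

Lemma upmass_le1 mu k : is_prob mu -> upmass mu k <= 1.
Proof.
move=> pmu; rewrite -[leRHS](integral_cst 1 pmu).
apply: integral_le => //; [exact: halfline_bounded|exact: bounded_cst|exact: halfline_le1].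
Qed.

Definition winpart N f : zbar -> R := fun x =>
  match x with ZFin j => if `|j| <= N%:Z then f x else 0 | _ => 0 end.

Lemma winpart_bounded N f : bounded_fun (winpart N f).
Proof.
exists (wsum N (fun k => `|f (ZFin k)|)) => -[|j|] /=; rewrite ?normr0 ?wsum_ge0 //.
case: ifPn => hj; rewrite ?normr0 ?wsum_ge0 //.
rewrite -(@wsum_delta _ N j (fun k => `|f (ZFin k)|)); last lia.
by apply: ler_wsum => k _; case: ifP.
Qed.

Lemma integral_winpart mu N f : is_prob mu ->
  zbar_integral mu (winpart N f) = wsum N (fun k => f (ZFin k) * mu (ZFin k)).
Proof.
move=> pmu; rewrite zbar_integralE /= !mul0r !add0r.
have [K hK] := winpart_bounded N f.
rewrite (Zs_eq_wsum (M := N) (prob_zfin pmu) (bounded_mass pmu hK)) /=; last first.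
  by move=> k hk; rewrite leNgt hk /= mul0r.
apply: eq_wsum => k hk; case: ifP => // /negP; lia.
Qed.

Lemma mass_upmass mu k : is_prob mu -> mu (ZFin k) = upmass mu k - upmass mu (k + 1).
Proof.
move=> pmu.
have := integral_lin 1 (-1) pmu (halfline_bounded k) (halfline_bounded (k + 1)).
rewrite mul1r mulN1r => <-.
have [n hn] : exists n : nat, - n%:Z <= k <= n%:Z by exists `|k|%N; lia.
have -> : (fun t => 1 * halfline k t + -1 * halfline (k + 1) t) =
   winpart n (fun x => match x with ZFin j => if j == k then 1 else 0 | _ => 0 end).
  apply/funext => -[|j|] /=; [ring| |ring].
  have [jk|jk] := eqVneq j k.
    rewrite jk lexx; have -> : (k + 1 <= k) = false by lia.
    have -> : (`|k| <= n%:Z) = true by lia.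
    by ring.
  have -> : (k + 1 <= j) = (k <= j) by lia.
  by case: ifP => _; case: ifP => _; ring.
rewrite integral_winpart // -(wsum_delta (fun k => mu (ZFin k)) hn).
by apply: eq_wsum => j _; case: ifP => _; rewrite ?mul1r ?mul0r.
Qed.

Lemma upmass_anti mu k : is_prob mu -> upmass mu (k + 1) <= upmass mu k.
Proof. by move=> pmu; rewrite -subr_ge0 -mass_upmass //; case: pmu. Qed.

Lemma upmass_window mu N : is_prob mu ->
  upmass mu (- N%:Z) - upmass mu (N%:Z + 1) = wsum N (zmass mu).
Proof.
move=> pmu; rewrite (@eq_wsum _ N (zmass mu) (fun k => - upmass mu (k + 1) - - upmass mu (k - 1 + 1))).
  rewrite (wsum_telescope N (fun k => - upmass mu (k + 1))) subrK; lra.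
by move=> k _; rewrite /zmass mass_upmass // subrK; lra.
Qed.

Lemma upmass_ge_top mu k : is_prob mu -> mu ZPInf <= upmass mu k.
Proof.
move=> pmu; have [mu0 _] := pmu; rewrite /upmass zbar_integralE /= mul0r add0r mul1r lerDl.
have [K hK] := halfline_bounded k.
have z0 : forall j : int, `|0 : R| <= 0 * zmass mu j by move=> j; rewrite normr0 mul0r.
have Z0 : Zs (fun _ : int => 0 : R) = 0.
  by rewrite (Zs_eq_wsum (M := 0%N) (prob_zfin pmu) z0) // wsum0.
rewrite -[leLHS]Z0.
apply: (@Zs_le _ _ _ (fun=> 0) (fun j => halfline k (ZFin j) * mu (ZFin j)) _ _
  (prob_zfin pmu) z0 (bounded_mass pmu hK)) => j.
by rewrite mulr_ge0 //; exact: (halfline_ge0 k (ZFin j)).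
Qed.

Lemma upmass_le_bot mu k : is_prob mu -> upmass mu k <= 1 - mu ZNInf.
Proof.
move=> pmu; have [mu0 _] := pmu; rewrite /upmass zbar_integralE /= mul0r add0r mul1r.
have [K hK] := halfline_bounded k.
have z1 j : `|zmass mu j| <= 1 * zmass mu j by rewrite mul1r ger0_norm //; exact: mu0.
rewrite addrC -lerBrDr.
have -> : 1 - mu ZNInf - mu ZPInf = Zs (zmass mu) by rewrite Zs_mass.
apply: (@Zs_le _ _ _ (fun j => halfline k (ZFin j) * mu (ZFin j)) (zmass mu) _ _
  (prob_zfin pmu) (bounded_mass pmu hK) z1) => j.
by rewrite ler_piMl //; exact: (halfline_le1 k (ZFin j)).
Qed.

Definition tailmass mu N : R := fin_mass mu - wsum N (zmass mu).

Lemma tail_small mu e : is_prob mu -> 0 < e ->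
  exists N, forall n, (N <= n)%N -> tailmass mu n < e.
Proof. by move=> pmu; exact: zfin_tail (prob_zfin pmu). Qed.

Lemma tail_ge0 mu N : is_prob mu -> 0 <= tailmass mu N.
Proof. by move=> pmu; rewrite /tailmass subr_ge0; exact: zfin_le (prob_zfin pmu). Qed.

(** The two tails at the ends of the window differ by the mass of the window, and the lower one is
    at most [1 - mu ZNInf]. *)
Lemma upmass_top_close mu N : is_prob mu ->
  mu ZPInf <= upmass mu (N%:Z + 1) <= mu ZPInf + tailmass mu N.
Proof.
move=> pmu; rewrite upmass_ge_top //=.
have := upmass_window N pmu; have := upmass_le_bot (- N%:Z) pmu.
rewrite /tailmass /fin_mass; lra.
Qed.

(** Equal to [f] on the window and to its limits outside, as [stepfunE] shows. The redundant factors
    [1] match the nested shape of [bounded_lin] and [integral_lin]. *)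
Definition stepfun N f : zbar -> R := fun x =>
  1 * (1 * (f ZNInf * 1 + (- f ZNInf) * halfline (- N%:Z) x) + 1 * winpart N f x) +
  f ZPInf * halfline (N%:Z + 1) x.

Lemma stepfunE N f x : stepfun N f x =
  match x with
  | ZFin j => if `|j| <= N%:Z then f x else if 0 <= j then f ZPInf else f ZNInf
  | _ => f x end.
Proof.
case: x => [|j|]; rewrite /stepfun; [rewrite /=; ring| |rewrite /=; ring].
have hE k : halfline k (ZFin j) = if k <= j then 1 else 0 by [].
have cE : winpart N f (ZFin j) = if `|j| <= N%:Z then f (ZFin j) else 0 by [].
rewrite !hE cE; have [hj|hj] := boolP (`|j| <= N%:Z).
  rewrite ifT; last lia.
  by rewrite ifF; [ring|lia].
case: ifPn => j0.
  rewrite ifT; last lia.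
  by rewrite ifT; [ring|lia].
rewrite ifF; last lia.
by rewrite ifF; [ring|lia].
Qed.

Definition stepfun_integral mu N f : R :=
  f ZNInf * (1 - upmass mu (- N%:Z)) + wsum N (fun k => f (ZFin k) * mu (ZFin k)) +
  f ZPInf * upmass mu (N%:Z + 1).

Lemma bounded_stepfun N f : bounded_fun (stepfun N f).
Proof.
apply: bounded_lin; last exact: halfline_bounded.
apply: bounded_lin; last exact: winpart_bounded.
by apply: bounded_lin; [exact: bounded_cst|exact: halfline_bounded].
Qed.

Lemma integral_stepfun mu N f : is_prob mu ->
  zbar_integral mu (stepfun N f) = stepfun_integral mu N f.
Proof.
move=> pmu; rewrite /stepfun.
have b1 := bounded_lin (f ZNInf) (- f ZNInf) (bounded_cst 1) (halfline_bounded (- N%:Z)).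
have b2 := bounded_lin 1 1 b1 (winpart_bounded N f).
rewrite (integral_lin _ _ pmu b2 (halfline_bounded _)) (integral_lin _ _ pmu b1 (winpart_bounded _ _)).
rewrite (integral_lin _ _ pmu (bounded_cst 1) (halfline_bounded _)) integral_winpart // integral_cst //.
rewrite /stepfun_integral /upmass; ring.
Qed.

Lemma cont_stepfun f e : zbar_continuous f -> 0 < e ->
  exists M, forall N, (M <= N)%N -> forall x, `|f x - stepfun N f x| <= e.
Proof.
move=> [fp fm] e0; have [n1 h1] := fp e e0; have [n2 h2] := fm e e0.
exists (maxn `|n1| `|n2|)%N => N MN x; rewrite stepfunE.
case: x => [|j|]; [by rewrite subrr normr0 ltW| |by rewrite subrr normr0 ltW].
case: ifPn => hj; first by rewrite subrr normr0 ltW.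
case: ifPn => j0; apply: ltW; [apply: h1|apply: h2]; lia.
Qed.

Lemma cont_bounded f : zbar_continuous f -> bounded_fun f.
Proof.
move=> cf; have [M /(_ M (leqnn M)) hM] := cont_stepfun cf ltr01.
have [K hK] := bounded_stepfun M f; exists (K + 1) => x.
rewrite -[f x](subrK (stepfun M f x)) addrC.
by apply: le_trans (ler_normD _ _) _; exact: lerD.
Qed.

Lemma integral_close mu N f e : is_prob mu -> bounded_fun f ->
  (forall x, `|f x - stepfun N f x| <= e) ->
  `|zbar_integral mu f - stepfun_integral mu N f| <= e.
Proof.
move=> pmu bf h; rewrite -integral_stepfun //.
have bs := bounded_stepfun N f; have b1 := bounded_cst 1.
have bp := bounded_lin 1 e bs b1; have bm := bounded_lin 1 (- e) bs b1.
have ab x : -e <= f x - stepfun N f x <= e by rewrite -ler_norml.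
have h1 : zbar_integral mu f <= zbar_integral mu (fun x => 1 * stepfun N f x + e * 1).
  by apply: integral_le => // x; have /andP[] := ab x; lra.
have h2 : zbar_integral mu (fun x => 1 * stepfun N f x + (- e) * 1) <= zbar_integral mu f.
  by apply: integral_le => // x; have /andP[] := ab x; lra.
rewrite (integral_lin 1 e pmu bs b1) integral_cst // in h1.
rewrite (integral_lin 1 (- e) pmu bs b1) integral_cst // in h2.
by rewrite ler_distl; move: h1 h2; rewrite !mul1r !mulr1 => -> ->.
Qed.

(** Each of the [2 * N + 1] masses is a difference of two tails and each end uses one tail, so there
    are [4 * N + 4] errors of size at most [K * d]. *)
Lemma stepfun_integral_close mu nu N f K d : is_prob mu -> is_prob nu ->
  (forall x, `|f x| <= K) ->
  (forall k, - N%:Z <= k <= N%:Z + 1 -> `|upmass nu k - upmass mu k| <= d) ->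
  `|stepfun_integral nu N f - stepfun_integral mu N f| <= (4 * N + 4)%:R * K * d.
Proof.
move=> pmu pnu hK hd.
have K0 : 0 <= K by exact: le_trans (normr_ge0 _) (hK ZNInf).
have d0 : 0 <= d by apply: le_trans (normr_ge0 _) (hd (N%:Z + 1) _); lia.
have prodb x (a : R) : `|a| <= d -> `|f x * a| <= K * d.
  by move=> ha; rewrite normrM; apply: ler_pM.
rewrite /stepfun_integral.
set W1 := wsum _ _; set W2 := wsum _ _.
have -> (a b x x' y y' w w' : R) : a * (1 - x') + w' + b * y' - (a * (1 - x) + w + b * y) =
  a * (x - x') + (w' - w) + b * (y' - y) by ring.
have hW : `|W1 - W2| <= (4 * N + 2)%:R * K * d.
  rewrite -wsumN -wsumD.
  apply: le_trans (ler_norm_wsum _ _) _.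
  apply: le_trans (_ : wsum N (fun=> 2 * (K * d)) <= _).
    apply: ler_wsum => k hk; rewrite -mulrBr (mass_upmass _ pmu) (mass_upmass _ pnu).
    have -> (a b a' b' : R) : a - b - (a' - b') = (a - a') - (b - b') by ring.
    rewrite mulrBr; apply: le_trans (ler_normB _ _) _.
    have -> : 2 * (K * d) = K * d + K * d by ring.
    by apply: lerD; apply: prodb; apply: hd; lia.
  rewrite /wsum sumr_const_nat subn0 -mulr_natr.
  have -> : (4 * N + 2 = 2 * (2 * N).+1)%N by lia.
  rewrite [(2 * (2 * N).+1)%:R]natrM -mulr_natr le_eqVlt; apply/orP; left; apply/eqP.
  by ring.
have h1 : `|f ZNInf * (upmass mu (- N%:Z) - upmass nu (- N%:Z))| <= K * d.
  by apply: prodb; rewrite distrC; apply: hd; lia.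
have h2 : `|f ZPInf * (upmass nu (N%:Z + 1) - upmass mu (N%:Z + 1))| <= K * d.
  by apply: prodb; apply: hd; lia.
apply: le_trans (ler_normD _ _) _.
apply: le_trans (lerD (le_trans (ler_normD _ _) (lerD h1 hW)) h2) _.
have -> : (4 * N + 4)%:R = (4 * N + 2)%:R + 2 :> R by rewrite -natrD -addnA.
by rewrite le_eqVlt; apply/orP; left; apply/eqP; ring.
Qed.

Lemma integral_nearby mu f e : is_prob mu -> zbar_continuous f -> 0 < e ->
  exists M (d : R), 0 < d /\ forall nu, is_prob nu ->
    (forall k, - M%:Z <= k <= M%:Z -> `|upmass nu k - upmass mu k| <= d) ->
    `|zbar_integral nu f - zbar_integral mu f| < e.
Proof.
move=> pmu cf e0; have e4 : 0 < e / 4 by lra.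
have [N /(_ N (leqnn N)) hN] := cont_stepfun cf e4.
have bf := cont_bounded cf; have [K hK] := bf.
have K0 : 0 <= K by exact: le_trans (normr_ge0 _) (hK ZNInf).
pose C := (4 * N + 4)%:R * K + 1; have C0 : 0 < C.
  by rewrite /C ltr_pwDr // mulr_ge0.
(* One more site than the window of [stepfun], because [stepfun_integral] involves the tail at
   [N + 1]. *)
exists N.+1, (e / 4 / C); split; first exact: divr_gt0.
move=> nu pnu hd.
have h1 := integral_close pmu bf hN; have h2 := integral_close pnu bf hN.
have h3 : `|stepfun_integral nu N f - stepfun_integral mu N f| <= (4 * N + 4)%:R * K * (e / 4 / C).
  by apply: stepfun_integral_close => // k hk; apply: hd; lia.
have h4 : (4 * N + 4)%:R * K * (e / 4 / C) <= e / 4.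
  rewrite mulrA ler_pdivrMr // mulrC ler_pM2l //.
  by rewrite /C lerDl.
apply: le_lt_trans (dist3 h2 h1 (le_trans h3 h4)) _.
by move: e0; clear; lra.
Qed.

(** Through this lemma the compactness argument and the lower bound see weak neighbourhoods as
    conditions on finitely many tails. *)
Lemma weak_open_basis (U : set (zbar -> R)) mu : weak_open U -> U mu ->
  exists M (d : R), 0 < d /\ forall nu, is_prob nu ->
    (forall k, - M%:Z <= k <= M%:Z -> `|upmass nu k - upmass mu k| <= d) -> U nu.
Proof.
move=> [UP Uo] Umu; have pmu := UP _ Umu.
have [fs [e [e0 [fsc h]]]] := Uo _ Umu.
suff [M [d [d0 hd]]] : exists M (d : R), 0 < d /\ forall nu, is_prob nu ->
    (forall k, - M%:Z <= k <= M%:Z -> `|upmass nu k - upmass mu k| <= d) ->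
    forall f, f \in fs -> `|zbar_integral nu f - zbar_integral mu f| < e.
  by exists M, d; split => // nu pnu hnu; apply: h => //; exact: hd.
elim: fs fsc {h} => [|f fs IH] fsc.
  by exists 0%N, 1; split => // nu _ _ f; rewrite in_nil.
have [|M1 [d1 [d10 h1]]] := IH.
  by move=> g gfs; apply: fsc; rewrite inE gfs orbT.
have [|M2 [d2 [d20 h2]]] := @integral_nearby mu f e pmu _ e0.
  by apply: fsc; rewrite inE eqxx.
exists (maxn M1 M2), (Num.min d1 d2); split; first by rewrite lt_min d10.
move=> nu pnu hnu g; rewrite inE => /predU1P[->|gfs].
  apply: h2 => // k hk; have := hnu k; rewrite le_min.
  by move=> H; have /andP[] := H ltac:(lia).
apply: h1 => // k hk; have := hnu k; rewrite le_min.
by move=> H; have /andP[] := H ltac:(lia).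
Qed.

Lemma wsum_count N s (F : int -> R) : (forall x, x \in s -> - N%:Z <= x <= N%:Z) ->
  wsum N (fun j => F j * (count (fun k => zbar_eqb (ZFin k) (ZFin j)) s)%:R) =
  \sum_(x <- s) F x.
Proof.
elim: s => [|x s IH] hs.
  by rewrite big_nil /wsum big1 // => i _; rewrite mulr0.
rewrite big_cons -IH; last by move=> y ys; apply: hs; rewrite inE ys orbT.
rewrite -(@wsum_delta _ N x F); last by apply: hs; rewrite mem_head.
rewrite -wsumD; apply: eq_wsum => j _ /=.
rewrite natrD mulrDr; congr (_ + _); rewrite eq_sym.
by case: eqP => _; rewrite ?mulr1 ?mulr0.
Qed.

Lemma seq_window s : exists N, forall x : int, x \in s -> - N%:Z <= x <= N%:Z.
Proof.
elim: s => [|x s [N IH]]; first by exists 0%N.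
exists (maxn N `|x|)%N => y; rewrite inE => /predU1P[->|/IH]; lia.
Qed.

Lemma empirical_inf s : empirical R s ZNInf = 0 /\ empirical R s ZPInf = 0.
Proof. by rewrite /empirical /=; rewrite !(eq_count (a2 := pred0)) // count_pred0 mul0r. Qed.

Lemma empirical_window s (F : int -> R) : exists M, forall N, (M <= N)%N ->
  wsum N (fun k => F k * empirical R s (ZFin k)) = (\sum_(x <- s) F x) / (size s)%:R.
Proof.
have [M hM] := seq_window s; exists M => N MN.
rewrite -(@wsum_count N); last by move=> x /hM; lia.
by rewrite mulrC -wsumZ; apply: eq_wsum => k _; rewrite /empirical [RHS]mulrC mulrA.
Qed.

Lemma empirical_prob s : s != [::] -> is_prob (empirical R s).
Proof.
move=> s0; have sz : (size s)%:R != 0 :> R by rewrite pnatr_eq0 size_eq0.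
have [em ep] := empirical_inf s.
have e0 x : 0 <= empirical R s x by rewrite /empirical divr_ge0.
apply: zfin_prob => //; rewrite /fin_mass em ep !subr0.
have [M hM] := empirical_window s (fun=> 1).
have W N : (M <= N)%N -> wsum N (zmass (empirical R s)) = 1.
  move=> /hM; rewrite big_const_seq iter_addr_0 count_predT divff // => <-.
  by apply: eq_wsum => k _; rewrite mul1r.
have W1 N : wsum N (zmass (empirical R s)) <= 1.
  by rewrite -(W (maxn M N) (leq_maxl _ _)); apply: ler_wsum_win; [move=> k; exact: e0|exact: leq_maxr].
have [T [zT T1]] := zfin_bounded (fun k => e0 (ZFin k)) W1.
suff <- : T = 1 by [].
by apply/eqP; rewrite eq_le T1 -(W M (leqnn M)) zfin_le.
Qed.

Lemma empirical_integral s f : s != [::] -> bounded_fun f ->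
  zbar_integral (empirical R s) f = (\sum_(x <- s) f (ZFin x)) / (size s)%:R.
Proof.
move=> s0 [K hK]; have pe := empirical_prob s0; have [em ep] := empirical_inf s.
have h := integral_window pe hK.
have [M hM] := empirical_window s (fun k => f (ZFin k)).
apply/eqP; rewrite -subr_eq0 -normr_le0.
apply: (@le_of_tail _ _ _ _ _ K (prob_zfin pe)); exists M => N MN.
by have := h N; rewrite em ep !mulr0 !add0r hM.
Qed.

Lemma empirical_upmass s k : s != [::] ->
  upmass (empirical R s) k = (count (fun x => k <= x) s)%:R / (size s)%:R.
Proof.
move=> s0; rewrite /upmass empirical_integral //; last exact: halfline_bounded.
congr (_ / _); elim: s {s0} => [|x s IH]; first by rewrite big_nil.
by rewrite big_cons IH /= natrD; case: ifP.
Qed.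

End Prob.

(** * Compactness *)

Section Compactness.
Variable R : realType.
Implicit Types (mu : zbar -> R) (d e : R) (M N : nat).

Lemma int_anti_le (g : int -> R) : (forall k, g (k + 1) <= g k) ->
  forall j k, j <= k -> g k <= g j.
Proof.
move=> h j k jk; have -> : k = j + `|k - j|%N%:Z by lia.
elim: `|k - j|%N => [|n IH]; first by rewrite addr0.
apply: le_trans IH; have -> : j + n.+1%:Z = j + n%:Z + 1 by lia.
exact: h.
Qed.

Definition upfun (g : int -> R) :=
  (forall k, 0 <= g k <= 1) /\ (forall k, g (k + 1) <= g k).

Lemma upfun_upmass mu : is_prob mu -> upfun (upmass mu).
Proof.
move=> pmu; split=> k; last exact: upmass_anti.
by rewrite upmass_ge0 // upmass_le1.
Qed.

(** The limits of [g] give the masses at the two ends and its increments the masses of the integers.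
    The tail of this measure then has the increments of [g], so it differs from [g] by a constant,
    which vanishes at [+oo]. *)
Lemma upmass_surj (g : int -> R) : upfun g ->
  exists mu, is_prob mu /\ forall k, upmass mu k = g k.
Proof.
move=> [g01 ga]; have gle := int_anti_le ga.
have g0 : range g !=set0 by exists (g 0), 0.
have hi : has_inf (range g).
  by split => //; exists 0 => _ [k _ <-]; have /andP[] := g01 k.
have hs : has_sup (range g).
  by split => //; exists 1 => _ [k _ <-]; have /andP[] := g01 k.
have infg k : inf (range g) <= g k by apply: ge_inf; [case: hi|exists k].
have supg k : g k <= sup (range g) by apply: ub_le_sup; [case: hs|exists k].
pose mu x := match x with
  | ZFin k => g k - g (k + 1) | ZPInf => inf (range g) | ZNInf => 1 - sup (range g) end.
have mu0 x : 0 <= mu x.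
  case: x => [|k|] /=.
  - by rewrite subr_ge0; apply: ge_sup => // _ [k _ <-]; have /andP[] := g01 k.
  - by rewrite subr_ge0.
  - by apply: lb_le_inf => // _ [k _ <-]; have /andP[] := g01 k.
have W N : wsum N (zmass mu) = g (- N%:Z) - g (N%:Z + 1).
  have -> : wsum N (zmass mu) = wsum N (fun k => - g (k + 1) - - g (k - 1 + 1)).
    by apply: eq_wsum => k _; rewrite /zmass /mu subrK opprK addrC.
  rewrite (wsum_telescope N (fun k => - g (k + 1))) subrK; lra.
have fm : fin_mass mu = sup (range g) - inf (range g).
  rewrite /fin_mass /mu; lra.
have Wle N : wsum N (zmass mu) <= fin_mass mu.
  by rewrite W fm lerB.
have close e : 0 < e -> exists N, g (N%:Z + 1) < inf (range g) + e /\
    sup (range g) - e < g (- N%:Z).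
  move=> e0.
  have [_ [k1 _ <-] h1] := inf_adherent e0 hi.
  have [_ [k2 _ <-] h2] := sup_adherent e0 hs.
  exists (maxn `|k1| `|k2|)%N; split.
    by apply: le_lt_trans h1; apply: gle; lia.
  by apply: lt_le_trans h2 _; apply: gle; lia.
have pmu : is_prob mu.
  apply: zfin_prob => //.
  have [T [zT Tle]] := zfin_bounded (fun k => mu0 (ZFin k)) Wle.
  suff <- : T = fin_mass mu by [].
  apply/eqP; rewrite eq_le Tle /= fm; apply/ler_addgt0Pr => e e0.
  have e2 : 0 < e / 2 by lra.
  have [N [h1 h2]] := close _ e2; have := zfin_le N zT; rewrite W; lra.
exists mu; split => //.
have hc k : upmass mu k - g k = upmass mu (k + 1) - g (k + 1).
  have := mass_upmass k pmu; rewrite /mu /=; lra.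
have hcN k N : upmass mu k - g k = upmass mu (k + N%:Z) - g (k + N%:Z).
  elim: N => [|N ->]; first by rewrite addr0.
  by rewrite hc; have -> : k + N.+1%:Z = k + N%:Z + 1 by lia.
move=> k; apply/eqP; rewrite -subr_eq0 -normr_le0.
apply/ler_addgt0Pr => e e0; rewrite add0r.
have [N1 h1] := tail_small pmu e0; have [N2 [h2 _]] := close e e0.
pose N := (maxn (maxn N1 N2) `|k|)%N.
have -> : upmass mu k - g k = upmass mu (N%:Z + 1) - g (N%:Z + 1).
  pose j : int := N%:Z + 1 - k; rewrite (hcN k (absz j)).
  by have -> : k + (absz j)%:Z = N%:Z + 1 by rewrite /j /N; lia.
have /andP[h3 h4] := upmass_top_close N pmu.
have h5 : tailmass mu N < e by apply: h1; rewrite /N; lia.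
have h6 : g (N%:Z + 1) <= g (N2%:Z + 1) by apply: gle; rewrite /N; lia.
have := infg (N%:Z + 1); rewrite /mu in h3 h4 => h7.
rewrite ler_norml; apply/andP; split; lra.
Qed.

Let T : topologicalType := prod_topology (fun _ : int => R : topologicalType).

Lemma near_proj (g0 : T) M d : 0 < d ->
  \forall g \near g0, forall k, - M%:Z <= k <= M%:Z -> `|(g : T) k - g0 k| <= d.
Proof.
move=> d0.
have P k : \forall g \near g0, `|(g : T) k - g0 k| <= d.
  have nb : nbhs (g0 k : R) [set x : R | `|x - g0 k| <= d].
    by apply/nbhs_ballP; exists d => //= x; rewrite /ball /= distrC => /ltW.
  exact: (@proj_continuous int (fun=> R : topologicalType) k g0 _ nb).
elim: M => [|M IH].
  by apply: filterS (P 0) => g hg k hk; have -> : k = 0 by lia.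
apply: filterS3 IH (P M.+1%:Z) (P (- M.+1%:Z)) => g h1 h2 h3 k hk.
have [->//|n1] := eqVneq k M.+1%:Z; have [->//|n2] := eqVneq k (- M.+1%:Z).
apply: h1; lia.
Qed.

(** Tychonoff's theorem for functions with values in [[0, 1]], monotonicity being a closed
    condition. *)
Lemma upfun_compact : compact [set g : T | upfun g].
Proof.
have -> : [set g : T | upfun g] =
    (\bigcap_k [set g : T | g (k + 1) <= g k]) `&` [set g : T | forall k, [set` `[0, 1]] (g k : R)].
  apply/seteqP; split => [g [h1 h2]|g [h1 h2]].
    split => [k _|k]; first exact: h2.
    by rewrite /= in_itv /=; exact: h1.
  split => k; last exact: h1.
  by have := h2 k; rewrite /= in_itv.
rewrite setIC; apply: compact_closedI.
  apply: (@tychonoff int (fun=> R : topologicalType) (fun=> [set` `[0, 1]])) => _.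
  exact: segment_compact.
apply: closed_bigI => k _.
have -> : [set g : T | g (k + 1) <= g k] =
    (fun g : T => g k - g (k + 1)) @^-1` [set x | 0 <= x].
  by apply/seteqP; split => g /=; rewrite subr_ge0.
have pc j : continuous (fun g : T => g j : R).
  exact: (@proj_continuous int (fun=> R : topologicalType) j).
apply: preimage_closed; last exact: closed_ge.
move=> g _; exact: (cvgB (pc k g) (pc (k + 1) g)).
Qed.

Lemma weak_closed_compact (K : set (zbar -> R)) : weak_closed K -> weak_compact K.
Proof.
move=> [KP coK]; split => // C Cop KC.
(* Transfer of [G] to tail functions. The interior is open by definition, and [weak_open_basis]
   shows that it still contains the tails of all points of [G]. *)
pose O (G : set (zbar -> R)) : set T :=
  interior [set g : T | forall mu, is_prob mu -> (forall k, upmass mu k = g k) -> G mu].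
(* Adding the complement of [K] turns the cover of [K] into a cover of the whole compact space. *)
pose D := [set G | C G \/ G = @is_prob R `\` K].
have Do G : D G -> weak_open G by move=> [/Cop|->].
have OG mu G : D G -> G mu -> O G (upmass mu).
  move=> /Do Gop Gmu; have [M [d [d0 h]]] := weak_open_basis Gop Gmu.
  have : nbhs (upmass mu : T) [set g : T | forall mu0, is_prob mu0 ->
      (forall k, upmass mu0 k = g k) -> G mu0].
    apply: filterS (near_proj (upmass mu) M d0) => g hg nu pnu nug.
    by apply: h => // k hk; rewrite nug; exact: hg.
  by [].
have /compact_near_coveringP ncov := upfun_compact.
(* The filter of large enough finite families: along it, the near-covering form of compactness
   produces one finite subcover. *)
pose F := [set S : set (seq (set (zbar -> R))) |
  exists s0 : seq _, forall s : seq _, {subset s0 <= s} -> S s].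
have FF : Filter F.
  split; first by exists [::].
    move=> P Q [s1 h1] [s2 h2]; exists (s1 ++ s2) => s hs; split.
      by apply: h1 => G Gs; apply: hs; rewrite mem_cat Gs.
    by apply: h2 => G Gs; apply: hs; rewrite mem_cat Gs orbT.
  by move=> P Q PQ [s1 h1]; exists s1 => s /h1 /PQ.
have := ncov _ F (fun (s : seq (set (zbar -> R))) (g : T) => exists G, [/\ G \in s, D G & O G g]) FF.
case.
  move=> g gX; have [mu [pmu mug]] := upmass_surj gX.
  have -> : g = upmass mu by apply/funext => k; rewrite mug.
  have {g gX mug}[G DG Gmu] : exists2 G, D G & G mu.
    have [Kmu|nKmu] := pselect (K mu).
      by have [G CG Gmu] := KC _ Kmu; exists G => //; left.
    by exists (@is_prob R `\` K); [right|].
  exists (O G, [set s : seq (set (zbar -> R)) | G \in s]).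
    split => /=; last by exists [:: G] => s; apply; rewrite mem_head.
    by apply: open_nbhs_nbhs; split; [exact: open_interior|exact: OG].
  by move=> [g s] /= [Og Gs]; exists G.
move=> s /(_ s (fun _ => id)) cov.
exists [seq G <- s | `[< C G >]]; split.
  by move=> G; rewrite mem_filter => /andP[/asboolP].
move=> mu Kmu; have pmu := KP _ Kmu.
have [G [Gs DG OGmu]] := cov _ (upfun_upmass pmu).
have Gmu : G mu by have := interior_subset OGmu; apply.
exists G => //=; rewrite mem_filter Gs andbT; apply/asboolP.
by case: DG => // Ge; move: Gmu; rewrite Ge => -[_].
Qed.

End Compactness.

(** * Exponential rates and Cramer constants *)

Section ExpRates.
Variable R : realType.
Implicit Types (P : nat -> R) (a b C e : R).

Lemma limn_esup_le_near (u : nat -> \bar R) (c : \bar R) n0 :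
  (forall n, (n0 <= n)%N -> (u n <= c)%E) -> (limn_esup u <= c)%E.
Proof.
move=> h; rewrite limn_esup_lim; apply: lime_le; first exact: is_cvg_esups.
exists n0 => // n /= n0n; apply: ge_ereal_sup => _ [k /= nk <-].
by apply: h; exact: leq_trans nk.
Qed.

Lemma limn_einf_ge_near (u : nat -> \bar R) (c : \bar R) n0 :
  (forall n, (n0 <= n)%N -> (c <= u n)%E) -> (c <= limn_einf u)%E.
Proof.
move=> h; rewrite limn_einf_lim; apply: lime_ge; first exact: is_cvg_einfs.
exists n0 => // n /= n0n; apply: le_ereal_inf_tmp => _ [k /= nk <-].
by apply: h; exact: leq_trans nk.
Qed.

Definition exp_rate P : nat -> \bar R := fun n => ((n%:R^-1)%:E * elog (P n))%E.

Lemma exp_rate_ge P b n0 :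
  (forall n, (n0 <= n)%N -> expR (- (n%:R * b)) <= P n) ->
  ((- b)%:E <= limn_einf (exp_rate P))%E.
Proof.
(* The successor keeps [n] positive, hence [n^-1] a true inverse. *)
move=> h; apply: (@limn_einf_ge_near _ _ n0.+1) => n n0n.
have Pn := h n (ltnW n0n); have Pp : 0 < P n by exact: lt_le_trans (expR_gt0 _) Pn.
rewrite /exp_rate /elog Pp -EFinM lee_fin mulrC.
have n_gt0 : 0 < n%:R :> R by rewrite ltr0n; exact: leq_trans n0n.
rewrite ler_pdivlMr // mulNr mulrC -[- _]expRK.
by rewrite ler_ln // posrE expR_gt0.
Qed.

Lemma exp_rate_le P a C n0 :
  (forall n, (n0 <= n)%N -> P n <= C * expR (- (n%:R * a))) ->
  (limn_esup (exp_rate P) <= (- a)%:E)%E.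
Proof.
move=> h; apply/lee_addgt0Pr => e e0.
(* A prefactor at least [1] that dominates [C]; [ln D <= n * e] eventually, so it does not affect
   the rate. *)
pose D := 1 + `|C|; have D1 : 1 <= D by rewrite /D lerDl.
have D0 : 0 < D by exact: lt_le_trans D1.
have [n1 hn1] : exists n1 : nat, ln D / e <= n1%:R.
  by exists (Num.truncn (ln D / e)).+1; rewrite ltW // real_truncnS_gt ?num_real.
apply: (@limn_esup_le_near _ _ (maxn n0 n1).+1) => n.
rewrite gtn_max => /andP[n0n n1n].
have n_gt0 : 0 < n%:R :> R by rewrite ltr0n; exact: leq_trans n0n.
rewrite /exp_rate /elog; case: ifPn => Pp; last first.
  by rewrite gt0_muleNy ?leNye // lte_fin invr_gt0.
rewrite -EFinD -EFinM lee_fin mulrC ler_pdivrMr //.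
have Pn : P n <= D * expR (- (n%:R * a)).
  apply: le_trans (h n (ltnW n0n)) _; apply: ler_wpM2r; first exact: expR_ge0.
  by rewrite /D; have := ler_norm C; lra.
have : ln (P n) <= ln (D * expR (- (n%:R * a))).
  by rewrite ler_ln ?posrE // mulr_gt0 // expR_gt0.
rewrite lnM ?posrE ?expR_gt0 // expRK => h1; apply: le_trans h1 _.
have h2 : ln D <= n%:R * e.
  by rewrite -ler_pdivrMr //; apply: le_trans hn1 _; rewrite ler_nat ltnW.
lra.
Qed.

End ExpRates.

Section CramerConstants.
Variable R : realType.
Implicit Types (q x t z : R).

Definition logmgf q t : R := ln (q * expR t + (1 - q) * expR (- t)).

(* [tilt0 q] minimises [logmgf q]; clipping it to the slopes that keep [exp (t k)]
   bounded below at [+oo] (resp. at [-oo]) gives the infimum of the Cramer function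
   over [0, 1] (resp. [-1, 0]). *)
Definition tilt0 q : R := ln ((1 - q) / q) / 2.
Definition tiltR q : R := Num.max (tilt0 q) 0.
Definition tiltL q : R := Num.min (tilt0 q) 0.

Lemma mgf_gt0 q t : 0 < q < 1 -> 0 < q * expR t + (1 - q) * expR (- t).
Proof.
move=> /andP[q0 q1]; rewrite addr_gt0 // mulr_gt0 ?expR_gt0 //; lra.
Qed.

Lemma logmgf0 q : logmgf q 0 = 0.
Proof. by rewrite /logmgf oppr0 expR0 !mulr1 addrC subrK ln1. Qed.

(** At [tilt0 q] the two terms of the moment generating function are equal. Squaring their sum
    avoids square roots. *)
Lemma logmgf_tilt0 q : 0 < q < 1 -> logmgf q (tilt0 q) = ln (4 * q * (1 - q)) / 2.
Proof.
move=> /andP[q0 q1]; have q1' : 0 < 1 - q by lra.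
set t := tilt0 q; have e0 := expR_gt0 t.
have e2 : expR t ^+ 2 = (1 - q) / q.
  by rewrite expr2 -expRD /t /tilt0 -splitr lnK // posrE divr_gt0.
have e2' : q * expR t ^+ 2 = 1 - q by rewrite e2 mulrC divfK // gt_eqF.
have E : (q * expR t + (1 - q) * expR (- t)) ^+ 2 = 4 * q * (1 - q).
  have -> : (1 - q) * expR (- t) = q * expR t.
    by rewrite expRN -e2' expr2 mulrA mulfK // gt_eqF.
  by rewrite -e2'; ring.
have p := mgf_gt0 t (introT andP (conj q0 q1)).
rewrite -E expr2 lnM // /logmgf; move: (ln _) => x; lra.
Qed.

End CramerConstants.

(** * Gibbs' inequality and duality for the Cramer function *)

Section Gibbs.
Variable R : realType.
Implicit Types (x y s t q A B : R).

(** The inequality [ln r <= r - 1] at [r = A * s / x], multiplied by [x]. *)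
Lemma xlnx_tangent x s A : 0 <= x -> 0 < s -> 0 < A ->
  x * ln A <= x * ln (x / s) + (A * s - x).
Proof.
move=> x0 s0 A0; have [->|xn0] := eqVneq x 0.
  by rewrite !mul0r add0r subr0 mulr_ge0 // ltW.
have xp : 0 < x by rewrite lt_def xn0.
have r0 : 0 < A * s / x by rewrite !mulr_gt0 // invr_gt0.
have : ln (A * s / x) <= A * s / x - 1.
  rewrite -{1}(subrK 1 (A * s / x)) addrC; apply: le_ln1Dx; lra.
have -> : A * s / x = A / (x / s) by rewrite invf_div mulrA.
rewrite ln_div ?posrE ?divr_gt0 // => h.
have := ler_wpM2l x0 h.
have -> : x * (A / (x / s) - 1) = A * s - x.
  by rewrite invf_div mulrBr mulr1 mulrCA [x * _]mulrCA divff // mulr1.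
rewrite mulrBr; move: (x * ln A) (x * ln (x / s)) (A * s) => a b c; lra.
Qed.

(** Two tangent inequalities with [s = x + y]; the sum of their remainders is nonpositive because
    [A + B <= 1]. *)
Lemma gibbs x y A B : 0 <= x -> 0 <= y -> 0 < A -> 0 < B -> A + B <= 1 ->
  x * ln A + y * ln B <= x * ln (x / (x + y)) + y * ln (y / (x + y)).
Proof.
move=> x0 y0 A0 B0 AB; have [s0|sn0] := eqVneq (x + y) 0.
  have -> : x = 0 by lra.
  have -> : y = 0 by lra.
  by rewrite !mul0r.
have s0 : 0 < x + y by rewrite lt_def sn0 addr_ge0.
have h1 := xlnx_tangent x0 s0 A0; have h2 := xlnx_tangent y0 s0 B0.
have h3 : A * (x + y) + B * (x + y) <= x + y by rewrite -mulrDl ler_piMl // ltW.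
move: h1 h2 h3.
move: (x * ln A) (y * ln B) (x * ln _) (y * ln _) (A * _) (B * _) => a b c d e f.
lra.
Qed.

(** Gibbs' inequality against the tilted law, whose weights are [q * expR t] and
    [(1 - q) * expR (- t)] divided by their sum. *)
Lemma I_Cr_dual q x t : 0 < q < 1 -> -1 <= x <= 1 ->
  ((t * x - logmgf q t)%:E <= I_Cr q x)%E.
Proof.
move=> hq /andP[x1 x2]; rewrite /I_Cr x1 x2 /= lee_fin.
have /andP[q0 q1] := hq; have q1' : 0 < 1 - q by lra.
have M0 := mgf_gt0 t hq.
set M := q * expR t + (1 - q) * expR (- t) in M0.
have e (u c : R) : 0 <= u -> 0 < c -> u / 2 * ln (u / (2 * c)) = u / 2 * (ln (u / 2) - ln c).
  move=> u0 c0; have [->|un0] := eqVneq u 0; first by rewrite !mul0r.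
  have up : 0 < u by rewrite lt_def un0.
  by rewrite -ln_div ?posrE ?divr_gt0 // invfM [u * (_ * _)]mulrA.
rewrite (e (1 - x)) ?(e (1 + x)) //; [|lra|lra].
have [a aE] : exists a, a = (1 - x) / 2 by exists ((1 - x) / 2).
have [b bE] : exists b, b = (1 + x) / 2 by exists ((1 + x) / 2).
rewrite -aE -bE.
have a0 : 0 <= a by lra.
have b0 : 0 <= b by lra.
have ab : b + a = 1 by lra.
have tx : t * x = b * t - a * t by rewrite aE bE; lra.
have A0 : 0 < (1 - q) * expR (- t) / M by rewrite divr_gt0 // mulr_gt0 // expR_gt0.
have B0 : 0 < q * expR t / M by rewrite divr_gt0 // mulr_gt0 // expR_gt0.
have := gibbs b0 a0 B0 A0; rewrite ab !divr1 -mulrDl divff ?gt_eqF // => /(_ (lexx _)).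
rewrite tx /logmgf -/M.
rewrite !ln_div ?posrE ?mulr_gt0 ?expR_gt0 // !lnM ?posrE ?expR_gt0 // !expRK.
move: (ln q) (ln (1 - q)) (ln M) (ln b) (ln a) => lq lq' lM lb la.
have : (b + a) * lM = lM by rewrite ab mul1r.
rewrite !(mulrBr, mulrDr, mulrDl).
move: (b * lq) (b * lM) (b * lb) (a * lq') (a * lM) (a * la) (b * t) (a * t).
clear; intros; lra.
Qed.

Lemma I_Cr0 q : 0 < q < 1 -> I_Cr q 0 = (- logmgf q (tilt0 q))%:E.
Proof.
move=> hq; have /andP[q0 q1] := hq; have q1' : 0 < 1 - q by lra.
rewrite /I_Cr ifT; last by apply/andP; split; lra.
rewrite logmgf_tilt0 // subr0 addr0 !mul1r !lnV ?posrE ?mulr_gt0 //.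
have -> : 4 * q * (1 - q) = (2 * q) * (2 * (1 - q)) by ring.
rewrite [ln (2 * q * _)]lnM ?posrE ?mulr_gt0 //; congr EFin; move: (ln (2 * q)) (ln (2 * (1 - q))) => a b; lra.
Qed.

Lemma I_Cr_mean q : 0 < q < 1 -> I_Cr q (2 * q - 1) = 0%E.
Proof.
move=> /andP[q0 q1]; rewrite /I_Cr ifT; last by apply/andP; split; lra.
have -> : 1 - (2 * q - 1) = 2 * (1 - q) by ring.
have -> : 1 + (2 * q - 1) = 2 * q by ring.
by rewrite !divff ?mulf_neq0 ?ln1 ?mulr0 ?addr0 //; lra.
Qed.

Lemma tilt0_ge0 q : 0 < q < 1 -> q <= 2^-1 -> 0 <= tilt0 q.
Proof.
move=> /andP[q0 q1] h; rewrite /tilt0 divr_ge0 // ln_ge0 //.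
by rewrite ler_pdivlMr //; lra.
Qed.

Lemma tilt0_le0 q : 0 < q < 1 -> 2^-1 <= q -> tilt0 q <= 0.
Proof.
move=> /andP[q0 q1] h; rewrite /tilt0 pmulr_lle0 ?invr_gt0 // ln_le0 //.
by rewrite ler_pdivrMr //; lra.
Qed.

(** The tilt [tiltR q] is nonnegative, so [tiltR q * x >= 0] on [[0, 1]] and duality gives the lower
    bound. It is attained at [0] when [q <= 1/2], and otherwise at the mean [2 * q - 1], where the
    Cramer function vanishes. *)
Lemma inf_Cr_right q : 0 < q < 1 ->
  ereal_inf [set I_Cr q x | x in [set x : R | 0 <= x <= 1]] = (- logmgf q (tiltR q))%:E.
Proof.
move=> hq; apply/eqP; rewrite eq_le; apply/andP; split; last first.
  apply: le_ereal_inf_tmp => _ [x /= /andP[x0 x1] <-].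
  have hx : -1 <= x <= 1 by apply/andP; split => //; lra.
  apply: le_trans (I_Cr_dual (tiltR q) hq hx); rewrite lee_fin lerDr mulr_ge0 //.
  by rewrite /tiltR le_max lexx orbT.
apply: ereal_inf_lbound; have [h|h] := leP q 2^-1.
  exists 0; first by rewrite /= lexx ler01.
  by rewrite I_Cr0 // /tiltR max_l // tilt0_ge0.
exists (2 * q - 1); first by case/andP: hq => ? ?; apply/andP; split; lra.
by rewrite I_Cr_mean // /tiltR max_r ?logmgf0 ?oppr0 // tilt0_le0 // ltW.
Qed.

Lemma inf_Cr_left q : 0 < q < 1 ->
  ereal_inf [set I_Cr q x | x in [set x : R | -1 <= x <= 0]] = (- logmgf q (tiltL q))%:E.
Proof.
move=> hq; apply/eqP; rewrite eq_le; apply/andP; split; last first.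
  apply: le_ereal_inf_tmp => _ [x /= /andP[x0 x1] <-].
  have hx : -1 <= x <= 1 by apply/andP; split => //; lra.
  apply: le_trans (I_Cr_dual (tiltL q) hq hx); rewrite lee_fin lerDr mulr_le0 //.
  by rewrite /tiltL ge_min lexx orbT.
apply: ereal_inf_lbound; have [h|h] := leP 2^-1 q.
  exists 0; first by rewrite /= lexx lerN10.
  by rewrite I_Cr0 // /tiltL min_l // tilt0_le0.
exists (2 * q - 1); first by case/andP: hq => ? ?; apply/andP; split; lra.
by rewrite I_Cr_mean // /tiltL min_r ?logmgf0 ?oppr0 // tilt0_ge0 // ltW.
Qed.

End Gibbs.

(** * The Donsker-Varadhan functional and its test functions *)

Section StepV.
Variables (R : realType) (p : int -> R).
Hypothesis p01 : forall k, 0 < p k < 1.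
Implicit Types (w nu : int -> R) (c K M : R) (mu : zbar -> R).

(* With [u = expR \o w], [stepV w] is the integrand [ln (u / P u)] of the
   Donsker-Varadhan functional. *)
Definition stepV w (k : int) : R :=
  w k - ln (p k * expR (w (k + 1)) + (1 - p k) * expR (w (k - 1))).

Lemma stepavg_gt0 w k : 0 < p k * expR (w (k + 1)) + (1 - p k) * expR (w (k - 1)).
Proof.
have /andP[h0 h1] := p01 k; rewrite addr_gt0 // mulr_gt0 ?expR_gt0 //; lra.
Qed.

Lemma expR_stepV w k :
  expR (stepV w k) * (p k * expR (w (k + 1)) + (1 - p k) * expR (w (k - 1))) = expR (w k).
Proof.
have h := stepavg_gt0 w k.
by rewrite /stepV expRD expRN lnK ?posrE // mulfVK // gt_eqF.
Qed.

Lemma convex_le (q a b d : R) : 0 < q < 1 -> a <= d -> b <= d -> q * a + (1 - q) * b <= d.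
Proof.
move=> /andP[q0 q1] ad bd; have -> : d = q * d + (1 - q) * d by ring.
by apply: lerD; apply: ler_wpM2l => //; lra.
Qed.

Lemma convex_ge (q a b d : R) : 0 < q < 1 -> d <= a -> d <= b -> d <= q * a + (1 - q) * b.
Proof.
move=> /andP[q0 q1] ad bd; have -> : d = q * d + (1 - q) * d by ring.
by apply: lerD; apply: ler_wpM2l => //; lra.
Qed.

Lemma stepV_ge w k M : w (k + 1) <= M -> w (k - 1) <= M -> w k - M <= stepV w k.
Proof.
move=> h1 h2; rewrite /stepV lerD2l lerN2 -[leRHS]expRK.
rewrite ler_ln ?posrE ?expR_gt0 ?stepavg_gt0 //.
by apply: convex_le; rewrite ?ler_expR.
Qed.

Lemma stepV_le w k M : M <= w (k + 1) -> M <= w (k - 1) -> stepV w k <= w k - M.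
Proof.
move=> h1 h2; rewrite /stepV lerD2l lerN2 -[leLHS]expRK.
rewrite ler_ln ?posrE ?expR_gt0 ?stepavg_gt0 //.
by apply: convex_ge; rewrite ?ler_expR.
Qed.

Lemma stepV_bound w k K : `|w (k + 1) - w k| <= K -> `|w k - w (k - 1)| <= K ->
  `|stepV w k| <= K.
Proof.
rewrite !ler_norml => /andP[h1 h2] /andP[h3 h4].
have h5 := @stepV_ge w k (w k + K) ltac:(lra) ltac:(lra).
have h6 := @stepV_le w k (w k - K) ltac:(lra) ltac:(lra).
apply/andP; split; lra.
Qed.

Lemma stepV_shift w c k : stepV (fun j => w j + c) k = stepV w k.
Proof.
rewrite /stepV; set u := p k * _ + _; set v := p k * _ + _.
have -> : u = v * expR c by rewrite /u /v !expRD; ring.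
rewrite lnM ?posrE ?expR_gt0 ?stepavg_gt0 // expRK; move: (ln v) => l; lra.
Qed.

Lemma stepV_local w w' k : w k = w' k -> w (k + 1) = w' (k + 1) ->
  w (k - 1) = w' (k - 1) -> stepV w k = stepV w' k.
Proof. by rewrite /stepV => -> -> ->. Qed.

Lemma stepV_anti w w' k : w' k = w k -> w' (k + 1) <= w (k + 1) ->
  w' (k - 1) <= w (k - 1) -> stepV w k <= stepV w' k.
Proof.
move=> e h1 h2; rewrite /stepV e lerD2l lerN2 ler_ln ?posrE ?stepavg_gt0 //.
have /andP[p0 p1] := p01 k.
by apply: lerD; apply: ler_wpM2l; rewrite ?ler_expR //; lra.
Qed.

Lemma stepV_cst k : stepV (fun _ => 0) k = 0.
Proof. by rewrite /stepV expR0 !mulr1 [p k + _]addrC subrK ln1 subr0. Qed.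

Lemma I_DV_ge nu w : (forall k, 0 <= w k) ->
  (zsum (fun k => (nu k * stepV w k)%:E) <= I_DV p nu)%E.
Proof.
move=> w0; apply: ereal_sup_ubound; exists (fun k => expR (w k)).
  by move=> k; rewrite -expR0 ler_expR.
congr zsum; apply/funext => k; rewrite ln_div ?posrE ?expR_gt0 ?stepavg_gt0 //.
by rewrite expRK.
Qed.

Lemma I_DV_gt nu (a : \bar R) : (a < I_DV p nu)%E ->
  exists w, (forall k, 0 <= w k) /\ (a < zsum (fun k => (nu k * stepV w k)%:E))%E.
Proof.
move=> /ereal_sup_gt [_ [u u1 <-] h]; exists (fun k => ln (u k)); split.
  by move=> k; apply: ln_ge0; exact: u1.
apply: lt_le_trans h _; rewrite le_eqVlt; apply/orP; left; apply/eqP.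
congr zsum; apply/funext => k.
have u0 j : 0 < u j by apply: lt_le_trans (u1 j).
rewrite /stepV !lnK ?posrE // ln_div ?posrE //.
have := stepavg_gt0 (fun k => ln (u k)) k.
by rewrite !lnK ?posrE.
Qed.

Lemma zsum_nn_scale c nu : 0 < c ->
  zsum_nn (fun k => (c * nu k)%:E) = (c%:E * zsum_nn (fun k => (nu k)%:E))%E.
Proof.
move=> c0; rewrite !zsum_nnE -ereal_supZl ?ltW //; last first.
  by apply/set0P; exists (wsum 0 nu)%:E, 0%N.
congr ereal_sup; apply/seteqP; split.
  by move=> _ [N _ <-]; exists (wsum N nu)%:E; [exists N|rewrite wsumZ EFinM].
by move=> _ [_ [N _ <-] <-]; exists N => //; rewrite wsumZ EFinM.
Qed.

Lemma zsum_scale c nu : 0 < c ->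
  zsum (fun k => (c * nu k)%:E) = (c%:E * zsum (fun k => (nu k)%:E))%E.
Proof.
move=> c0; have e f : (fun k : int => Order.max (f k : R)%:E 0%E) = (fun k => (Num.max (f k) 0)%:E).
  by apply/funext => k; rewrite -EFin_max.
have ec f : (fun k => (Num.max (c * f k) 0)%:E) = (fun k : int => (c * Num.max (f k) 0)%:E).
  by apply/funext => k; rewrite maxr_pMr ?ltW // mulr0.
have pos f : (0 <= zsum_nn (fun k : int => (Num.max (f k) 0 : R)%:E))%E.
  rewrite zsum_nnE; apply: le_trans (ereal_sup_ubound (imageP _ (I : [set: nat] 0%N))).
  by rewrite lee_fin wsum_ge0 // => k _; rewrite le_max lexx orbT.
rewrite /zsum !e ec.
under [X in (_ - zsum_nn X)%E]eq_fun do rewrite -mulrN.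
rewrite (ec (fun k => - nu k)) !zsum_nn_scale //.
move: (pos nu) (pos (fun k => - nu k)); move: (zsum_nn _) (zsum_nn _) => P Q.
have c0' : (0 < c%:E)%E by rewrite lte_fin.
case: P Q => [x| |] [y| |] //= _ _; rewrite ?gt0_muley //= ?gt0_muleNy //.
by congr EFin; rewrite mulrBr.
Qed.

(** Homogeneity replaces [a0 * I_DV mu0] by [I_DV] of the unnormalised restriction [zmass mu], after
    which the decomposition of [mu] can be forgotten. *)
Lemma I_DV_scale c nu : 0 < c -> I_DV p (fun k => c * nu k) = (c%:E * I_DV p nu)%E.
Proof.
move=> c0; rewrite /I_DV -ereal_supZl ?ltW //; last first.
  by apply/set0P; eexists; exists (fun=> 1); [move=> k /=|reflexivity].
congr ereal_sup; apply/seteqP; split.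
  move=> _ [u u1 <-]; eexists; first by exists u; [exact: u1|reflexivity].
  by rewrite -zsum_scale //; congr zsum; apply/funext => k; rewrite mulrA.
move=> _ [_ [u u1 <-] <-]; exists u => //.
by rewrite -zsum_scale //; congr zsum; apply/funext => k; rewrite mulrA.
Qed.

Lemma zsum0 : zsum (fun _ : int => (0 : R)%:E) = 0%E.
Proof.
have w0 N : wsum N (fun _ : int => 0 : R) <= 0 by rewrite /wsum big1.
have [T [zT _]] := zfin_bounded (fun _ : int => lexx (0 : R)) w0.
have b0 (k : int) : `|0 : R| <= 0 * 0 by rewrite normr0 mul0r.
have [-> _] := zsum_approx zT b0.
by rewrite (Zs_eq_wsum (M := 0%N) zT b0) // wsum0.
Qed.

Lemma I_DV0 : I_DV p (fun _ => 0) = 0%E.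
Proof.
apply/eqP; rewrite eq_le; apply/andP; split.
  apply: ge_ereal_sup => _ [u u1 <-].
  by under eq_fun do rewrite mul0r; rewrite zsum0.
apply: ereal_sup_ubound; exists (fun=> 1) => //.
by under eq_fun do rewrite mul0r; rewrite zsum0.
Qed.

Lemma zmass_null mu : is_prob mu -> fin_mass mu = 0 -> zmass mu = fun=> 0.
Proof.
move=> pmu m0; apply/funext => k; have [z0 zT] := prob_zfin pmu.
apply/eqP; rewrite eq_le z0 andbT -m0.
have [n hn] : exists n : nat, - n%:Z <= k <= n%:Z by exists `|k|%N; lia.
apply: le_trans (zfin_le n (prob_zfin pmu)).
rewrite -(wsum_delta (zmass mu) hn); apply: ler_wsum => j _.
by case: ifP.
Qed.

(** Both expressions of the minimum have this form: slopes [tilt0 pm], [tiltR pp] for the first and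
    [tiltL pm], [tilt0 pp] for the second. *)
Definition endcost (pm pp : R) tm tp mu : R :=
  mu ZNInf * - logmgf pm tm + mu ZPInf * - logmgf pp tp.

Lemma rate_IE pm pp mu : 0 < pm < 1 -> 0 < pp < 1 -> is_prob mu ->
  rate_I p pm pp mu = (I_DV p (zmass mu) +
    Order.min (endcost pm pp (tilt0 pm) (tiltR pp) mu)%:E
              (endcost pm pp (tiltL pm) (tilt0 pp) mu)%:E)%E.
Proof.
move=> hm hp pmu; rewrite /rate_I !I_Cr0 // inf_Cr_right // inf_Cr_left //.
congr (_ + Order.min _ _)%E; last by rewrite -!EFinM -EFinD addrC.
rewrite -/(fin_mass mu).
have m0 : 0 <= fin_mass mu.
  by have := zfin_le 0%N (prob_zfin pmu); apply: le_trans; apply: wsum_ge0 => k _; have [mu0 _] := pmu; exact: mu0.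
(* Without mass on the integers both sides vanish: the left one as a product by [0], the right one
   as [I_DV] of the zero function. *)
have [e|mn0] := eqVneq (fin_mass mu) 0; first by rewrite e mul0e zmass_null // I_DV0.
rewrite -I_DV_scale; last by rewrite lt_def mn0.
by congr I_DV; apply/funext => k; rewrite mulrC divfK.
Qed.

End StepV.

(** * Test functions that are affine near both ends *)

Section Nice.
Variables (R : realType) (p : int -> R) (pm pp : R).
Implicit Types (w : int -> R) (mu : zbar -> R) (tm tp a e : R).

(** Both slopes are taken in the increasing direction, so [w] is bounded below at [+oo] when
    [0 <= tp] and at [-oo] when [tm <= 0]. *)
Definition affine_ends tm tp w := exists N : nat,
  (forall k, N%:Z <= k -> w (k + 1) = w k + tp) /\
  (forall k, k <= - N%:Z -> w (k - 1) = w k - tm).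

Definition testV tm tp w : zbar -> R := fun x => match x with
  | ZNInf => - logmgf pm tm | ZPInf => - logmgf pp tp | ZFin k => stepV p w k end.

Lemma affine_lipschitz tm tp w : affine_ends tm tp w ->
  exists K, forall k, `|w (k + 1) - w k| <= K.
Proof.
move=> [N [hp hm]].
exists (`|tm| + `|tp| + wsum N (fun k => `|w (k + 1) - w k|)) => k.
have W0 : 0 <= wsum N (fun k => `|w (k + 1) - w k|) by apply: wsum_ge0.
have [k1|k1] := leP N%:Z k.
  by rewrite hp // addrAC subrr add0r; have := normr_ge0 tm; lra.
have [k2|k2] := leP k (- N%:Z - 1).
  have -> : w k = w (k + 1) - tm by rewrite -hm; [congr w|]; lia.
  by rewrite opprB addrC subrK; have := normr_ge0 tp; lra.
have hk : - N%:Z <= k <= N%:Z by lia.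
have : `|w (k + 1) - w k| <= wsum N (fun k => `|w (k + 1) - w k|).
  rewrite -{1}(wsum_delta (fun k => `|w (k + 1) - w k|) hk).
  by apply: ler_wsum => j _; case: ifP.
have := normr_ge0 tp; have := normr_ge0 tm; lra.
Qed.

Lemma logmgf_cont q t e : 0 < q < 1 -> 0 < e -> exists2 d, 0 < d &
  forall q', 0 < q' < 1 -> `|q' - q| < d -> `|- logmgf q' t - - logmgf q t| < e.
Proof.
move=> hq e0; have M0 := mgf_gt0 t hq.
have : nbhs (ln (q * expR t + (1 - q) * expR (- t))) (ball (ln (q * expR t + (1 - q) * expR (- t))) e).
  exact: nbhsx_ballx.
move=> /(continuous_ln M0) /nbhs_ballP [d /= d0 hd].
pose D := 1 + `|expR t - expR (- t)|; have D0 : 0 < D by rewrite ltr_pwDl.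
exists (d / D); first exact: divr_gt0.
move=> q' hq' qq'; rewrite opprK addrC /logmgf.
apply: hd; rewrite /ball /=.
have -> : q * expR t + (1 - q) * expR (- t) - (q' * expR t + (1 - q') * expR (- t)) =
  (q - q') * (expR t - expR (- t)) by ring.
rewrite normrM distrC; apply: le_lt_trans (_ : `|q' - q| * D < d); last by rewrite -ltr_pdivlMr.
by apply: ler_wpM2l => //; rewrite /D lerDr.
Qed.

Hypothesis p01 : forall k, 0 < p k < 1.
Hypothesis hpm : forall e : R, 0 < e -> exists N : int, forall k : int, k <= N -> `|p k - pm| < e.
Hypothesis hpp : forall e : R, 0 < e -> exists N : int, forall k : int, N <= k -> `|p k - pp| < e.
Hypotheses (hpm01 : 0 < pm < 1) (hpp01 : 0 < pp < 1).

(** Where [w] has slope [t] on both sides of [k], [stepV p w k] equals [- logmgf (p k) t], which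
    converges together with [p k]. This dictates the values of [testV] at the two ends. *)
Lemma testV_cont tm tp w : affine_ends tm tp w -> zbar_continuous (testV tm tp w).
Proof.
move=> [N [hp hm]]; split => e e0 /=.
  have [d d0 hd] := logmgf_cont tp hpp01 e0; have [M hM] := hpp d0.
  exists (Num.max (N%:Z + 1) M) => k; rewrite ge_max => /andP[k1 k2].
  have -> : stepV p w k = - logmgf (p k) tp; last exact: hd _ (hM _ k2).
  have e1 := hp k ltac:(lia); have e2 := hp (k - 1) ltac:(lia).
  rewrite subrK in e2.
  have E1 : w (k + 1) - w k = tp by rewrite e1 addrAC subrr add0r.
  have E2 : w (k - 1) - w k = - tp by rewrite e2 opprD addrA subrr add0r.
  by rewrite -(stepV_shift p01 w (- w k)) /stepV subrr sub0r E1 E2.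
have [d d0 hd] := logmgf_cont tm hpm01 e0; have [M hM] := hpm d0.
exists (Num.min (- N%:Z - 1) M) => k; rewrite le_min => /andP[k1 k2].
have -> : stepV p w k = - logmgf (p k) tm; last exact: hd _ (hM _ k2).
have e1 := hm k ltac:(lia); have e2 := hm (k + 1) ltac:(lia).
rewrite addrK in e2.
have E1 : w (k + 1) - w k = tm by rewrite e2 opprB addrC subrK.
have E2 : w (k - 1) - w k = - tm by rewrite e1 addrAC subrr add0r.
by rewrite -(stepV_shift p01 w (- w k)) /stepV subrr sub0r E1 E2.
Qed.

End Nice.

(** * The rate as a supremum of integrals of continuous functions *)

Section Variational.
Variables (R : realType) (p : int -> R) (pm pp : R).
Hypothesis p01 : forall k, 0 < p k < 1.
Implicit Types (w : int -> R) (mu : zbar -> R) (tm tp a c e K : R).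

Lemma mass_dominated mu (V : int -> R) K : is_prob mu -> (forall k, `|V k| <= K) ->
  forall k, `|V k * zmass mu k| <= K * zmass mu k.
Proof.
move=> [mu0 _] VK k; rewrite normrM (ger0_norm (mu0 (ZFin k))).
by apply: ler_wpM2r; [exact: mu0|exact: VK].
Qed.

Lemma Zs_mass_le_IDV mu w K : is_prob mu -> (forall k, 0 <= w k) ->
  (forall k, `|stepV p w k| <= K) ->
  ((Zs (fun k => stepV p w k * zmass mu k))%:E <= I_DV p (zmass mu))%E.
Proof.
move=> pmu w0 VK; apply: le_trans (I_DV_ge p01 _ w0).
have [h _] := zsum_approx (prob_zfin pmu) (mass_dominated pmu VK).
by rewrite -h; under [X in (_ <= zsum X)%E]eq_fun do rewrite mulrC.
Qed.

Lemma stepV_lip w K : (forall k, `|w (k + 1) - w k| <= K) -> forall k, `|stepV p w k| <= K.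
Proof.
move=> wK k; apply: stepV_bound => //.
by have := wK (k - 1); rewrite subrK.
Qed.

Lemma integral_testV mu tm tp w : zbar_integral mu (testV p pm pp tm tp w) =
  endcost pm pp tm tp mu + Zs (fun k => stepV p w k * zmass mu k).
Proof. by rewrite zbar_integralE /endcost /= mulrC [_ * mu ZPInf]mulrC. Qed.

Lemma win_bound N w k : - N%:Z <= k <= N%:Z -> `|w k| <= wsum N (fun j => `|w j|).
Proof.
move=> hk; rewrite -(wsum_delta (fun j => `|w j|) hk).
by apply: ler_wsum => j _; case: ifP.
Qed.

(* [max w (- A) + A] is nonnegative and, by the Lipschitz bound, costs only the mass
   outside the window where it differs from [w + A]. *)
Lemma integral_le_rate mu tm tp w : is_prob mu -> affine_ends tm tp w ->
  ((zbar_integral mu (testV p pm pp tm tp w))%:E <=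
    I_DV p (zmass mu) + (endcost pm pp tm tp mu)%:E)%E.
Proof.
move=> pmu aw; rewrite integral_testV addrC EFinD; apply: leeD => //.
have [K wK] := affine_lipschitz aw; have VK := stepV_lip wK.
have K0 : 0 <= K by exact: le_trans (normr_ge0 _) (wK 0).
apply/lee_addgt0Pr => e e0.
(* The mass outside the window is charged [K] for [w] and [K] for its truncation [w']. *)
have K1 : 0 < 2 * K + 1 by lra.
have [N /(_ N (leqnn N)) hN] := tail_small pmu (divr_gt0 e0 K1).
pose A := wsum N.+1 (fun j => `|w j|).
pose w' k := Num.max (w k) (- A) + A.
have w'0 k : 0 <= w' k by rewrite /w' -lerBlDr sub0r le_max lexx orbT.
have w'K k : `|w' (k + 1) - w' k| <= K.
  have := wK k; rewrite /w' !ler_norml => /andP[h1 h2].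
  by apply/andP; split; case: (leP (w k) (- A)); case: (leP (w (k + 1)) (- A)) => *; lra.
have w'E k : - N.+1%:Z <= k <= N.+1%:Z -> w' k = w k + A.
  move=> /win_bound - /(_ w); rewrite ler_norml => /andP[h _].
  by rewrite /w' max_l.
have VE k : - N%:Z <= k <= N%:Z -> stepV p w' k = stepV p w k.
  move=> hk; rewrite -(stepV_shift p01 w A); apply: stepV_local => //; apply: w'E; lia.
have V'K := stepV_lip w'K.
apply: le_trans (_ : ((Zs (fun k => stepV p w' k * zmass mu k)) + e)%:E <= _)%E; last first.
  by rewrite EFinD; apply: leeD => //; exact: Zs_mass_le_IDV V'K.
rewrite lee_fin.
have [_ /(_ N) h1] := zsum_approx (prob_zfin pmu) (mass_dominated pmu VK).
have [_ /(_ N) h2] := zsum_approx (prob_zfin pmu) (mass_dominated pmu V'K).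
have We : wsum N (fun k => stepV p w' k * zmass mu k) = wsum N (fun k => stepV p w k * zmass mu k).
  by apply: eq_wsum => k hk; rewrite VE.
have t0 := tail_ge0 N pmu.
rewrite ltr_pdivlMr // in hN.
rewrite /tailmass in hN t0; rewrite We in h2.
have {}h1 := le_trans (ler_norm _) h1.
rewrite distrC in h2; have {}h2 := le_trans (ler_norm _) h2.
move: h1 h2 hN t0; move: (Zs _) (Zs _) (wsum _ _) (fin_mass mu - _) => z1 z2 W t h1 h2 hN t0.
rewrite mulrDr mulr1 mulrCA [t * K]mulrC in hN.
move: (K * t) h1 h2 hN t0 => u; clear; intros; lra.
Qed.

Lemma wsum_trunc M N (F : int -> R) : (M <= N)%N ->
  wsum N (fun k => if `|k| <= M%:Z then F k else 0) = wsum M F.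
Proof.
move=> /subnK <-; elim: (N - M)%N => [|d IH].
  apply: eq_wsum => k hk; case: ifP => //; lia.
by rewrite addSn wsumS IH !ifF ?addr0 //; lia.
Qed.

(* Capping [w] at [A] lowers [stepV] only to [0], and the capped function is then
   continued affinely outside a large window. *)
Lemma rate_lt_integral mu tm tp a : is_prob mu ->
  (a%:E < I_DV p (zmass mu) + (endcost pm pp tm tp mu)%:E)%E ->
  exists w, affine_ends tm tp w /\ a < zbar_integral mu (testV p pm pp tm tp w).
Proof.
move=> pmu; set c := endcost _ _ _ _ _; rewrite -lteBlDr // -EFinB => /(I_DV_gt p01).
move=> [w [w0]].
have -> : (fun k => (zmass mu k * stepV p w k)%:E) = (fun k => (stepV p w k * zmass mu k)%:E).
  by apply/funext => k; rewrite mulrC.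
pose F k := stepV p w k * zmass mu k.
pose Fp k := Num.max (F k) 0; pose Fn k := Num.max (- F k) 0.
have -> : zsum (fun k => (stepV p w k * zmass mu k)%:E) =
  (zsum_nn (fun k => (Fp k)%:E) - zsum_nn (fun k => (Fn k)%:E))%E.
  by congr (zsum_nn _ - zsum_nn _)%E; apply/funext => k; rewrite /Fp /Fn EFin_max.
have Fn0 k : 0 <= Fn k by rewrite le_max lexx orbT.
have Fp0 k : 0 <= Fp k by rewrite le_max lexx orbT.
have Q0 : (0 <= zsum_nn (fun k => (Fn k)%:E))%E.
  rewrite zsum_nnE; apply: le_trans (ereal_sup_ubound (imageP _ (I : [set: nat] 0%N))).
  by rewrite lee_fin wsum_ge0.
(* If the negative parts diverge, the sum is [-oo] by convention and exceeds nothing. *)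
have [Qy|[Q QE]] : zsum_nn (fun k => (Fn k)%:E) = +oo%E \/
    exists Q, zsum_nn (fun k => (Fn k)%:E) = Q%:E.
  by case: (zsum_nn (fun k => (Fn k)%:E)) Q0 => [x| |] // _; [right; exists x|left].
  by rewrite Qy /= addeNy.
rewrite QE lteBrDr // -EFinD => /= h.
have zQ : zfin Fn Q by split.
move: h; rewrite zsum_nnE => /ereal_sup_gt [_ [N _ <-]]; rewrite lte_fin => hN.
pose A := wsum N.+1 (fun j => `|w j|).
have A0 : 0 <= A by apply: wsum_ge0.
pose w1 k := Num.min (w k) A.
have w10 k : 0 <= w1 k <= A by rewrite /w1 le_min w0 A0 ge_min lexx orbT.
have V1 k : Num.min (stepV p w k) 0 <= stepV p w1 k.
  have [hk|hk] := leP (w k) A.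
    apply: le_trans (_ : stepV p w k <= _); first by rewrite ge_min lexx.
    apply: stepV_anti => //; rewrite /w1 ?ge_min ?lexx //; exact: min_l.
  apply: le_trans (_ : 0 <= _); first by rewrite ge_min lexx orbT.
  have e : w1 k = A by rewrite /w1 min_r // ltW.
  have /andP[_ h1] := w10 (k + 1); have /andP[_ h2] := w10 (k - 1).
  by have := stepV_ge p01 h1 h2; rewrite e subrr.
(* On the window the cap [A] is inactive at [k] and can only lower the neighbours, so nothing is
   lost there. *)
have V1N k : - N%:Z <= k <= N%:Z -> stepV p w k <= stepV p w1 k.
  move=> hk; apply: stepV_anti => //; rewrite /w1 ?ge_min ?lexx //.
  rewrite min_l //; apply: le_trans (ler_norm _) _; apply: win_bound; lia.
pose K := A + `|tm| + `|tp|; pose K' := K + `|logmgf pm tm| + `|logmgf pp tp|.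
have K'0 : 0 <= K' by rewrite /K' /K; do !apply: addr_ge0.
pose et := wsum N Fp - Q - (a - c).
have et0 : 0 < et by rewrite /et; lra.
have [M hM] := tail_small pmu (divr_gt0 et0 (ltr_pwDl ltr01 K'0)).
pose L := maxn N M; pose B : int := L%:Z + 1.
have B0 : 0 < B by rewrite /B; lia.
(* The affine pieces start afresh from [0] at [B] and [- B], without matching [w1]. The resulting
   jump is at most [A] plus a slope, so [K] bounds all increments whatever the window [L], which
   could thus be chosen after [K]. *)
pose w2 k := if B < k then tp * (k - B)%:~R
  else if k < - B then tm * (k + B)%:~R else w1 k.
have w2_in k : - B <= k <= B -> w2 k = w1 k.
  by move=> /andP[k1 k2]; rewrite /w2 ltNge k2 /= ltNge k1.
have aff : affine_ends tm tp w2.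
  exists L.+2; split => k hk; rewrite /w2.
    rewrite !ifT; [|rewrite /B; lia|rewrite /B; lia].
    have -> : k + 1 - B = k - B + 1 by lia.
    by rewrite [(k - B + 1)%:~R]intrD mulrDr mulr1z mulr1.
  rewrite ifF; last by rewrite /B; lia.
  rewrite ifT; last by rewrite /B; lia.
  rewrite ifF; last by rewrite /B; lia.
  rewrite ifT; last by rewrite /B; lia.
  have -> : k - 1 + B = k + B - 1 by lia.
  by rewrite [(k + B - 1)%:~R]intrB mulrBr mulr1z mulr1.
have w2K k : `|w2 (k + 1) - w2 k| <= K.
  have tm0 := normr_ge0 tm; have tp0 := normr_ge0 tp.
  have [k1|k1] := ltP B k.
    rewrite /w2 ifT; last by lia.
    rewrite k1 -mulrBr -intrB.
    have -> : k + 1 - B - (k - B) = 1 by lia.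
    by rewrite mulr1z mulr1 /K; lra.
  have [k2|k2] := ltP k (- B - 1).
    have -> : w2 (k + 1) = tm * (k + 1 + B)%:~R.
      have b1 : (B < k + 1) = false by lia.
      have b2 : (k + 1 < - B) = true by lia.
      by rewrite /w2 b1 b2.
    have -> : w2 k = tm * (k + B)%:~R.
      have b1 : (B < k) = false by lia.
      have b2 : (k < - B) = true by lia.
      by rewrite /w2 b1 b2.
    rewrite -mulrBr -intrB.
    have -> : k + 1 + B - (k + B) = 1 by lia.
    by rewrite mulr1z mulr1 /K; lra.
  have [k3|k3] := eqVneq k B.
    have -> : w2 (k + 1) = tp.
      rewrite /w2 ifT; last by lia.
      by rewrite k3 addrAC subrr add0r mulr1z mulr1.
    rewrite k3 w2_in; last by rewrite /B; lia.
    have /andP[? ?] := w10 B; apply: le_trans (ler_normB _ _) _.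
    rewrite [`|w1 _|]ger0_norm // /K; lra.
  have [k4|k4] := eqVneq k (- B - 1).
    have -> : w2 k = - tm.
      rewrite /w2 ifF; last by rewrite /B in k4 *; lia.
      rewrite ifT; last by lia.
      by rewrite k4 addrAC addNr add0r mulrN1z mulrN1.
    rewrite k4 subrK w2_in; last by rewrite /B; lia.
    have /andP[? ?] := w10 (- B); rewrite opprK; apply: le_trans (ler_normD _ _) _.
    rewrite [`|w1 _|]ger0_norm // /K; lra.
  rewrite !w2_in; [|lia|lia].
  have /andP[? ?] := w10 k; have /andP[? ?] := w10 (k + 1).
  rewrite ler_norml /K; apply/andP; split; lra.
exists w2; split => //.
have V2 k : - L%:Z <= k <= L%:Z -> stepV p w2 k = stepV p w1 k.
  by move=> hk; apply: stepV_local; apply: w2_in; rewrite /B; lia.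
have bV x : `|testV p pm pp tm tp w2 x| <= K'.
  have h1 := normr_ge0 (logmgf pm tm); have h2 := normr_ge0 (logmgf pp tp).
  have h3 : 0 <= K by rewrite /K; do !apply: addr_ge0.
  case: x => [|k|] /=; rewrite ?normrN.
  - by rewrite /K'; lra.
  - by apply: le_trans (stepV_lip w2K k) _; rewrite /K'; lra.
  - by rewrite /K'; lra.
have := integral_window pmu bV L.
have hL : tailmass mu L < et / (1 + K') by apply: hM; rewrite /L; lia.
have K'1 : 0 < 1 + K' by exact: ltr_pwDl.
rewrite ltr_pdivlMr // in hL.
have W : wsum N Fp - Q <= wsum L (fun k => testV p pm pp tm tp w2 (ZFin k) * mu (ZFin k)).
  apply: le_trans (_ : wsum N Fp - wsum L Fn <= _).
    by rewrite lerD2l lerN2; exact: zfin_le.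
  rewrite -(@wsum_trunc N L Fp) ?leq_maxl // -wsumN -wsumD; apply: ler_wsum => k hk.
  have m0 : 0 <= zmass mu k by have [mu0 _] := pmu; exact: mu0.
  rewrite /= V2 // -/(zmass mu k).
  have FE : F k = Fp k - Fn k.
    by rewrite /Fp /Fn; case: (leP (F k) 0) => ?; case: (leP (- F k) 0) => ?; lra.
  case: ifP => hkN.
    by rewrite -FE; apply: ler_wpM2r => //; apply: V1N; lia.
  rewrite add0r; apply: le_trans (_ : Num.min (stepV p w k) 0 * zmass mu k <= _); last first.
    exact: ler_wpM2r.
  by rewrite minr_pMl // mul0r /Fn oppr_max opprK oppr0.
rewrite ler_norml => /andP[h1 _].
have t0 := tail_ge0 L pmu.
have ec : testV p pm pp tm tp w2 ZNInf * mu ZNInf + testV p pm pp tm tp w2 ZPInf * mu ZPInf = c.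
  by rewrite /c /endcost /= mulrC [_ * mu ZPInf]mulrC.
rewrite ec in h1; rewrite /tailmass in hL t0.
move: h1 W hL t0; rewrite /et.
move: (zbar_integral _ _) (wsum N Fp) (wsum L _) (fin_mass mu - _) => I0 W2 W1 t.
rewrite mulrDr mulr1 [t * K']mulrC; move: (K' * t) => u; clear; intros; lra.
Qed.

End Variational.

(** * Goodness and upper bound *)

Section Goodness.
Variables (R : realType) (p : int -> R) (pm pp : R).
Implicit Types (w : int -> R) (mu nu : zbar -> R) (tm tp a c e q : R).

Lemma integrals_gt_open a (f1 f2 : zbar -> R) :
  zbar_continuous f1 -> zbar_continuous f2 ->
  weak_open [set nu | is_prob nu /\ (a < zbar_integral nu f1 /\ a < zbar_integral nu f2)].
Proof.
move=> c1 c2; split; first by move=> nu [].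
move=> mu [pmu [h1 h2]].
exists [:: f1; f2], (Num.min (zbar_integral mu f1 - a) (zbar_integral mu f2 - a)).
split; first by rewrite lt_min !subr_gt0 h1 h2.
split; first by move=> f; rewrite !inE => /orP[/eqP->|/eqP->].
move=> nu pnu h; split; first exact: pnu.
have g1 := h f1 (mem_head _ _).
have g2 : `|zbar_integral nu f2 - zbar_integral mu f2| <
    Num.min (zbar_integral mu f1 - a) (zbar_integral mu f2 - a).
  by apply: h; rewrite !inE eqxx orbT.
move: g1 g2 h1 h2.
move: (zbar_integral nu f1) (zbar_integral nu f2) (zbar_integral mu f1) (zbar_integral mu f2).
move=> x y u v; rewrite !lt_min !ltr_norml => /andP[/andP[g1 _] _] /andP[_ /andP[g2 _]].
by move: g1 g2; clear; intros; split; lra.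
Qed.

Lemma affine_bounded_right tm tp w : affine_ends tm tp w -> 0 <= tp ->
  exists c, forall y, 0 <= y -> c <= w y.
Proof.
move=> [N [hp _]] tp0; exists (- wsum N (fun j => `|w j|)) => y y0.
have hin k : - N%:Z <= k <= N%:Z -> - wsum N (fun j => `|w j|) <= w k.
  by move=> /win_bound - /(_ _ w); rewrite ler_norml => /andP[].
have [yN|yN] := leP y N%:Z; first by apply: hin; lia.
have -> : y = N%:Z + `|y - N%:Z|%N%:Z by lia.
elim: `|y - N%:Z|%N => [|d IH]; first by rewrite addr0; apply: hin; lia.
apply: le_trans IH _; have -> : N%:Z + d.+1%:Z = N%:Z + d%:Z + 1 by lia.
by rewrite hp ?lerDl //; lia.
Qed.

Lemma affine_bounded_left tm tp w : affine_ends tm tp w -> tm <= 0 ->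
  exists c, forall y, y <= 0 -> c <= w y.
Proof.
move=> [N [_ hm]] tm0; exists (- wsum N (fun j => `|w j|)) => y y0.
have hin k : - N%:Z <= k <= N%:Z -> - wsum N (fun j => `|w j|) <= w k.
  by move=> /win_bound - /(_ _ w); rewrite ler_norml => /andP[].
have [yN|yN] := leP (- N%:Z) y; first by apply: hin; lia.
pose j : int := y + N%:Z; have -> : y = - N%:Z - `|j|%N%:Z by rewrite /j; lia.
elim: `|j|%N => [|d IH]; first by rewrite subr0; apply: hin; lia.
apply: le_trans IH _; have -> : - N%:Z - d.+1%:Z = - N%:Z - d%:Z - 1 by lia.
by rewrite hm ?lerDl ?oppr_ge0 //; lia.
Qed.

Lemma neg_logmgf_ge0 q : 0 < q < 1 -> 0 <= - logmgf q (tilt0 q).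
Proof.
move=> hq; have h0 : -1 <= (0 : R) <= 1 by rewrite lerN10 ler01.
have := I_Cr_dual 0 hq h0; rewrite I_Cr0 // lee_fin logmgf0; lra.
Qed.

Lemma neg_logmgfR_ge0 q : 0 < q < 1 -> 0 <= - logmgf q (tiltR q).
Proof.
move=> hq; rewrite /tiltR; case: (leP (tilt0 q) 0) => _.
  by rewrite logmgf0 oppr0.
exact: neg_logmgf_ge0.
Qed.

Lemma neg_logmgfL_ge0 q : 0 < q < 1 -> 0 <= - logmgf q (tiltL q).
Proof.
move=> hq; rewrite /tiltL; case: (leP (tilt0 q) 0) => _.
  exact: neg_logmgf_ge0.
by rewrite logmgf0 oppr0.
Qed.

Hypothesis p01 : forall k, 0 < p k < 1.
Hypothesis hpm : forall e : R, 0 < e -> exists N : int, forall k : int, k <= N -> `|p k - pm| < e.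
Hypothesis hpp : forall e : R, 0 < e -> exists N : int, forall k : int, N <= k -> `|p k - pp| < e.
Hypotheses (hpm01 : 0 < pm < 1) (hpp01 : 0 < pp < 1).

Let I1 mu := (I_DV p (zmass mu) + (endcost pm pp (tilt0 pm) (tiltR pp) mu)%:E)%E.
Let I2 mu := (I_DV p (zmass mu) + (endcost pm pp (tiltL pm) (tilt0 pp) mu)%:E)%E.

Lemma rate_I_min mu : is_prob mu -> rate_I p pm pp mu = Order.min (I1 mu) (I2 mu).
Proof.
move=> pmu; rewrite rate_IE // /I1 /I2.
set c := endcost _ _ _ _ _; set d := endcost _ _ _ _ _.
have [cd|/ltW cd] := leP c%:E d%:E.
  by rewrite min_l //; exact: leeD2l.
by rewrite min_r //; exact: leeD2l.
Qed.

Lemma I_DV_ge0 (nu : int -> R) : (0 <= I_DV p nu)%E.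
Proof.
apply: le_trans (I_DV_ge p01 nu (w := fun=> 0) (fun=> lexx _)).
by under eq_fun do rewrite stepV_cst mulr0; rewrite zsum0.
Qed.

Lemma rate_I_ge0 mu : is_prob mu -> (0 <= rate_I p pm pp mu)%E.
Proof.
move=> pmu; rewrite rate_I_min // /I1 /I2; have [mu0 _] := pmu.
have ec tm tp : 0 <= - logmgf pm tm -> 0 <= - logmgf pp tp -> (0 <= (endcost pm pp tm tp mu)%:E)%E.
  by move=> h1 h2; rewrite lee_fin addr_ge0 // mulr_ge0.
rewrite le_min; apply/andP; split; apply: adde_ge0; rewrite ?I_DV_ge0 //; apply: ec.
- exact: neg_logmgf_ge0.
- exact: neg_logmgfR_ge0.
- exact: neg_logmgfL_ge0.
- exact: neg_logmgf_ge0.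
Qed.

(* A half-space of test integrals, one test function for each end at which the
   walk may finish. *)
Definition halfspace a (w : (int -> R) * (int -> R)) : set (zbar -> R) :=
  [set nu | is_prob nu /\
    (a < zbar_integral nu (testV p pm pp (tilt0 pm) (tiltR pp) w.1) /\
     a < zbar_integral nu (testV p pm pp (tiltL pm) (tilt0 pp) w.2))].

Definition affine_pair (w : (int -> R) * (int -> R)) :=
  affine_ends (tilt0 pm) (tiltR pp) w.1 /\ affine_ends (tiltL pm) (tilt0 pp) w.2.

Lemma halfspace_open a (w : (int -> R) * (int -> R)) : affine_pair w -> weak_open (halfspace a w).
Proof. by move=> [a1 a2]; apply: integrals_gt_open; exact: testV_cont. Qed.

Lemma rate_gt_halfspace a mu : is_prob mu -> (a%:E < rate_I p pm pp mu)%E ->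
  exists w : (int -> R) * (int -> R), affine_pair w /\ halfspace a w mu.
Proof.
move=> pmu; rewrite rate_I_min // lt_min => /andP[h1 h2].
have [w1 [a1 g1]] := rate_lt_integral p01 pmu h1.
have [w2 [a2 g2]] := rate_lt_integral p01 pmu h2.
exists (w1, w2); exact: (conj (conj a1 a2) (conj pmu (conj g1 g2))).
Qed.

Lemma halfspace_rate_gt a (w : (int -> R) * (int -> R)) mu : affine_pair w -> halfspace a w mu ->
  (a%:E < rate_I p pm pp mu)%E.
Proof.
move=> [a1 a2] [pmu [h1 h2]]; rewrite rate_I_min // lt_min; apply/andP; split.
  by apply: lt_le_trans (integral_le_rate pm pp p01 pmu a1); rewrite lte_fin; exact: h1.
by apply: lt_le_trans (integral_le_rate pm pp p01 pmu a2); rewrite lte_fin; exact: h2.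
Qed.

(** The complement of the level set is the union of the open sets [halfspace a w];
    [rate_gt_halfspace] and [halfspace_rate_gt] are the two inclusions. *)
Lemma level_closed a : weak_closed [set mu | is_prob mu /\ (rate_I p pm pp mu <= a%:E)%E].
Proof.
split; first by move=> mu [].
split; first by move=> mu [].
move=> mu [pmu nmu].
have h : (a%:E < rate_I p pm pp mu)%E.
  by rewrite ltNge; apply/negP => h; apply: nmu.
have [w [aw hw]] := rate_gt_halfspace pmu h.
have [_ /(_ _ hw) [fs [e [e0 [fc H]]]]] := halfspace_open a aw.
exists fs, e; split => //; split => // nu pnu hnu; split => // -[_ hle].
have := halfspace_rate_gt aw (H _ pnu hnu); by rewrite ltNge hle.
Qed.

Lemma rate_I_good : good_rate_function (rate_I p pm pp).
Proof.
split; first exact: rate_I_ge0.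
by split=> a; [exact: level_closed|apply: weak_closed_compact; exact: level_closed].
Qed.

End Goodness.

(** * Exponential upper bounds for half-spaces and closed sets *)

Section UpperBound.
Variables (R : realType) (p : int -> R) (pm pp : R).
Implicit Types (w : int -> R) (mu nu : zbar -> R) (tm tp a c e q : R) (s : seq int).
Hypothesis p01 : forall k, 0 < p k < 1.

Lemma p_stochastic : stochastic p.
Proof. by move=> k; have /andP[h1 h2] := p01 k; rewrite !ltW. Qed.

Lemma walkE_martingale w m n :
  walkE p m n (fun s y => expR (\sum_(x <- s) stepV p w x) * expR (w y)) = expR (w m).
Proof.
elim: n m => [|n IH] m /=; first by rewrite big_nil expR0 mul1r.
have e x : walkE p x n (fun s y => expR (\sum_(x <- m :: s) stepV p w x) * expR (w y)) =
    expR (stepV p w m) * expR (w x).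
  rewrite -IH -walkEZ; apply: walkE_ext => s y.
  by rewrite big_cons expRD mulrA.
by rewrite !e -[RHS](expR_stepV p01 w m) mulrDr; congr (_ + _); rewrite mulrCA.
Qed.

Lemma walk_chernoff w (J : int -> Prop) c a m n :
  (forall y, J y -> c <= w y) ->
  walkE p m n (fun s y => pind R (n%:R * a <= \sum_(x <- s) stepV p w x /\ J y))
    <= expR (w m - c) * expR (- (n%:R * a)).
Proof.
move=> Jc; rewrite [expR (w m - c)]expRD -(walkE_martingale w m n) -[leRHS]mulrA [leRHS]mulrC -walkEZ.
apply: walkE_le; first exact: p_stochastic.
move=> s y _ _; have [[h1 h2]|h] := pselect (n%:R * a <= \sum_(x <- s) stepV p w x /\ J y).
  rewrite pindT // -!expRD -[leLHS]expR0 ler_expR; have := Jc _ h2; lra.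
by rewrite pindF // !mulr_ge0 ?expR_ge0.
Qed.

Hypothesis hpm : forall e : R, 0 < e -> exists N : int, forall k : int, k <= N -> `|p k - pm| < e.
Hypothesis hpp : forall e : R, 0 < e -> exists N : int, forall k : int, N <= k -> `|p k - pp| < e.
Hypotheses (hpm01 : 0 < pm < 1) (hpp01 : 0 < pp < 1).

Lemma halfspace_bound a (w : (int -> R) * (int -> R)) m : affine_pair pm pp w ->
  exists C, forall n, (1 <= n)%N ->
    walkE p m n (fun s _ => pind R (halfspace p pm pp a w (empirical R s))) <=
      C * expR (- (n%:R * a)).
Proof.
move=> [a1 a2].
have [c1 h1] : exists c, forall y, 0 <= y -> c <= w.1 y.
  by apply: affine_bounded_right a1 _; rewrite /tiltR le_max lexx orbT.
have [c2 h2] : exists c, forall y, y <= 0 -> c <= w.2 y.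
  by apply: affine_bounded_left a2 _; rewrite /tiltL ge_min lexx orbT.
exists (expR (w.1 m - c1) + expR (w.2 m - c2)) => n n1.
rewrite mulrDl; apply: le_trans (lerD (walk_chernoff a m n h1) (walk_chernoff a m n h2)).
rewrite -walkED; apply: walkE_le; first exact: p_stochastic.
move=> s y ss _.
have s0 : s != [::] by rewrite -size_eq0 ss; lia.
have n0 : 0 < n%:R :> R by rewrite ltr0n.
have conv tm tp v : affine_ends tm tp v ->
    a < zbar_integral (empirical R s) (testV p pm pp tm tp v) ->
    n%:R * a <= \sum_(x <- s) stepV p v x.
  move=> av; rewrite empirical_integral //; last exact: cont_bounded (testV_cont p01 hpm hpp hpm01 hpp01 av).
  by rewrite ss ltr_pdivlMr // mulrC => /ltW.
have [[ps [g1 g2]]|hn] := pselect (halfspace p pm pp a w (empirical R s)); last first.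
  by rewrite pindF // addr_ge0 // pind_ge0.
apply: le_trans (pind_le1 _ _) _.
have [y0|y0] := leP 0 y.
  by rewrite [X in X + _]pindT ?lerDl ?pind_ge0 //; split => //; exact: conv g1.
by rewrite [X in _ + X]pindT ?lerDr ?pind_ge0 //; split; [exact: conv g2|exact: ltW].
Qed.

Lemma closed_bound (F : set (zbar -> R)) a m : weak_closed F ->
  (forall mu, F mu -> (a%:E < rate_I p pm pp mu)%E) ->
  exists C, forall n, (1 <= n)%N -> emp_prob p m n F <= C * expR (- (n%:R * a)).
Proof.
move=> cF hF; have [FP comp] := weak_closed_compact cF.
have [||s [sC sF]] := comp [set G | exists2 w : (int -> R) * (int -> R), affine_pair pm pp w & G = halfspace p pm pp a w].
- by move=> _ [w aw ->]; exact: halfspace_open.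
- move=> mu Fmu; have [w [aw hw]] := rate_gt_halfspace p01 hpm01 hpp01 (FP _ Fmu) (hF _ Fmu).
  by exists (halfspace p pm pp a w) => //; exists w.
(* What remains is a union bound over the finite cover; the constants add up and do not change the
   rate. *)
suff [C hC] : exists C, forall n, (1 <= n)%N ->
    walkE p m n (fun s0 _ => pind R (exists2 G, G \in s & G (empirical R s0))) <=
      C * expR (- (n%:R * a)).
  exists C => n n1; rewrite /emp_prob path_probE; apply: le_trans (hC n n1).
  apply: walkE_le; first exact: p_stochastic.
  move=> s0 y _ _; apply: pind_le => /sF [G Gs Ge]; by exists G.
elim: s sC {sF} => [|G s IH] sC.
  exists 0 => n _; rewrite mul0r -(walkE_cst p m n 0); apply: walkE_le.
    exact: p_stochastic.
  by move=> s0 y _ _; rewrite pindF // => -[].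
have [|C1 h1] := IH; first by move=> G' G's; apply: sC; rewrite inE G's orbT.
have [|w aw Gw] := sC G; first by rewrite mem_head.
have [C2 h2] := halfspace_bound a m aw.
exists (C1 + C2) => n n1; rewrite mulrDl.
apply: le_trans (lerD (h1 n n1) (h2 n n1)); rewrite -walkED.
apply: walkE_le; first exact: p_stochastic.
move=> s0 y _ _.
have [[G']|hn] := pselect (exists2 G', G' \in G :: s & G' (empirical R s0)); last first.
  by rewrite pindF // addr_ge0 // pind_ge0.
rewrite inE => /predU1P[->|G's] G'e; apply: le_trans (pind_le1 _ _) _.
  by rewrite -Gw [X in _ + X]pindT ?lerDr ?pind_ge0.
by rewrite [X in X + _]pindT ?lerDl ?pind_ge0 //; exists G'.
Qed.

Lemma upper_bound (F : set (zbar -> R)) m : weak_closed F ->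
  (limn_esup (exp_rate (fun n => emp_prob p m n F)) <=
    - ereal_inf (rate_I p pm pp @` F))%E.
Proof.
move=> cF; set L := limn_esup _; set x := ereal_inf _.
have H a : (a%:E < x)%E -> (L <= (- a)%:E)%E.
  move=> ax; have [C hC] : exists C, forall n, (1 <= n)%N -> emp_prob p m n F <= C * expR (- (n%:R * a)).
    apply: closed_bound => // mu Fmu; apply: lt_le_trans ax _.
    by apply: ereal_inf_lbound; exists mu.
  exact: (exp_rate_le (n0 := 1)) hC.
case: x H => [r| |] H.
- apply/lee_addgt0Pr => e e0; have := H (r - e); rewrite lte_fin.
  rewrite (_ : (- (r - e))%:E = (- r%:E + e%:E)%E); last by rewrite -EFinN -EFinD; congr EFin; ring.
  by apply; rewrite ltrBlDr ltrDl.
(* Infinite infimum, for instance when [F] is empty: the bound holds for every [a], which forces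
   [L = -oo]. *)
- rewrite leeNy_eq; apply/eqP; case: L H => [l| |] // H.
    have h : (l%:E <= (- (1 - l))%:E)%E by apply: H; rewrite ltry.
    by exfalso; move: h; rewrite lee_fin; lra.
  have h : (+oo <= (- (0 : R))%:E)%E by apply: H; rewrite ltry.
  by move: h; rewrite leye_eq.
- by rewrite /= leey.
Qed.

End UpperBound.

(** * Chains with a finite flux *)

(* A finite flux on the edges [{x, x+1}], [a <= x < a + n]: the reversible chain
   crossing each edge [x] with intensity [r x] in both directions. *)
Section Flux.
Variables (R : realType) (a : int) (n : nat) (r : int -> R).
Hypothesis r_pos : forall x, a <= x < a + n%:Z -> 0 < r x.
Hypothesis r_out : forall x, ~~ (a <= x < a + n%:Z) -> r x = 0.
Hypothesis n_gt0 : (0 < n)%N.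
Implicit Types (f : int -> int -> R) (g h : int -> R) (s : seq int) (x y k m : int)
  (d e c K : R) (N M i : nat).

Definition site x := a <= x <= a + n%:Z.
Definition occ x : R := r x + r (x - 1).
Definition jump x : R := r x / occ x.
Definition ssum h : R := \sum_(i < n.+1) h (a + i%:Z).

Lemma r_ge0 x : 0 <= r x.
Proof.
have [/r_pos/ltW//|h] := boolP (a <= x < a + n%:Z).
by rewrite r_out.
Qed.

Lemma occ_ge0 x : 0 <= occ x.
Proof. by rewrite addr_ge0 ?r_ge0. Qed.

Lemma occ_gt0 x : site x -> 0 < occ x.
Proof.
move=> /andP[x1 x2]; have [xa|xa] := eqVneq x a.
  by rewrite ltr_pwDl ?r_ge0 // r_pos //; lia.
by rewrite ltr_wpDl ?r_ge0 // r_pos //; lia.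
Qed.

Lemma jumpC x : site x -> 1 - jump x = r (x - 1) / occ x.
Proof.
move=> /occ_gt0 h; rewrite /jump -{1}(divff (lt0r_neq0 h)) -mulrBl; congr (_ / _).
by rewrite /occ addrC addKr.
Qed.

Lemma jump_stochastic : stochastic jump.
Proof.
move=> x; rewrite /jump divr_ge0 ?r_ge0 ?occ_ge0 //=.
have [->|h] := eqVneq (occ x) 0; first by rewrite invr0 mulr0.
rewrite ler_pdivrMr ?mul1r ?lerDl ?r_ge0 //.
by rewrite lt_def h occ_ge0.
Qed.

Lemma jump_up x : site x -> jump x != 0 -> site (x + 1).
Proof.
move=> xs; rewrite /jump; have [h _|h] := boolP (a <= x < a + n%:Z).
  by rewrite /site; lia.
by rewrite r_out // mul0r eqxx.
Qed.

Lemma jump_down x : site x -> jump x != 1 -> site (x - 1).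
Proof.
move=> xs; rewrite -subr_eq0 -opprB oppr_eq0 jumpC //.
have [h _|h] := boolP (a <= x - 1 < a + n%:Z).
  by rewrite /site; lia.
by rewrite r_out // mul0r eqxx.
Qed.

Lemma site_bound h : exists K, forall x, site x -> h x <= K.
Proof.
pose N := (`|a| + n)%N; exists (wsum N (fun x => `|h x|)) => x xs.
apply: le_trans (ler_norm _) _; apply: win_bound; move: xs; rewrite /site /N; lia.
Qed.

Definition fmean f x : R := jump x * f x (x + 1) + (1 - jump x) * f x (x - 1).

(** Multiplied by [occ x], the equation says that [r x * (g (x + 1) - g x)] changes by
    [- occ x * fmean f x] from one edge to the next. So the increments [D] of [g] are minus the
    partial sums of the source divided by the flux. *)
Lemma poisson f : ssum (fun x => occ x * fmean f x) = 0 ->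
  exists g, forall x, site x ->
    jump x * (f x (x + 1) + g (x + 1)) + (1 - jump x) * (f x (x - 1) + g (x - 1)) = g x.
Proof.
move=> f0.
pose F x := occ x * fmean f x.
pose S i : R := \sum_(j < i.+1) F (a + j%:Z).
pose D i : R := - S i / r (a + i%:Z).
pose g x : R := \sum_(j < `|x - a|%N) D j.
(* At the last site the flux is zero and [D] is a division by [0]; the identity survives because the
   total sum [S n] vanishes. This is where centering enters. *)
have rD i : (i <= n)%N -> r (a + i%:Z) * D i = - S i.
  move=> i_n; rewrite /D; have [->|ne] := eqVneq i n.
    by rewrite /S [X in - X]f0 oppr0 mul0r mulr0.
  by rewrite mulrC divfK // gt_eqF // r_pos //; lia.
exists g => x xs.
have [i xE i_n] : exists2 i, x = a + i%:Z & (i <= n)%N.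
  by exists `|x - a|%N; move: xs; rewrite /site; lia.
have gi j : g (a + j%:Z) = \sum_(l < j) D l.
  by rewrite /g; have -> : `|(a + j%:Z - a)%R|%N = j by lia.
have ne := lt0r_neq0 (occ_gt0 xs).
have g1 : g (x + 1) = g x + D i.
  have -> : x + 1 = a + i.+1%:Z by lia.
  by rewrite xE !gi big_ord_recr.
have key : r x * D i - r (x - 1) * (g x - g (x - 1)) = - F x.
  rewrite xE rD //; case: i xE i_n {g1} => [|i] xE i_n.
    have -> : r (a + 0%:Z - 1) = 0 by rewrite r_out //; lia.
    by rewrite mul0r subr0 /S big_ord_recl big_ord0 addr0.
  have -> : a + i.+1%:Z - 1 = a + i%:Z by lia.
  rewrite !gi big_ord_recr /= [_ + D i]addrC addrK rD; last by lia.
  by rewrite /S big_ord_recr /= opprD opprK addrC addNKr.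
apply: (mulfI ne); rewrite g1 jumpC //.
have e1 : occ x * jump x = r x by rewrite /jump mulrC divfK.
have e2 : occ x * (r (x - 1) / occ x) = r (x - 1) by rewrite mulrC divfK.
rewrite mulrDr (mulrA (occ x) (jump x)) (mulrA (occ x) (_ / _)) e1 e2.
move: key; rewrite /F /fmean jumpC // (mulrDr (occ x)) (mulrA (occ x) (jump x)).
rewrite (mulrA (occ x) (_ / _)) e1 e2.
rewrite /occ; move: (r x) (r (x - 1)) (g x) (g (x - 1)) (D i) (f x _) (f x _) => u v u1 v1 w1 c b.
move=> key; have -> : u * (b + (u1 + w1)) + v * (c + v1) =
  (u * w1 - v * (u1 - v1)) + (u * b + v * c) + (u + v) * u1 by ring.
by rewrite key; ring.
Qed.

Lemma weak_lln f m d e : ssum (fun x => occ x * fmean f x) = 0 -> site m ->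
  0 < d -> 0 < e -> exists N0, forall N, (N0 <= N)%N ->
    walkE jump m N (fun s y => pind R (N%:R * d <= `|stepsum f s y|)) <= e.
Proof.
move=> f0 ms d0 e0; have [g hg] := poisson f0.
have [K hK] := site_bound (fun x => (f x (x + 1) + g (x + 1) - f x (x - 1) - g (x - 1)) ^+ 2).
have [G hG] := site_bound (fun x => g x ^+ 2).
have K0 : 0 <= K by apply: le_trans (hK _ ms); exact: sqr_ge0.
have G0 : 0 <= G by apply: le_trans (hG _ ms); exact: sqr_ge0.
(* The square of [stepsum] is at most [2 * (stepsum + g) ^+ 2 + 2 * g ^+ 2], whose mean is at most
   [2 * (G + N * K) + 2 * G], hence at most [N * A] since [1 <= N]. *)
pose A := 4 * G + 2 * K; have A0 : 0 <= A by rewrite /A; lra.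
pose N0 := (Num.truncn (A / (d ^+ 2 * e))).+1.
exists N0 => N N0N.
have Np : 0 < N%:R :> R by rewrite ltr0n; apply: leq_trans N0N.
have N1 : 1 <= N%:R :> R by rewrite ler1n; apply: leq_trans N0N.
have hN : A / (d ^+ 2 * e) <= N%:R.
  apply: ltW; apply: lt_le_trans (real_truncnS_gt _) _; first exact: num_real.
  by rewrite ler_nat.
have D0 : 0 < N%:R ^+ 2 * d ^+ 2 by rewrite mulr_gt0 // exprn_gt0.
have step1 : walkE jump m N (fun s y => pind R (N%:R * d <= `|stepsum f s y|)) <=
    walkE jump m N (fun s y => (N%:R ^+ 2 * d ^+ 2)^-1 *
      (2 * (0 + stepsum f s y + g y) ^+ 2 + 2 * G)).
  apply: (walkE_le_in jump_stochastic jump_up jump_down ms) => s y _ _ _ ys.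
  rewrite ler_pdivlMl //.
  have [h|h] := pselect (N%:R * d <= `|stepsum f s y|); last first.
    rewrite pindF // mulr0; have := sqr_ge0 (0 + stepsum f s y + g y); lra.
  rewrite pindT // mulr1 add0r -exprMn.
  have h2 : (N%:R * d) ^+ 2 <= stepsum f s y ^+ 2.
    by rewrite -[leRHS]real_normK ?num_real // ler_sqr ?nnegrE // mulr_ge0 // ltW.
  have h3 := hG _ ys; apply: le_trans h2 _.
  move: (stepsum f s y) (g y) h3 => u v h3.
  have := sqr_ge0 (u + 2 * v); rewrite !sqrrD => h4.
  move: h4; have -> : (2 * v) ^+ 2 = 4 * v ^+ 2 by ring.
  have -> : u * (2 * v) *+ 2 = 4 * (u * v) by ring.
  have -> : u * v *+ 2 = 2 * (u * v) by ring.
  move: (u ^+ 2) (v ^+ 2) (u * v) h3 => x1 x2 x3; lra.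
apply: le_trans step1 _; rewrite walkEZ walkED walkEZ walkE_cst.
have ch := chebyshev_walk N 0 jump_stochastic jump_up jump_down hg hK ms.
rewrite ler_pdivrMl //.
have hgm := hG _ ms; rewrite add0r in ch.
have bA : A <= N%:R * (d ^+ 2 * e) by rewrite -ler_pdivrMr // mulr_gt0 // exprn_gt0.
have : 2 * walkE jump m N (fun s y => (0 + stepsum f s y + g y) ^+ 2) + 2 * G <= N%:R * A.
  apply: le_trans (_ : 2 * (g m ^+ 2 + N%:R * K) + 2 * G <= _); first by lra.
  have NG : G <= N%:R * G by rewrite ler_peMl.
  have -> : N%:R * A = 4 * (N%:R * G) + 2 * (N%:R * K) by rewrite /A; ring.
  move: (N%:R * G) (N%:R * K) (g m ^+ 2) NG hgm G0 => x1 x2 x3; clear; intros; lra.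
move=> h; apply: le_trans h _.
have -> : N%:R ^+ 2 * d ^+ 2 * e = N%:R * (N%:R * (d ^+ 2 * e)) by ring.
apply: ler_wpM2l; first exact: ltW.
exact: bA.
Qed.

Lemma lln_family (F : nat -> int -> int -> R) M m d e :
  (forall i, (i < M)%N -> ssum (fun x => occ x * fmean (F i) x) = 0) -> site m ->
  0 < d -> 0 < e -> exists N0, forall N, (N0 <= N)%N ->
    1 - e <= walkE jump m N
      (fun s y => pind R (forall i, (i < M)%N -> `|stepsum (F i) s y| < N%:R * d)).
Proof.
move=> F0 ms d0; elim: M e F0 => [|M IH] e F0 e0.
  exists 0%N => N _; rewrite -[leLHS](walkE_cst jump m N); apply: walkE_le.
    exact: jump_stochastic.
  by move=> s y _ _; rewrite pindT //; lra.
have e2 : 0 < e / 2 by rewrite divr_gt0.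
have [N1 h1] := IH _ (fun i iM => F0 i (ltnW iM)) e2.
have [N2 h2] := weak_lln (F0 M (ltnSn M)) ms d0 e2.
exists (maxn N1 N2) => N; rewrite geq_max => /andP[/h1 {}h1 /h2 {}h2].
have -> : 1 - e = (1 - e / 2) + - (e / 2) by rewrite [in LHS](splitr e) opprD addrA.
rewrite -lerN2 in h2; apply: le_trans (lerD h1 h2) _.
rewrite -mulN1r -walkEZ -walkED; apply: walkE_le; first exact: jump_stochastic.
move=> s y _ _; rewrite mulN1r.
have [hM|hM] := pselect (N%:R * d <= `|stepsum (F M) s y|).
  by rewrite [X in _ - X]pindT // (le_trans _ (pind_ge0 _ _)) // subr_le0 pind_le1.
rewrite [X in _ - X]pindF // subr0; apply: pind_le => hi i.
rewrite ltnS leq_eqVlt => /predU1P[->|/hi //].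
by rewrite ltNge; apply/negP.
Qed.

Variable p : int -> R.
Hypothesis p01 : forall k, 0 < p k < 1.

(** Not normalised: when part of the time is left to an escape the flux has mass less than one, and
    the relative entropy per step is [entropy_cost / mass]. *)
Definition mass : R := ssum occ.
Definition entropy_cost : R := ssum (fun x =>
  occ x * (jump x * ln (jump x / p x) + (1 - jump x) * ln ((1 - jump x) / (1 - p x)))).
Definition mass_above k : R := ssum (fun x => if k <= x then occ x else 0).

Lemma mass_gt0 : 0 < mass.
Proof.
rewrite /mass /ssum big_ord_recl; apply: ltr_pwDl.
  by apply: occ_gt0; rewrite /site /= addr0 lexx lerDl.
by apply: sumr_ge0 => i _; exact: occ_ge0.
Qed.

Lemma stepsum_split f1 f2 s y :
  stepsum (fun u v => f1 u v - f2 u v) s y = stepsum f1 s y - stepsum f2 s y.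
Proof.
elim: s => [|x s IH] /=; first by rewrite subrr.
by rewrite IH opprD addrACA.
Qed.

Lemma stepsum_cst c s y : stepsum (fun _ _ => c) s y = (size s)%:R * c.
Proof.
elim: s => [|x s IH] /=; first by rewrite mul0r.
by rewrite IH -natr1 mulrDl mul1r addrC.
Qed.

Lemma stepsum_count k s y :
  stepsum (fun u _ => if k <= u then 1 else 0) s y = (count (fun x => k <= x) s)%:R :> R.
Proof.
by elim: s => [|x s IH] //=; rewrite IH natrD; case: ifP.
Qed.

Lemma ssum_sub h1 h2 : ssum (fun x => h1 x - h2 x) = ssum h1 - ssum h2.
Proof. by rewrite /ssum big_split /= sumrN. Qed.

Lemma eq_ssum h1 h2 : h1 =1 h2 -> ssum h1 = ssum h2.
Proof. by move=> h; apply: eq_bigr => i _; rewrite h. Qed.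

Lemma centered f c : ssum (fun x => occ x * fmean f x) = c * mass ->
  ssum (fun x => occ x * fmean (fun u v => f u v - c) x) = 0.
Proof.
move=> h; rewrite (@eq_ssum _ (fun x => occ x * fmean f x - c * occ x)).
  by rewrite ssum_sub h /mass /ssum mulr_sumr subrr.
move=> x; rewrite /fmean; move: (occ x) (jump x) => o j; ring.
Qed.

(* Tilting [p] to the chain of the flux costs [entropy_cost / mass] per step,
   up to an event controlled by the law of large numbers. *)
Lemma flux_lower_bound M m d : site m -> 0 < d ->
  exists N0, forall N, (N0 <= N)%N ->
    2^-1 * expR (- (N%:R * (entropy_cost / mass + d))) <=
    walkE p m N (fun s y => pind R (site y /\ forall k, - M%:Z <= k <= M%:Z ->
      `|(count (fun x => k <= x) s)%:R - N%:R * (mass_above k / mass)| < N%:R * d)).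
Proof.
move=> ms d0.
pose C := entropy_cost / mass.
pose fk k u (v : int) : R := (if k <= u then 1 else 0) - mass_above k / mass.
pose fl u v : R := llr p jump u v - C.
(* One family for the law of large numbers: index [0] is the log-likelihood ratio, the others are
   the counts above the levels of the window. *)
pose F i := if i is i'.+1 then fk (i'%:Z - M%:Z) else fl.
have mn0 := lt0r_neq0 mass_gt0.
have F0 i : (i < (2 * M).+2)%N -> ssum (fun x => occ x * fmean (F i) x) = 0.
  move=> _; case: i => [|i]; apply: centered; rewrite mulrC mulrC divfK //.
    apply: eq_ssum => x; congr (_ * _); rewrite /fmean /llr eqxx.
    by have -> : (x - 1 == x + 1) = false by lia.
  apply: eq_ssum => x; rewrite /fmean; case: ifP => _; move: (occ x) (jump x) => o j; ring.
have [N0 hN0] := lln_family F0 ms d0 (e := 2^-1) ltac:(by rewrite invr_gt0).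
exists N0 => N /hN0 {hN0}; have -> : 1 - 2^-1 = 2^-1 :> R by lra.
move=> h.
pose E s y := site y /\ forall k, - M%:Z <= k <= M%:Z ->
      `|(count (fun x => k <= x) s)%:R - N%:R * (mass_above k / mass)| < N%:R * d.
have pstoch : stochastic p by exact: p_stochastic.
apply: le_trans (walkE_tilt m N p01 jump_stochastic (F := fun s y => pind R (E s y)) _).
  rewrite mulrC; apply: le_trans (ler_wpM2l (expR_ge0 _) h) _.
  rewrite -walkEZ.
  apply: (walkE_le_in jump_stochastic jump_up jump_down ms) => s y ss _ _ ys.
  have [hF|hF] := pselect (forall i, (i < (2 * M).+2)%N -> `|stepsum (F i) s y| < N%:R * d);
    last by rewrite [X in _ * X]pindF // mulr0 mulr_ge0 ?expR_ge0 ?pind_ge0.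
  rewrite pindT // mulr1 pindT ?mul1r.
    rewrite ler_expR lerN2.
    have := hF 0%N isT; rewrite /F /fl stepsum_split stepsum_cst ss.
    rewrite ltr_norml mulrDr -/C => /andP[_]; rewrite ltrBlDl addrC => /ltW.
    by rewrite addrC.
  split => // k hk.
  have [i iE iM] : exists2 i : nat, k = i%:Z - M%:Z & (i < (2 * M).+1)%N.
    by pose j : int := k + M%:Z; exists `|j|%N; rewrite /j; lia.
  have := hF i.+1 iM; rewrite /F -iE /fk stepsum_split stepsum_cst ss.
  by rewrite stepsum_count.
by move=> s y; exact: pind_ge0.
Qed.

End Flux.

(** * Escape to infinity *)

Section Escape.
Variable R : realType.
Implicit Types (p : int -> R) (a b k m x y : int) (n M T : nat) (c d e t : R) (s : seq int).

(* If [p >= p0 > 1/2] beyond [N], then [1 - rho ^ i] with [rho = (1 - p0) / p0]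
   is subharmonic in the height [i] above [N - 1]. *)
Lemma stay_right p (p0 : R) (N : int) n (i : nat) : (forall k, 0 < p k < 1) ->
  2^-1 < p0 < 1 -> (forall k, N <= k -> p0 <= p k) ->
  1 - ((1 - p0) / p0) ^+ i <=
    walkE p (N - 1 + i%:Z) n (fun s _ => pind R (forall x, x \in s -> N <= x)).
Proof.
move=> p01 /andP[p0h p01'] hN; have pst := p_stochastic p01.
set rho := (1 - p0) / p0.
have r0 : 0 < rho by rewrite divr_gt0; lra.
have pr : p0 * rho = 1 - p0 by rewrite /rho mulrC divfK //; lra.
have r1 : rho < 1 by rewrite /rho ltr_pdivrMr; lra.
elim: n i => [|n IH] i.
  by rewrite /= pindT // gerBl exprn_ge0 // ltW.
case: i => [|i].
  by rewrite expr0 subrr walkE_ge0 // => s y _; exact: pind_ge0.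
set x := N - 1 + i.+1%:Z; have xN : N <= x by rewrite /x; lia.
have e j : walkE p j n (fun s _ => pind R (forall z, z \in x :: s -> N <= z)) =
    walkE p j n (fun s _ => pind R (forall z, z \in s -> N <= z)).
  apply: walkE_ext => s y; congr (if `[< _ >] then _ else _); apply/propext; split => h z zs.
    by apply: h; rewrite inE zs orbT.
  by move: zs; rewrite inE => /predU1P[->//|/h].
rewrite walkE_consE !e.
have := IH i.+2; have := IH i.
have -> : N - 1 + i.+2%:Z = x + 1 by rewrite /x; lia.
have -> : N - 1 + i%:Z = x - 1 by rewrite /x; lia.
have /andP[px0 px1] := p01 x; have px := hN _ xN.
have ri : 0 < rho ^+ i by rewrite exprn_gt0.
rewrite !exprS; move: (walkE _ _ _ _) (walkE _ _ _ _) => u v hv hu.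
apply: le_trans (_ : p x * (1 - rho * (rho * rho ^+ i)) + (1 - p x) * (1 - rho ^+ i) <= _); last first.
  by apply: lerD; apply: ler_wpM2l => //; lra.
have -> : p x * (1 - rho * (rho * rho ^+ i)) + (1 - p x) * (1 - rho ^+ i) =
  1 - rho ^+ i * (p x * rho ^+ 2 + (1 - p x)) by ring.
rewrite lerD2l lerN2 [leRHS]mulrC; apply: ler_wpM2l; first exact: ltW.
have -> : p x * rho ^+ 2 + (1 - p x) = 1 - p x * (1 - rho ^+ 2) by ring.
have h2 : 0 <= 1 - rho ^+ 2 by rewrite subr_ge0 expr_le1 // ltW.
have h3 : p0 * (1 - rho ^+ 2) <= p x * (1 - rho ^+ 2) by exact: ler_wpM2r.
have h4 : p0 * (1 - rho ^+ 2) = 1 - rho.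
  have -> : p0 * (1 - rho ^+ 2) = p0 - (p0 * rho) * rho by ring.
  rewrite pr; have -> : p0 - (1 - p0) * rho = p0 - rho + p0 * rho by ring.
  rewrite pr; lra.
lra.
Qed.

(** From [N] on, the walk stays above [N] with probability at least [1 - rho]. From [N - j] it may
    climb straight up, each step costing a factor [p x0] and at most one visit below [k0]; so [T] is
    the height to climb, and [c] depends neither on [n] nor on the starting point. *)
Lemma escape_right p (pp : R) a k0 : (forall k, 0 < p k < 1) ->
  (forall e : R, 0 < e -> exists N : int, forall k : int, N <= k -> `|p k - pp| < e) ->
  2^-1 < pp < 1 ->
  exists T c, 0 < c /\ forall n y, a <= y ->
    c <= walkE p y n (fun s _ => pind R (count (fun x => (x < k0)%R) s <= T)%N).
Proof.
move=> p01 hpp /andP[pp1 pp2]; have pst := p_stochastic p01.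
pose p0 := (2^-1 + pp) / 2.
have p0h : 2^-1 < p0 < 1 by rewrite /p0; apply/andP; split; lra.
have e0 : 0 < pp - p0 by rewrite /p0; lra.
have [N1 hN1] := hpp _ e0.
pose N := Num.max N1 k0.
have hN k : N <= k -> p0 <= p k.
  by rewrite ge_max => /andP[/hN1]; rewrite ltr_norml => /andP[]; lra.
pose rho := (1 - p0) / p0.
have /andP[p0a p0b] := p0h.
have r1 : rho < 1 by rewrite /rho ltr_pdivrMr; lra.
have r0 : 0 < rho by rewrite divr_gt0; lra.
suff H j : exists c, 0 < c /\ forall n y, N - j%:Z <= y ->
    c <= walkE p y n (fun s _ => pind R (count (fun x => (x < k0)%R) s <= j)%N).
  have [c [c0 hc]] := H `|N - a|%N.
  by exists `|N - a|%N, c; split => // n y ay; apply: hc; lia.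
elim: j => [|j [c [c0 IH]]].
  exists (1 - rho); split; first by rewrite subr_gt0.
  move=> n y; rewrite subr0 => Ny.
  have yE : y = N - 1 + (`|y - N|%N.+1)%:Z by lia.
  rewrite yE; apply: le_trans (le_trans _ (stay_right n `|y - N|%N.+1 p01 p0h hN)) _.
    rewrite lerD2l lerN2 exprS ler_piMr ?(ltW r0) //.
    by rewrite exprn_ile1 ?ltW.
  apply: walkE_le => // s z _ _; apply: pind_le => hs.
  rewrite leqNgt -has_count; apply/hasPn => x /hs Nx.
  by rewrite -leNgt; apply: le_trans Nx; rewrite le_max lexx orbT.
pose x0 := N - j.+1%:Z; have /andP[px0 px1] := p01 x0.
exists (p x0 * c); split; first exact: mulr_gt0.
move=> n y Ny; have [yj|yj] := leP (N - j%:Z) y.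
  apply: le_trans (_ : c <= _); first by rewrite ler_piMl // ltW.
  by apply: le_trans (IH n y yj) _; apply: walkE_le => // s z _ _; apply: pind_le => /leqW.
have -> : y = x0 by rewrite /x0; lia.
case: n => [|n].
  rewrite /= pindT // -[leRHS]mulr1; apply: ler_pM => //; try exact: ltW.
  by apply: le_trans (IH 0%N (N - j%:Z) (lexx _)) _; rewrite /= pind_le1.
rewrite walkE_consE; apply: le_trans (_ : p x0 * walkE p (x0 + 1) n
   (fun s _ => pind R (count (fun x => (x < k0)%R) (x0 :: s) <= j.+1)%N) <= _); last first.
  rewrite lerDl mulr_ge0 //; first by rewrite subr_ge0 ltW.
  by apply: walkE_ge0 => // s z _; exact: pind_ge0.
apply: ler_wpM2l; first exact: ltW.
apply: le_trans (IH n (x0 + 1) _) _; first by rewrite /x0; lia.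
apply: walkE_le => // s z _ _; apply: pind_le => /= h.
by rewrite -[j.+1]add1n; apply: leq_add => //; exact: leq_b1.
Qed.

Lemma escape_left p (pm : R) b k0 : (forall k, 0 < p k < 1) ->
  (forall e : R, 0 < e -> exists N : int, forall k : int, k <= N -> `|p k - pm| < e) ->
  0 < pm < 2^-1 ->
  exists T c, 0 < c /\ forall n y, y <= b ->
    c <= walkE p y n (fun s _ => pind R (count (fun x => (k0 < x)%R) s <= T)%N).
Proof.
move=> p01 hpm /andP[pm1 pm2].
have m01 k : 0 < mirror p k < 1.
  by rewrite /mirror; have /andP[] := p01 (- k) => *; apply/andP; split; lra.
have hm e : 0 < e -> exists N : int, forall k : int, N <= k -> `|mirror p k - (1 - pm)| < e.
  move=> /hpm [N hN]; exists (- N) => k Nk; rewrite /mirror distrC.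
  have -> : 1 - pm - (1 - p (- k)) = p (- k) - pm by ring.
  by apply: hN; lia.
have hp : 2^-1 < 1 - pm < 1 by apply/andP; split; lra.
have [T [c [c0 H]]] := escape_right (- b) (- k0) m01 hm hp.
exists T, c; split => // n y yb.
rewrite walkE_mirror; apply: le_trans (H n (- y) _) _; first by lia.
apply: walkE_le; first exact: p_stochastic.
move=> s z _ _; apply: pind_le; apply: leq_trans.
rewrite count_map; apply: sub_count => x /=; lia.
Qed.

(** Here [e] is the share of the escape seen above a fixed level: [1] towards [+oo], [0] towards
    [-oo]. As [c] is uniform in the duration and in the starting point, an escape of any length has
    no exponential cost. *)
Definition escapes p e := forall a b M, exists T c, 0 < c /\
  forall n y, a <= y <= b -> c <= walkE p y n (fun s _ => pind R
    (forall k, - M%:Z <= k <= M%:Z -> `|(count (fun x => k <= x) s)%:R - n%:R * e| <= T%:R :> R)).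

Lemma escapes_right p (pp : R) : (forall k, 0 < p k < 1) ->
  (forall e : R, 0 < e -> exists N : int, forall k : int, N <= k -> `|p k - pp| < e) ->
  2^-1 < pp < 1 -> escapes p 1.
Proof.
move=> p01 hpp pp1 a b M.
have [T [c [c0 H]]] := escape_right a M%:Z p01 hpp pp1.
exists T, c; split => // n y /andP[ay _]; apply: le_trans (H n y ay) _.
apply: walkE_le; first exact: p_stochastic.
move=> s z ss _; apply: pind_le => cs k hk.
have := count_predC (fun x => k <= x) s; rewrite ss => <-.
rewrite mulr1 natrD opprD addrA subrr add0r normrN normr_nat ler_nat.
apply: leq_trans cs; apply: sub_count => x /=; lia.
Qed.

Lemma escapes_left p (pm : R) : (forall k, 0 < p k < 1) ->
  (forall e : R, 0 < e -> exists N : int, forall k : int, k <= N -> `|p k - pm| < e) ->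
  0 < pm < 2^-1 -> escapes p 0.
Proof.
move=> p01 hpm pm1 a b M.
have [T [c [c0 H]]] := escape_left b (- M%:Z - 1) p01 hpm pm1.
exists T, c; split => // n y /andP[_ yb]; apply: le_trans (H n y yb) _.
apply: walkE_le; first exact: p_stochastic.
move=> s z ss _; apply: pind_le => cs k hk.
rewrite mulr0 subr0 normr_nat ler_nat.
apply: leq_trans cs; apply: sub_count => x /=; lia.
Qed.

End Escape.

(** * A phase that follows a flux, then an escape *)

Section FluxEscape.
Variables (R : realType) (a : int) (n : nat) (r p : int -> R).
Hypothesis r_pos : forall x, a <= x < a + n%:Z -> 0 < r x.
Hypothesis r_out : forall x, ~~ (a <= x < a + n%:Z) -> r x = 0.
Hypothesis n_gt0 : (0 < n)%N.
Hypothesis p01 : forall k, 0 < p k < 1.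
Implicit Types (s : seq int) (x y k m : int) (d e c : R) (N M T : nat).

Let jst := jump_stochastic r_pos r_out.

Lemma entropy_cost_ge0 : 0 <= entropy_cost a n r p.
Proof.
apply: sumr_ge0 => i _; set x := a + _.
have /andP[j0 j1] := jst x; have /andP[p0 p1] := p01 x.
apply: mulr_ge0; first exact: occ_ge0 r_pos r_out _.
have q1 : 0 < 1 - p x by lra.
have j1' : 0 <= 1 - jump r x by lra.
have := gibbs j0 j1' p0 q1; rewrite ![_ + (1 - _)]addrC !subrK !divr1 => /(_ (lexx _)).
have e (u v : R) : 0 <= u -> 0 < v -> u * ln (u / v) = u * ln u - u * ln v.
  move=> u0 v0; have [->|un] := eqVneq u 0; first by rewrite !mul0r subrr.
  by rewrite ln_div ?posrE ?mulrBr // lt_def un.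
rewrite !e //; move: (_ * ln (p x)) (_ * ln (1 - p x)) (_ * ln (jump r x)) (_ * ln (1 - jump r x)).
intros; lra.
Qed.

Lemma mass_above_le k : 0 <= mass_above a n r k <= mass a n r.
Proof.
have o0 x : 0 <= occ r x by exact: occ_ge0 r_pos r_out _.
apply/andP; split; first by apply: sumr_ge0 => i _; case: ifP.
by apply: ler_sum => i _; case: ifP.
Qed.

Let t := mass a n r.
Let C := entropy_cost a n r p.

(** The flux is followed during the first [t * N] steps, rounded down, at cost [C / t] per step,
    hence [C] per unit of total time. The remaining share [1 - t] escapes. *)
Lemma walk_lower_bound e m M d : site a n m -> 0 < d -> 0 <= e <= 1 -> t <= 1 ->
  t = 1 \/ escapes p e ->
  exists N0, forall N, (N0 <= N)%N ->
    expR (- (N%:R * (C + d))) <= walkE p m N (fun s _ => pind R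
      (forall k, - M%:Z <= k <= M%:Z ->
        `|(count (fun x => k <= x) s)%:R / N%:R - (mass_above a n r k + (1 - t) * e)| <= d)).
Proof.
move=> ms d0 /andP[e0 e1] t1 hesc.
have t0 : 0 < t := mass_gt0 r_pos r_out n_gt0.
have C0 : 0 <= C := entropy_cost_ge0.
have pst := p_stochastic p01.
pose n1 N := Num.truncn (t * N%:R).
have n1P N : (n1 N)%:R <= t * N%:R < (n1 N)%:R + 1.
  by rewrite natr1; apply: truncn_itv; rewrite mulr_ge0 // ltW.
have n1N N : (n1 N <= N)%N.
  rewrite -(@ler_nat R); have /andP[h _] := n1P N; apply: le_trans h _.
  by rewrite ler_piMl.
have [T [c [c0 hT]]] : exists T c, 0 < c /\ forall N y, site a n y ->
    c <= walkE p y (N - n1 N) (fun s _ => pind R (forall k, - M%:Z <= k <= M%:Z ->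
      `|(count (fun x => k <= x) s)%:R - (N - n1 N)%N%:R * e| <= T%:R :> R)).
  case: hesc => [t_1|hesc].
    (* With full mass the flux phase uses all steps and nothing is left for an escape. *)
    exists 0%N, 1; split => // N y _.
    have -> : (N - n1 N = 0)%N.
      by apply/eqP; rewrite subn_eq0 /n1 t_1 mul1r natrK.
    by rewrite /= pindT // => k _; rewrite /= mul0r subrr normr0.
  have [T [c [c0 H]]] := hesc a (a + n%:Z) M.
  by exists T, c; split => // N y ys; exact: H.
have d2 : 0 < d / 2 by lra.
have [N1 hN1] := flux_lower_bound r_pos r_out n_gt0 p01 M ms d2.
(* Three requirements on [N]: the flux phase is long enough for its law of large numbers; [T] and
   the rounding of [t * N] fit into [N * d / 2]; so does the logarithm of the lost factor
   [c / 2]. *)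
pose B := Num.max (N1.+1%:R / t) (Num.max (2 * (T%:R + 2) / d) (2 * ln (2 / c) / d)).
exists (Num.truncn B).+1 => N hN.
have BN : B <= N%:R.
  apply: ltW; apply: lt_le_trans (real_truncnS_gt _) _; first exact: num_real.
  by rewrite ler_nat.
move: BN; rewrite !ge_max => /and3P[b1 b2 b3].
have N0 : 0 < N%:R :> R by rewrite ltr0n; apply: leq_trans hN.
have hn1 : (N1 <= n1 N)%N.
  rewrite ler_pdivrMr // mulrC in b1; have /andP[_ h] := n1P N.
  have : (N1.+1%:R : R) < (n1 N)%:R + 1 by exact: le_lt_trans b1 h.
  by rewrite natr1 ltr_nat ltnS => /ltnW.
rewrite ler_pdivrMr // in b2; rewrite ler_pdivrMr // in b3.
have {hN1 hn1}hN1 := hN1 _ hn1.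
have b3' : - (N%:R * d) / 2 <= ln (c / 2).
  have -> : c / 2 = (2 / c)^-1 by rewrite invf_div.
  by rewrite lnV ?posrE ?divr_gt0 // ; move: (ln _) (N%:R * d) b3 => *; lra.
have [/andP[p1 p2]] := n1P N; set l := n1 N in hN1 p1 p2 *.
have lN : (l <= N)%N by exact: n1N.
apply: le_trans (_ : c * (2^-1 * expR (- (l%:R * (C / t + d / 2)))) <= _).
  rewrite mulrA -[c * _]lnK ?posrE ?divr_gt0 // -expRD ler_expR.
  have q1 : l%:R * (C / t) <= N%:R * C.
    rewrite mulrCA; apply: le_trans (_ : C * (t * N%:R / t) <= _).
      by apply: ler_wpM2l => //; rewrite ler_pM2r ?invr_gt0.
    by rewrite mulrAC divff ?gt_eqF // mul1r mulrC.
  have q2 : l%:R * (d / 2) <= N%:R * (d / 2) by apply: ler_wpM2r; rewrite ?ler_nat // ltW.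
  rewrite (mulrDr l%:R) (mulrDr N%:R) (mulrA N%:R d) in q2 *.
  move: q1 q2 b3'; move: (l%:R * (C / t)) (l%:R * (d / 2)) (N%:R * C) (N%:R * d) (ln _).
  intros; lra.
rewrite -(subnKC lN) in hN *; rewrite walkE_cat subnKC //.
have step : walkE p m l (fun s y => c * pind R (site a n y /\ forall k, - M%:Z <= k <= M%:Z ->
      `|(count (fun x => k <= x) s)%:R - l%:R * (mass_above a n r k / t)| < l%:R * (d / 2)))
   <= walkE p m l (fun s y => walkE p y (N - l) (fun s' _ => pind R
      (forall k, - M%:Z <= k <= M%:Z ->
        `|(count (fun x => k <= x) (s ++ s'))%:R / N%:R - (mass_above a n r k + (1 - t) * e)| <= d))).
  apply: walkE_le => // s y ss _.
  set E := (site a n y /\ _); have [[ys hs]|hE] := pselect E; last first.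
    by rewrite pindF // mulr0; apply: walkE_ge0 => // s' z _; exact: pind_ge0.
  rewrite pindT // mulr1; apply: le_trans (hT N y ys) _.
  apply: walkE_le => // s' z _ _; apply: pind_le => hs' k hk.
  have {}hs := hs k hk; have {}hs' := hs' k hk.
  rewrite count_cat natrD -/l in hs' *.
  have [g0 g1] : 0 <= mass_above a n r k / t /\ mass_above a n r k / t <= 1.
    have /andP[u1 u2] := mass_above_le k; split; first by rewrite divr_ge0 // ltW.
    by rewrite ler_pdivrMr // mul1r.
  have gE : mass_above a n r k = mass_above a n r k / t * t by rewrite divfK // gt_eqF.
  rewrite gE; move: (mass_above a n r k / t) hs g0 g1 => G hs g0 g1.
  rewrite natrB // in hs'.
  rewrite -(@ler_pM2l _ N%:R) // -[X in X * `|_|]gtr0_norm // -normrM mulrBr.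
  rewrite mulrC divfK ?gt_eqF //.
  move: hs hs'; set u := (count _ s)%:R; set v := (count _ s')%:R.
  have lr0 : 0 <= l%:R :> R by [].
  have lNr : l%:R <= N%:R :> R by rewrite ler_nat.
  rewrite ltr_norml !ler_norml => /andP[h1 h2] /andP[h3 h4].
  have f1 : 0 <= (t * N%:R - l%:R) * G by rewrite mulr_ge0 // subr_ge0.
  have f2 : (t * N%:R - l%:R) * G <= 1.
    rewrite -[leRHS]mulr1; apply: ler_pM => //; first by rewrite subr_ge0.
    by rewrite lerBlDr addrC ltW.
  have f3 : 0 <= (t * N%:R - l%:R) * e by rewrite mulr_ge0 // subr_ge0.
  have f4 : (t * N%:R - l%:R) * e <= 1.
    rewrite -[leRHS]mulr1; apply: ler_pM => //; first by rewrite subr_ge0.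
    by rewrite lerBlDr addrC ltW.
  have f5 : l%:R * (d / 2) <= N%:R * (d / 2) by apply: ler_wpM2r => //; exact: ltW.
  have -> : N%:R * (G * t + (1 - t) * e) = l%:R * G + (N%:R - l%:R) * e
     + (t * N%:R - l%:R) * G - (t * N%:R - l%:R) * e by ring.
  move: f1 f2 f3 f4; move: ((t * N%:R - l%:R) * G) ((t * N%:R - l%:R) * e) => x1 x2.
  move: h1 h2 h3 h4 f5; rewrite !mulrA; move: (l%:R * G) ((N%:R - l%:R) * e) => x3 x4.
  move: b2; move: (N%:R * d) (l%:R * d) => x5 x6; intros.
  by apply/andP; split; lra.
apply: le_trans step; rewrite walkEZ; apply: ler_wpM2l hN1; exact: ltW.
Qed.

End FluxEscape.

(** * The flux of a measure *)

Section EdgeCost.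
Variable R : realType.
Implicit Types (q x y z e Q : R).

(** Unnormalised relative entropy of the law proportional to [(x, y)] with respect to [(q, 1 - q)]:
    the price of a site left upwards with flux [x] and downwards with flux [y]. *)
Definition cost q x y : R := x * ln (x / (x + y) / q) + y * ln (y / (x + y) / (1 - q)).

(** The one-site form of the Donsker-Varadhan integrand, where [z] is the increment of the test
    function between the two neighbours of the site. *)
Definition dual_cost q x y z : R := x * z - (x + y) * ln (q * expR z + (1 - q)).

Lemma dual_costE q x y Q : 0 < q < 1 -> 0 < Q < 1 ->
  dual_cost q x y (ln (Q / q) - ln ((1 - Q) / (1 - q))) =
  x * ln (Q / q) + y * ln ((1 - Q) / (1 - q)).
Proof.
move=> /andP[q0 q1] /andP[Q0 Q1].
have q1' : 0 < 1 - q by lra.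
have Q1' : 0 < 1 - Q by lra.
rewrite /dual_cost.
have -> : q * expR (ln (Q / q) - ln ((1 - Q) / (1 - q))) + (1 - q) = ((1 - Q) / (1 - q))^-1.
  rewrite expRB !lnK ?posrE ?divr_gt0 //; field; lra.
rewrite lnV ?posrE ?divr_gt0 //; ring.
Qed.

(** The optimal [z] tilts [q] to [Q = x / (x + y)]. When exactly one flux vanishes this is infinite,
    whence the error [e] and a [Q] at logarithmic distance [e / y] or [e / x] from the endpoint. *)
Lemma cost_dual_approx q x y e : 0 < q < 1 -> 0 <= x -> 0 <= y -> 0 < e ->
  exists z, cost q x y <= dual_cost q x y z + e.
Proof.
move=> hq x0 y0 e0; have /andP[q0 q1] := hq; have q1' : 0 < 1 - q by lra.
suff [Q hQ h] : exists2 Q, 0 < Q < 1 &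
    cost q x y <= x * ln (Q / q) + y * ln ((1 - Q) / (1 - q)) + e.
  by exists (ln (Q / q) - ln ((1 - Q) / (1 - q))); rewrite dual_costE.
have [xz|xn] := eqVneq x 0; have [yz|yn] := eqVneq y 0.
- exists 2^-1; first by apply/andP; split; lra.
  by rewrite /cost xz yz !mul0r !add0r ltW.
- have yp : 0 < y by rewrite lt_def yn.
  pose u := expR (- (e / y)); have u0 : 0 < u := expR_gt0 _.
  have u1 : u < 1 by rewrite /u expR_lt1 oppr_lt0 divr_gt0.
  exists (1 - u); first by apply/andP; split; lra.
  rewrite /cost xz !mul0r !add0r divff // (_ : 1 - (1 - u) = u) ?div1r; last by ring.
  rewrite ln_div ?posrE // lnV ?posrE // /u expRK mulrBr !mulrN (_ : y * (e / y) = e); last by rewrite mulrC divfK.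
  by move: (y * _) => v; lra.
- have xp : 0 < x by rewrite lt_def xn.
  pose u := expR (- (e / x)); have u0 : 0 < u := expR_gt0 _.
  have u1 : u < 1 by rewrite /u expR_lt1 oppr_lt0 divr_gt0.
  exists u; first by apply/andP; split; lra.
  rewrite /cost yz !mul0r !addr0 divff // div1r.
  rewrite ln_div ?posrE // lnV ?posrE // /u expRK mulrBr !mulrN (_ : x * (e / x) = e); last by rewrite mulrC divfK.
  by move: (x * _) => v; lra.
- have xp : 0 < x by rewrite lt_def xn.
  have yp : 0 < y by rewrite lt_def yn.
  have s0 : 0 < x + y by rewrite addr_gt0.
  have E : 1 - x / (x + y) = y / (x + y).
    by rewrite -{1}(divff (lt0r_neq0 s0)) -mulrBl addrC addKr.
  exists (x / (x + y)); first by rewrite divr_gt0 //= ltr_pdivrMr // mul1r ltrDl.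
  by rewrite E /cost lerDl ltW.
Qed.

End EdgeCost.

(** * The flux carried by a measure of finite Donsker-Varadhan rate *)

Section FluxOfMeasure.
Variables (R : realType) (p : int -> R) (mu : zbar -> R) (M : R).
Hypothesis p01 : forall k, 0 < p k < 1.
Hypothesis pmu : is_prob mu.
Hypothesis IM : (I_DV p (zmass mu) <= M%:E)%E.
Implicit Types (z w : int -> R) (N B : nat) (i j k : int) (l : R).

Let zT := prob_zfin pmu.

(* The flux balance [r k + r (k - 1) = mu k] forces the alternating sum. *)
Definition altern k j : R := if j <= k then (-1) ^+ `|(k - j)%R|%N else 0.
Definition mflux k : R := Zs (fun j => altern k j * zmass mu j).

Lemma altern_bound k j : `|altern k j| <= 1.
Proof. by rewrite /altern; case: ifP; rewrite ?normr0 // normrX normrN1 expr1n. Qed.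

Lemma mfluxD k : mflux k + mflux (k - 1) = zmass mu k.
Proof.
have b1 := mass_dominated pmu (altern_bound k).
have b2 := mass_dominated pmu (altern_bound (k - 1)).
have := Zs_linear 1 1 zT b1 b2; rewrite !mul1r -/(mflux k) -/(mflux (k - 1)) => <-.
pose F j : R := if j == k then zmass mu j else 0.
have -> : (fun j => 1 * (altern k j * zmass mu j) + 1 * (altern (k - 1) j * zmass mu j)) = F.
  apply/funext => j; rewrite !mul1r -mulrDl /F /altern.
  have [->|jk] := eqVneq j k.
    rewrite lexx subrr absz0 expr0; have -> : (k <= k - 1) = false by lia.
    by rewrite addr0 mul1r.
  have [jk'|jk'] := leP j k; last first.
    have -> : (j <= k - 1) = false by lia.
    by rewrite addr0 mul0r.
  have -> : (j <= k - 1) = true by lia.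
  have -> : `|(k - j)%R|%N = `|(k - 1 - j)%R|%N.+1 by lia.
  by rewrite exprS mulN1r addNr mul0r.
have [n hn] : exists n : nat, - n%:Z <= k <= n%:Z by exists `|k|%N; lia.
rewrite (@Zs_eq_wsum _ _ _ F 1 n zT).
- by rewrite /F wsum_delta.
- move=> j; rewrite mul1r /F; case: ifP => _; last by rewrite normr0; case: zT.
  by rewrite ger0_norm //; case: zT.
- by move=> j hj; rewrite /F; case: eqP => // jk; move: hj; lia.
Qed.

(* Test with [w = l] on [k - 1, k - 3, ...] and [0] elsewhere, and let [l] grow. *)
Lemma mflux_ge0 k : 0 <= mflux k.
Proof.
rewrite leNgt; apply/negP => rk0.
(* Chosen so that [- l * mflux k = 1 + |M|], beyond the bound [M] on the functional. *)
pose l := (1 + `|M|) / - mflux k.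
have l0 : 0 < l by rewrite divr_gt0 ?oppr_gt0 // ltr_pwDl.
pose w j : R := if (j < k) && odd `|(k - j)%R|%N then l else 0.
have w0 j : 0 <= w j by rewrite /w; case: ifP => // _; exact: ltW.
have wl j : w j <= l by rewrite /w; case: ifP => // _; exact: ltW.
have wlip j : `|w (j + 1) - w j| <= l.
  by rewrite ler_norml; have := w0 j; have := wl j; have := w0 (j + 1); have := wl (j + 1) => *;
     apply/andP; split; lra.
have Vb := stepV_lip p01 wlip.
have h1 := Zs_mass_le_IDV p01 pmu w0 Vb.
have {h1}h1 := le_trans h1 IM; rewrite lee_fin in h1.
have b1 := mass_dominated pmu (altern_bound k).
have b2 := mass_dominated pmu Vb.
have E : - l * mflux k = Zs (fun j => - l * (altern k j * zmass mu j)).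
  have := Zs_linear (- l) 0 zT b1 b1; rewrite mul0r addr0 => <-.
  by congr Zs; apply/funext => j; rewrite mul0r addr0.
(* Sitewise, [stepV p w j >= - l * altern k j]: where [w] is [l] both neighbours are [0], and
   elsewhere [w] is [0] with neighbours at most [l], which are [0] beyond [k]. *)
have : - l * mflux k <= Zs (fun j => stepV p w j * zmass mu j).
  have b3 j : `|- l * (altern k j * zmass mu j)| <= l * zmass mu j.
    rewrite [`|_ * (_ * _)|]normrM normrN (gtr0_norm l0); apply: ler_wpM2l; first exact: ltW.
    by have := b1 j; rewrite mul1r.
  rewrite E; apply: (Zs_le zT b3 b2) => j.
  have m0 : 0 <= zmass mu j by case: zT.
  rewrite mulrA; apply: ler_wpM2r => //; rewrite /altern.
  have [jk|jk] := leP j k; last first.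
    rewrite mulr0; have wz i : k <= i -> w i = 0 by rewrite /w ltNge => ->.
    have := @stepV_ge _ p p01 w j 0; rewrite !wz ?subr0; [by apply|lia|lia|lia].
  have [oj|ej] := boolP (odd `|(k - j)%R|%N).
    rewrite -signr_odd oj expr1 mulrN1 opprK.
    have wj : w j = l.
      rewrite /w oj andbT ifT //; move: oj; have [->|] := eqVneq j k; last by lia.
      by rewrite subrr.
    have := @stepV_ge _ p p01 w j 0; rewrite wj subr0; apply.
      by rewrite /w; case: ifP => // /andP[h3 h4]; exfalso; lia.
    by rewrite /w; case: ifP => // /andP[h3 h4]; exfalso; lia.
  rewrite -signr_odd (negbTE ej) expr0 mulr1.
  have wj : w j = 0 by rewrite /w (negbTE ej) andbF.
  by have := @stepV_ge _ p p01 w j l; rewrite wj sub0r; apply.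
have -> : - l * mflux k = 1 + `|M|.
  by rewrite /l mulNr -mulrN divfK // oppr_eq0 lt_eqF.
have := ler_norm M; lra.
Qed.

(* [pairsum B z] has prescribed increments [z k] over [{k - 1, k + 1}]; these are
   independent since even and odd sites decouple, so the Donsker-Varadhan functional
   splits into one-site problems up to a telescoping term. *)
Definition pairsum B z k : R :=
  wsum B (fun i => if (i < k) && odd `|(k - i)%R|%N then z i else 0).

Lemma pairsum_step B z k : (forall j, B%:Z < `|j| -> z j = 0) ->
  pairsum B z (k + 1) - pairsum B z (k - 1) = z k.
Proof.
move=> zB; rewrite /pairsum -wsumN -wsumD.
rewrite (@eq_wsum _ B _ (fun i => if i == k then z i else 0)).
  have [hk|hk] := leP `|k| B%:Z; first by rewrite wsum_delta //; lia.
  rewrite zB //; rewrite (@eq_wsum _ B _ (fun=> 0)); first by rewrite /wsum big1.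
  by move=> i hi; case: eqP => // ik; move: hi hk; rewrite ik; lia.
move=> i _; have [->|ik] := eqVneq i k.
  rewrite ifT; last by lia.
  by rewrite ifF ?subr0 //; lia.
case: ifP => h1; case: ifP => h2; rewrite ?subrr ?subr0 //; exfalso; lia.
Qed.

Lemma pairsum_bound B z k : `|pairsum B z k| <= wsum B (fun i => `|z i|).
Proof.
apply: le_trans (ler_norm_wsum _ _) _; apply: ler_wsum => i _.
by case: ifP; rewrite ?normr0.
Qed.

(** Subtracting [w (k - 1)] leaves only [z k] in the logarithm. By [mfluxD] the linear part becomes
    [mflux k * z k] minus an increment in [k], which telescopes under summation. *)
Lemma stepV_pair w z k : w (k + 1) - w (k - 1) = z k ->
  zmass mu k * stepV p w k = dual_cost (p k) (mflux k) (mflux (k - 1)) (z k)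
    - (mflux k * (w (k + 1) - w k) - mflux (k - 1) * (w (k - 1 + 1) - w (k - 1))).
Proof.
move=> hz; rewrite subrK -(stepV_shift p01 w (- w (k - 1))) /stepV subrr expR0 mulr1 hz.
rewrite /dual_cost -mfluxD -hz.
move: (mflux k) (mflux (k - 1)) (w (k + 1)) (w k) (w (k - 1)) (ln _); intros; ring.
Qed.

(** By [mfluxD] and nonnegativity a flux is at most the mass at either end of its edge; here the
    outer ends lie outside the window. *)
Lemma mflux_tail N : mflux N%:Z + mflux (- N.+1%:Z) <= tailmass mu N.
Proof.
have := zfin_le N.+1 zT; rewrite wsumS => h.
have h1 : mflux N%:Z <= zmass mu N.+1%:Z.
  rewrite -mfluxD; have -> : N.+1%:Z - 1 = N%:Z by lia.
  by rewrite lerDr mflux_ge0.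
have h2 : mflux (- N.+1%:Z) <= zmass mu (- N.+1%:Z).
  by rewrite -mfluxD lerDl mflux_ge0.
rewrite /tailmass; lra.
Qed.

Lemma dual_cost_sum B z : (forall j, B%:Z < `|j| -> z j = 0) ->
  wsum B (fun k => dual_cost (p k) (mflux k) (mflux (k - 1)) (z k)) <= M.
Proof.
move=> zB; pose W := wsum B (fun i => `|z i|).
pose w := pairsum B z.
have wW k : `|w k| <= W by exact: pairsum_bound.
have W0 : 0 <= W by exact: le_trans (normr_ge0 _) (wW 0).
have w2 j k : `|w j - w k| <= 2 * W.
  by apply: le_trans (ler_normB _ _) _; have := wW j; have := wW k; lra.
have Vb := stepV_lip p01 (fun k => w2 (k + 1) k).
have ws0 k : 0 <= w k + W by have := wW k; rewrite ler_norml => /andP[]; lra.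
have VE k : stepV p (fun k => w k + W) k = stepV p w k by exact: stepV_shift.
have Vb' k : `|stepV p (fun k => w k + W) k| <= 2 * W by rewrite VE.
have h1 := le_trans (Zs_mass_le_IDV p01 pmu ws0 Vb') IM.
rewrite lee_fin (_ : (fun k => _) = fun k => stepV p w k * zmass mu k) in h1; last first.
  by apply/funext => k; rewrite VE.
have [_ h2] := zsum_approx zT (mass_dominated pmu Vb).
(* A factor [2 * W] for truncating the series and another for the two boundary terms of the
   telescoping sum. *)
apply: (@le_of_tail _ _ _ _ _ (4 * W) zT); exists B => N BN.
pose dd k := mflux k * (w (k + 1) - w k).
have phi0 k : B%:Z < `|k| -> dual_cost (p k) (mflux k) (mflux (k - 1)) (z k) = 0.
  by move=> /zB ->; rewrite /dual_cost expR0 mulr1 [p k + _]addrC subrK ln1 !mulr0 subrr.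
have -> : wsum B (fun k => dual_cost (p k) (mflux k) (mflux (k - 1)) (z k)) =
    wsum N (fun k => dual_cost (p k) (mflux k) (mflux (k - 1)) (z k)).
  rewrite -(wsum_trunc _ BN); apply: eq_wsum => k _.
  by case: leP => // /phi0.
have -> : wsum N (fun k => dual_cost (p k) (mflux k) (mflux (k - 1)) (z k)) =
    wsum N (fun k => stepV p w k * zmass mu k) + (dd N%:Z - dd (- N%:Z - 1)).
  rewrite -wsum_telescope -wsumD; apply: eq_wsum => k _.
  by rewrite mulrC (stepV_pair (pairsum_step _ zB)) subrK.
have {}h2 := h2 N; rewrite distrC in h2; have {}h2 := le_trans (ler_norm _) h2.
have d1 : dd N%:Z <= mflux N%:Z * (2 * W).
  apply: ler_wpM2l; first exact: mflux_ge0.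
  exact: le_trans (ler_norm _) (w2 _ _).
have d2 : - dd (- N%:Z - 1) <= mflux (- N.+1%:Z) * (2 * W).
  have -> : - N%:Z - 1 = - N.+1%:Z by lia.
  rewrite /dd -mulrN; apply: ler_wpM2l; first exact: mflux_ge0.
  by rewrite opprB; exact: le_trans (ler_norm _) (w2 _ _).
have d3 := ler_wpM2r (mulr_ge0 (ler0n R 2) W0) (mflux_tail N).
rewrite mulrDl /tailmass in d3.
move: h1 h2 d1 d2 d3.
move: (mflux N%:Z * _) (mflux (- N.+1%:Z) * _) (dd N%:Z) (dd _) => x1 x2 x3 x4.
move: (Zs _) (wsum N _) => x5 x6; move: (fin_mass mu - _) => t; intros.
rewrite -subr_ge0; have : 0 <= t * 0 by rewrite mulr0.
move: h2 d3; rewrite ![t * _]mulrC -![_ * W * t]mulrA; move: (W * t) => u; intros; lra.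
Qed.

(** Since [pairsum] realises arbitrary increments, each site can choose its own near-optimal [z k];
    the total error [e] is shared equally by the [2 * B + 1] sites. *)
Lemma cost_sum_le B : wsum B (fun k => cost (p k) (mflux k) (mflux (k - 1))) <= M.
Proof.
apply/ler_addgt0Pr => e e0.
pose eB := e / (2 * B).+1%:R; have eB0 : 0 < eB by rewrite divr_gt0 // ltr0n.
have ex k : exists zk, cost (p k) (mflux k) (mflux (k - 1)) <=
    dual_cost (p k) (mflux k) (mflux (k - 1)) zk + eB.
  by apply: cost_dual_approx => //; exact: mflux_ge0.
have [z hz] := choice ex.
pose z' k := if `|k| <= B%:Z then z k else 0.
have z'B j : B%:Z < `|j| -> z' j = 0 by rewrite /z' ltNge => /negbTE ->.
apply: le_trans (_ : wsum B (fun k => dual_cost (p k) (mflux k) (mflux (k - 1)) (z' k) + eB) <= _).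
  apply: ler_wsum => k hk; rewrite /z' ifT; [exact: hz|lia].
rewrite wsumD; apply: lerD; first exact: dual_cost_sum.
by rewrite /wsum sumr_const_nat subn0 -mulr_natr /eB divfK // pnatr_eq0.
Qed.

End FluxOfMeasure.

(** * Approximation by finite fluxes *)

Section CostLemmas.
Variable R : realType.
Implicit Types (q x y z v c K : R).

Lemma xlnx_div x s q : 0 <= x -> 0 <= s -> (s = 0 -> x = 0) -> 0 < q ->
  x * ln (x / s / q) = x * ln (x / s) - x * ln q.
Proof.
move=> x0 s0 sx q0; have [->|xn] := eqVneq x 0; first by rewrite !mul0r subrr.
have xp : 0 < x by rewrite lt_def xn.
have sp : 0 < s by rewrite lt_def s0 andbT; apply/eqP => /sx; apply/eqP.
by rewrite ln_div ?posrE ?divr_gt0 // mulrBr.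
Qed.

Lemma costE q x y : 0 < q < 1 -> 0 <= x -> 0 <= y ->
  cost q x y = x * ln (x / (x + y)) + y * ln (y / (x + y)) - (x * ln q + y * ln (1 - q)).
Proof.
move=> /andP[q0 q1] x0 y0; have q1' : 0 < 1 - q by lra.
rewrite /cost !xlnx_div ?addr_ge0 //; [ring|by move=> ?; lra|by move=> ?; lra].
Qed.

Lemma dual_cost_le q x y z : 0 < q < 1 -> 0 <= x -> 0 <= y -> dual_cost q x y z <= cost q x y.
Proof.
move=> hq x0 y0; have /andP[q0 q1] := hq; have q1' : 0 < 1 - q by lra.
rewrite costE // /dual_cost; set D := q * expR z + (1 - q).
have D0 : 0 < D by rewrite addr_gt0 // mulr_gt0 // expR_gt0.
have A0 : 0 < q * expR z / D by rewrite divr_gt0 // mulr_gt0 // expR_gt0.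
have B0 : 0 < (1 - q) / D by rewrite divr_gt0.
have := gibbs x0 y0 A0 B0; rewrite -mulrDl -/D divff ?gt_eqF // => /(_ (lexx _)).
rewrite [ln (q * _ / D)]ln_div ?posrE ?mulr_gt0 ?expR_gt0 //.
rewrite [ln ((1 - q) / D)]ln_div ?posrE // lnM ?posrE ?expR_gt0 // expRK.
rewrite !(mulrBr, mulrDr, mulrDl).
move: (x * ln (x / _)) (y * ln (y / _)) (x * ln q) (x * z) (x * ln D) (y * ln D) (y * ln (1 - q)).
intros; lra.
Qed.

Lemma cost_ge0 q x y : 0 < q < 1 -> 0 <= x -> 0 <= y -> 0 <= cost q x y.
Proof.
move=> hq x0 y0; apply: le_trans (dual_cost_le 0 hq x0 y0).
by rewrite /dual_cost expR0 mulr1 [q + _]addrC subrK ln1 !mulr0 subrr.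
Qed.

(** [cost] is the supremum over [z] of the functions [dual_cost], which are linear in the pair of
    fluxes. *)
Lemma costD q x1 x2 y1 y2 : 0 < q < 1 -> 0 <= x1 -> 0 <= x2 -> 0 <= y1 -> 0 <= y2 ->
  cost q (x1 + x2) (y1 + y2) <= cost q x1 y1 + cost q x2 y2.
Proof.
move=> hq x10 x20 y10 y20; apply/ler_addgt0Pr => e e0.
have [z hz] := cost_dual_approx hq (addr_ge0 x10 x20) (addr_ge0 y10 y20) e0.
apply: le_trans hz _; rewrite lerD2r.
have -> : dual_cost q (x1 + x2) (y1 + y2) z = dual_cost q x1 y1 z + dual_cost q x2 y2 z.
  by rewrite /dual_cost; ring.
by apply: lerD; exact: dual_cost_le.
Qed.

Lemma costZ q c x y : 0 <= c -> cost q (c * x) (c * y) = c * cost q x y.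
Proof.
move=> c0; have [->|cn] := eqVneq c 0; first by rewrite !mul0r /cost !mul0r addr0.
by rewrite /cost -mulrDr -!mulf_div divff // !mul1r mulrDr !mulrA.
Qed.

Lemma cost_bound q x y K : 0 < q < 1 -> 0 <= x -> 0 <= y ->
  - ln q <= K -> - ln (1 - q) <= K -> cost q x y <= K * (x + y).
Proof.
move=> hq x0 y0 h1 h2; rewrite costE //.
have e (u w : R) : 0 <= u -> 0 <= w -> u * ln (u / (u + w)) <= 0.
  move=> u0 w0; apply: mulr_ge0_le0 => //; apply: ln_le0.
  have [->|un] := eqVneq u 0; first by rewrite mul0r.
  by rewrite ler_pdivrMr ?mul1r ?lerDl // ltr_pwDl // lt_def un.
have g1 := e _ _ x0 y0; have g2 := e _ _ y0 x0; rewrite [y + x]addrC in g2.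
have g3 := ler_wpM2l x0 h1; have g4 := ler_wpM2l y0 h2.
rewrite mulrDr ![K * _]mulrC; rewrite !mulrN in g3 g4.
move: g1 g2 g3 g4; move: (x * ln (x / _)) (y * ln (y / _)) (x * ln q) (y * ln (1 - q)) (x * K) (y * K).
intros; lra.
Qed.

(** Equal fluxes [v] occupy the site with mass [2 * v], each unit of which pays the Cramer function
    at [0]. *)
Lemma cost_diag q v : 0 < q < 1 -> 0 <= v -> cost q v v = 2 * v * - logmgf q (tilt0 q).
Proof.
move=> hq v0; have /andP[q0 q1] := hq; have q1' : 0 < 1 - q by lra.
rewrite costE // logmgf_tilt0 //.
have -> : 4 * q * (1 - q) = (2 * q) * (2 * (1 - q)) by ring.
rewrite [ln (2 * q * _)]lnM ?posrE ?mulr_gt0 //.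
rewrite [ln (2 * q)]lnM ?posrE // [ln (2 * (1 - q))]lnM ?posrE //.
have [->|vn] := eqVneq v 0; first by rewrite !mul0r !mulr0 !mul0r; lra.
have -> : v / (v + v) = 2^-1 by field; lra.
by rewrite lnV ?posrE //; move: (ln 2) (ln q) (ln (1 - q)) => l2 lq lq'; field.
Qed.

End CostLemmas.

Section WindowIndicators.
Variable R : realType.
Implicit Types (v : R) (lo hi k : int) (N B : nat).

Lemma wsum_interval N lo hi v : - N%:Z <= lo -> lo <= hi -> hi <= N%:Z + 1 ->
  wsum N (fun x => if (lo <= x) && (x < hi) then v else 0) = v * (hi - lo)%:~R.
Proof.
move=> h1 h2 h3.
(* Clamping to [[lo, hi]] gives a discrete primitive of the indicator, so the sum telescopes. *)
pose cl (x : int) := Num.min (Num.max x lo) hi.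
pose F (x : int) := v * (cl (x + 1))%:~R.
rewrite (@eq_wsum _ N _ (fun x => F x - F (x - 1))).
  rewrite wsum_telescope /F -mulrBr -intrB; congr (_ * _%:~R); rewrite /cl; lia.
move=> x _; rewrite /F -mulrBr -intrB subrK.
case: ifP => hx.
  have -> : cl (x + 1) - cl x = 1 by rewrite /cl; lia.
  by rewrite mulr1z mulr1.
have -> : cl (x + 1) - cl x = 0 by rewrite /cl; lia.
by rewrite mulr0z mulr0.
Qed.

Lemma wsum_upmass (mu : zbar -> R) B k : is_prob mu -> - B%:Z <= k <= B%:Z + 1 ->
  wsum B (fun x => if k <= x then zmass mu x else 0) = upmass mu k - upmass mu (B%:Z + 1).
Proof.
move=> pmu hk; pose F (x : int) := - upmass mu (Num.max k (x + 1)).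
rewrite (@eq_wsum _ B _ (fun x => F x - F (x - 1))).
  rewrite wsum_telescope /F opprK addrC subrK.
  have -> : Num.max k (- B%:Z) = k by lia.
  by have -> : Num.max k (B%:Z + 1) = B%:Z + 1 by lia.
move=> x _; rewrite /F subrK opprK addrC; case: ifP => kx.
  have -> : Num.max k x = x by lia.
  have -> : Num.max k (x + 1) = x + 1 by lia.
  exact: mass_upmass.
have -> : Num.max k x = k by lia.
have -> : Num.max k (x + 1) = k by lia.
by rewrite subrr.
Qed.

Lemma wsum_occ N (f : int -> R) : f N%:Z = 0 -> f (- N%:Z - 1) = 0 ->
  wsum N (occ f) = 2 * wsum N f.
Proof.
move=> f1 f2; have h := wsum_telescope N f; rewrite f1 f2 subrr in h.
rewrite (@eq_wsum _ N (occ f) (fun x => 2 * f x + - (f x - f (x - 1)))).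
  by rewrite wsumD wsumN h oppr0 addr0 wsumZ.
by move=> x _; rewrite /occ; ring.
Qed.

Lemma ssum_wsum N (h : int -> R) : ssum (- N%:Z) (2 * N) h = wsum N h.
Proof.
rewrite /ssum /wsum big_mkord; apply: eq_bigr => i _; congr h; lia.
Qed.

End WindowIndicators.

(** * Stretches of constant flux *)

Section Blocks.
Variable R : realType.
Implicit Types (v : R) (lo hi x : int) (N : nat).

Definition block lo hi v x : R := if (lo <= x) && (x < hi) then v else 0.

Lemma block_ge0 lo hi v x : 0 <= v -> 0 <= block lo hi v x.
Proof. by rewrite /block; case: ifP. Qed.

Lemma block_cases lo hi v x : lo < hi ->
  [\/ [/\ x == lo, (x == hi) = false, block lo hi v x = v & block lo hi v (x - 1) = 0],
      [/\ (x == lo) = false, x == hi, block lo hi v x = 0 & block lo hi v (x - 1) = v],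
      [/\ (x == lo) = false, (x == hi) = false,
          lo < x < hi & block lo hi v x = v /\ block lo hi v (x - 1) = v] |
      [/\ (x == lo) = false, (x == hi) = false,
          block lo hi v x = 0 & block lo hi v (x - 1) = 0]].
Proof.
move=> h; rewrite /block; have [xlo|xlo] := eqVneq x lo.
  have -> : (lo <= x) && (x < hi) = true by lia.
  have -> : (lo <= x - 1) && (x - 1 < hi) = false by lia.
  by constructor 1; split => //; lia.
have [xhi|xhi] := eqVneq x hi.
  have -> : (lo <= x) && (x < hi) = false by lia.
  have -> : (lo <= x - 1) && (x - 1 < hi) = true by lia.
  by constructor 2.
have [hx|hx] := boolP ((lo < x) && (x < hi)).
  have -> : (lo <= x) && (x < hi) = true by lia.
  have -> : (lo <= x - 1) && (x - 1 < hi) = true by lia.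
  by constructor 3.
have -> : (lo <= x) && (x < hi) = false by lia.
have -> : (lo <= x - 1) && (x - 1 < hi) = false by lia.
by constructor 4.
Qed.

Lemma block_mass N lo hi v : - N%:Z <= lo -> lo <= hi -> hi <= N%:Z ->
  wsum N (occ (block lo hi v)) = 2 * v * (hi - lo)%:~R.
Proof.
move=> h1 h2 h3; rewrite wsum_occ.
- by rewrite wsum_interval ?mulrA //; lia.
- by rewrite /block; case: ifP => //; lia.
- by rewrite /block; case: ifP => //; lia.
Qed.

End Blocks.

Section Environment.
Variables (R : realType) (p : int -> R).
Hypothesis p01 : forall k, 0 < p k < 1.
Implicit Types (c d e q v K : R) (lo hi k x : int) (N : nat).

Lemma neg_ln_le q q' : 0 < q -> q <= q' -> - ln q' <= `|ln q|.
Proof.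
move=> q0 qq'; apply: le_trans (_ : - ln q <= _).
  by rewrite lerN2 ler_ln ?posrE //; exact: lt_le_trans qq'.
by rewrite -normrN; exact: ler_norm.
Qed.

Lemma diag_cost_cont q e : 0 < q < 1 -> 0 < e -> exists2 d, 0 < d &
  forall q', 0 < q' < 1 -> `|q' - q| < d ->
    - logmgf q' (tilt0 q') <= - logmgf q (tilt0 q) + e.
Proof.
move=> hq e0; have /andP[q0 q1] := hq.
have M0 : 0 < 4 * q * (1 - q) by rewrite !mulr_gt0 // subr_gt0.
have : nbhs (ln (4 * q * (1 - q))) (ball (ln (4 * q * (1 - q))) e) by exact: nbhsx_ballx.
move=> /(continuous_ln M0) /nbhs_ballP [d /= d0 hd].
exists (d / 4); first by rewrite divr_gt0.
move=> q' hq' qq'; rewrite !logmgf_tilt0 //.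
have /andP[q'0 q'1] := hq'.
have : ball (ln (4 * q * (1 - q))) e (ln (4 * q' * (1 - q'))).
  apply: hd; rewrite /ball /=.
  have -> : 4 * q * (1 - q) - 4 * q' * (1 - q') = 4 * ((q' - q) * (q' + q - 1)) by ring.
  have h1 : `|q' + q - 1| <= 1 by rewrite ler_norml; apply/andP; split; lra.
  rewrite !normrM gtr0_norm //.
  have : `|q' - q| * `|q' + q - 1| <= `|q' - q| * 1 by apply: ler_wpM2l.
  rewrite mulr1; move: (_ * `|q' + q - 1|) => u; lra.
by rewrite /ball /= ltr_norml => /andP[h1 h2]; move: h1 h2; move: (ln _) (ln _) => *; lra.
Qed.

Definition wcost N (f : int -> R) : R := wsum N (fun x => cost (p x) (f x) (f (x - 1))).

(** Interior sites see equal fluxes and fall under [cost_diag]. At the two end sites the flux is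
    one-sided and only the crude bound [K * v] is used, small when the block is long and [v]
    small. *)
Lemma block_cost N lo hi v c K : - N%:Z <= lo -> lo < hi -> hi <= N%:Z -> 0 <= v -> 0 <= c ->
  (forall k, - ln (p k) <= K /\ - ln (1 - p k) <= K) ->
  (forall x, lo < x < hi -> - logmgf (p x) (tilt0 (p x)) <= c) ->
  wcost N (block lo hi v) <= 2 * v * (hi - lo)%:~R * c + 2 * (K * v).
Proof.
move=> h1 h2 h3 v0 c0 hK hc; rewrite -(block_mass v h1 (ltW h2) h3).
have e1 : wsum N (fun x => if x == lo then K * v else 0) = K * v.
  by rewrite (wsum_delta (fun=> K * v)) //; lia.
have e2 : wsum N (fun x => if x == hi then K * v else 0) = K * v.
  by rewrite (wsum_delta (fun=> K * v)) //; lia.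
have -> : wsum N (occ (block lo hi v)) * c + 2 * (K * v) =
    wsum N (fun x => c * occ (block lo hi v) x + ((if x == lo then K * v else 0) +
      (if x == hi then K * v else 0))).
  have e3 : 2 * (K * v) = K * v + K * v by ring.
  have e4 : wsum N (fun x => (if x == lo then K * v else 0) + (if x == hi then K * v else 0)) =
    K * v + K * v by rewrite wsumD e1 e2.
  by rewrite [RHS]wsumD e4 wsumZ e3 [c * _]mulrC.
apply: ler_wsum => x _; rewrite /occ.
have b0 y : 0 <= block lo hi v y by exact: block_ge0.
have [ka kb] := hK x.
have cb := cost_bound (p01 x) (b0 x) (b0 (x - 1)) ka kb.
have co : 0 <= c * (block lo hi v x + block lo hi v (x - 1)) by rewrite mulr_ge0 // addr_ge0.
case: (block_cases v x h2) => -[-> ->].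
- move=> b1 b2; move: cb co; rewrite b1 b2 !addr0 => cb co.
  by apply: le_trans cb _; rewrite lerDr.
- move=> b1 b2; move: cb co; rewrite b1 b2 !add0r => cb co.
  by apply: le_trans cb _; rewrite lerDr.
- move=> hx [-> ->]; rewrite !addr0 cost_diag //.
  have -> : c * (v + v) = 2 * v * c by ring.
  by apply: ler_wpM2l; [rewrite mulr_ge0|exact: hc].
- by move=> -> ->; rewrite /cost !mul0r !addr0 mulr0.
Qed.

Lemma wcost_lin N f g c d : (forall x, 0 <= f x) -> (forall x, 0 <= g x) -> 0 <= c -> 0 <= d ->
  wcost N (fun x => c * f x + d * g x) <= c * wcost N f + d * wcost N g.
Proof.
move=> f0 g0 c0 d0; rewrite /wcost -!wsumZ -wsumD; apply: ler_wsum => x _.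
apply: le_trans (costD (p01 x) _ _ _ _) _; rewrite ?mulr_ge0 //.
by rewrite !costZ.
Qed.

Lemma wcost_bound N f K : (forall x, 0 <= f x) ->
  (forall k, - ln (p k) <= K /\ - ln (1 - p k) <= K) -> wcost N f <= K * wsum N (occ f).
Proof.
move=> f0 hK; rewrite -wsumZ; apply: ler_wsum => x _.
by have [h1 h2] := hK x; apply: cost_bound.
Qed.

Lemma entropy_costE N f : (forall x, 0 <= f x) ->
  entropy_cost (- N%:Z) (2 * N) f p = wcost N f.
Proof.
move=> f0; rewrite /entropy_cost ssum_wsum; apply: eq_wsum => x _.
rewrite /cost /jump /occ; set s := f x + f (x - 1).
have [s0|sn] := eqVneq s 0.
  have fx0 : f x = 0 by have := f0 x; have := f0 (x - 1); rewrite /s in s0 *; lra.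
  have fy0 : f (x - 1) = 0 by have := f0 x; have := f0 (x - 1); rewrite /s in s0 *; lra.
  by rewrite s0 fx0 fy0 !mul0r addr0.
have -> : 1 - f x / s = f (x - 1) / s.
  by rewrite -{1}(divff sn) -mulrBl; congr (_ / _); rewrite /s addrC addKr.
by rewrite mulrDr; congr (_ + _); rewrite mulrA; congr (_ * _); rewrite mulrC divfK.
Qed.

Variables pm pp : R.
Hypothesis hpm : forall e : R, 0 < e -> exists N : int, forall k : int, k <= N -> `|p k - pm| < e.
Hypothesis hpp : forall e : R, 0 < e -> exists N : int, forall k : int, N <= k -> `|p k - pp| < e.
Hypotheses (hpm01 : 0 < pm < 1) (hpp01 : 0 < pp < 1).

(** Near both ends [p] is close to limits inside [(0, 1)]; the finitely many sites in between are
    bounded by a sum. *)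
Lemma log_bound : exists K, 0 <= K /\ forall k, - ln (p k) <= K /\ - ln (1 - p k) <= K.
Proof.
have near q : 0 < q < 1 -> 0 < Num.min (q / 2) ((1 - q) / 2).
  by move=> /andP[q0 q1]; rewrite lt_min !divr_gt0 // subr_gt0.
have bd q : 0 < q < 1 -> forall k, `|p k - q| < Num.min (q / 2) ((1 - q) / 2) ->
    - ln (p k) <= `|ln (q / 2)| /\ - ln (1 - p k) <= `|ln ((1 - q) / 2)|.
  move=> /andP[q0 q1] k; rewrite lt_min !ltr_norml => /andP[/andP[h1 _] /andP[_ h2]].
  by split; apply: neg_ln_le; lra.
have [N1 hN1] := hpm (near _ hpm01); have [N2 hN2] := hpp (near _ hpp01).
pose N := maxn `|N1| `|N2|.
pose K1 := `|ln (pm / 2)| + `|ln ((1 - pm) / 2)|.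
pose K2 := `|ln (pp / 2)| + `|ln ((1 - pp) / 2)|.
pose K3 := wsum N (fun k => `|ln (p k)|) + wsum N (fun k => `|ln (1 - p k)|).
have K10 : 0 <= K1 by rewrite addr_ge0.
have K20 : 0 <= K2 by rewrite addr_ge0.
have K30 : 0 <= K3 by rewrite addr_ge0 // wsum_ge0.
exists (K1 + K2 + K3); split.
  by apply: addr_ge0 K30; exact: addr_ge0 K10 K20.
move=> k; have [k1|k1] := leP k N1.
  have [h1 h2] := bd _ hpm01 _ (hN1 k k1).
  have n1 := normr_ge0 (ln (pm / 2)); have n2 := normr_ge0 (ln ((1 - pm) / 2)).
  by rewrite /K1 in K10 *; split; lra.
have [k2|k2] := leP N2 k.
  have [h1 h2] := bd _ hpp01 _ (hN2 k k2).
  have n1 := normr_ge0 (ln (pp / 2)); have n2 := normr_ge0 (ln ((1 - pp) / 2)).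
  by rewrite /K2 in K20 *; split; lra.
have hk : - N%:Z <= k <= N%:Z by rewrite /N; lia.
have h1 := win_bound (fun k => ln (p k)) hk.
have h2 := win_bound (fun k => ln (1 - p k)) hk.
have h3 := ler_norm (- ln (p k)); have h4 := ler_norm (- ln (1 - p k)).
rewrite normrN in h3; rewrite normrN in h4.
have h5 := le_trans h3 h1; have h6 := le_trans h4 h2.
have h7 : 0 <= wsum N (fun k => `|ln (p k)|) by apply: wsum_ge0.
have h8 : 0 <= wsum N (fun k => `|ln (1 - p k)|) by apply: wsum_ge0.
split; rewrite /K3; move: h5 h6 h7 h8 K10 K20;
  move: (wsum _ _) (wsum _ _) (- ln _) (- ln _); intros; lra.
Qed.

End Environment.

Section Above.
Variable R : realType.
Implicit Types (f g : int -> R) (c d v : R) (lo hi k x : int) (N : nat).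

Definition above N f k : R := wsum N (fun x => if k <= x then occ f x else 0).

Lemma above_lin N f g c d k :
  above N (fun x => c * f x + d * g x) k = c * above N f k + d * above N g k.
Proof.
rewrite /above -!wsumZ -wsumD; apply: eq_wsum => x _; rewrite /occ.
by case: ifP => _; ring.
Qed.

Lemma occ_sum_lin N f g c d :
  wsum N (occ (fun x => c * f x + d * g x)) = c * wsum N (occ f) + d * wsum N (occ g).
Proof.
rewrite -!wsumZ -[RHS]wsumD; apply: eq_wsum => x _; rewrite /occ; ring.
Qed.

Lemma above_bound N f k : (forall x, 0 <= f x) -> 0 <= above N f k <= wsum N (occ f).
Proof.
move=> f0; have o0 x : 0 <= occ f x by rewrite /occ addr_ge0.
apply/andP; split; first by apply: wsum_ge0 => x _; case: ifP.
by apply: ler_wsum => x _; case: ifP.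
Qed.

Lemma above_block_right N lo hi v k : k <= lo ->
  above N (block lo hi v) k = wsum N (occ (block lo hi v)).
Proof.
move=> klo; apply: eq_wsum => x _; case: ifPn => // kx.
by rewrite /occ /block !ifF ?addr0 //; lia.
Qed.

Lemma above_block_left N lo hi v k : hi < k -> above N (block lo hi v) k = 0.
Proof.
move=> klo; rewrite /above (@eq_wsum _ N _ (fun=> 0)); first by rewrite /wsum big1.
by move=> x _; case: ifP => // kx; rewrite /occ /block !ifF ?addr0 //; lia.
Qed.

End Above.

(** * Truncation of the flux to a window *)

Section Core.
Variables (R : realType) (p : int -> R) (mu : zbar -> R) (r : int -> R) (M K : R).
Hypothesis p01 : forall k, 0 < p k < 1.
Hypothesis pmu : is_prob mu.
Hypothesis r0 : forall k, 0 <= r k.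
Hypothesis rD : forall k, r k + r (k - 1) = zmass mu k.
Hypothesis rcost : forall B, wsum B (fun k => cost (p k) (r k) (r (k - 1))) <= M.
Hypothesis hK : forall k, - ln (p k) <= K /\ - ln (1 - p k) <= K.
Implicit Types (k x : int) (N B : nat).

(** All edges touching [[-B, B]] are kept, so the sites of that window keep exactly their mass; the
    sites [B + 1] and [- (B + 1)] each retain one edge. *)
Definition core B x : R := if (- B.+1%:Z <= x) && (x < B.+1%:Z) then r x else 0.

Lemma core_ge0 B x : 0 <= core B x.
Proof. by rewrite /core; case: ifP. Qed.

Lemma core_cases B x :
  [\/ [/\ `|x| <= B%:Z, core B x = r x & core B (x - 1) = r (x - 1)],
      [/\ x = B.+1%:Z, core B x = 0 & core B (x - 1) = r B%:Z],
      [/\ x = - B.+1%:Z, core B x = r (- B.+1%:Z) & core B (x - 1) = 0] |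
      [/\ B.+1%:Z < `|x|, core B x = 0 & core B (x - 1) = 0]].
Proof.
rewrite /core; have [h|h] := leP `|x| B%:Z.
  have -> : (- B.+1%:Z <= x) && (x < B.+1%:Z) = true by lia.
  have -> : (- B.+1%:Z <= x - 1) && (x - 1 < B.+1%:Z) = true by lia.
  by constructor 1.
have [->|h1] := eqVneq x B.+1%:Z.
  have -> : B.+1%:Z - 1 = B%:Z by lia.
  have -> : (- B.+1%:Z <= B.+1%:Z) && (B.+1%:Z < B.+1%:Z) = false by lia.
  have -> : (- B.+1%:Z <= B%:Z) && (B%:Z < B.+1%:Z) = true by lia.
  by constructor 2.
have [->|h2] := eqVneq x (- B.+1%:Z).
  have -> : (- B.+1%:Z <= - B.+1%:Z) && (- B.+1%:Z < B.+1%:Z) = true by lia.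
  have -> : (- B.+1%:Z <= - B.+1%:Z - 1) && (- B.+1%:Z - 1 < B.+1%:Z) = false by lia.
  by constructor 3.
have -> : (- B.+1%:Z <= x) && (x < B.+1%:Z) = false by lia.
have -> : (- B.+1%:Z <= x - 1) && (x - 1 < B.+1%:Z) = false by lia.
by constructor 4; split => //; lia.
Qed.

Lemma wsum_core_form N B (F : int -> R) (u v : R) : (B < N)%N ->
  wsum N (fun x => (if `|x| <= B%:Z then F x else 0) +
    ((if x == B.+1%:Z then u else 0) + (if x == - B.+1%:Z then v else 0))) =
  wsum B F + (u + v).
Proof.
move=> BN.
have e1 : wsum N (fun x => if x == B.+1%:Z then u else 0) = u.
  by apply: (wsum_delta (fun=> u)); lia.
have e2 : wsum N (fun x => if x == - B.+1%:Z then v else 0) = v.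
  by apply: (wsum_delta (fun=> v)); lia.
rewrite wsumD; congr (_ + _); first exact: wsum_trunc (ltnW BN).
by rewrite wsumD e1 e2.
Qed.

Lemma core_mass N B : (B < N)%N ->
  wsum N (occ (core B)) = wsum B (zmass mu) + (r B%:Z + r (- B.+1%:Z)).
Proof.
move=> BN; rewrite -(wsum_core_form _ _ _ BN); apply: eq_wsum => x _; rewrite /occ.
case: (core_cases B x) => -[h -> ->].
- rewrite h rD.
  have -> : (x == B.+1%:Z) = false by lia.
  have -> : (x == - B.+1%:Z) = false by lia.
  by rewrite !addr0.
- have -> : (`|x| <= B%:Z) = false by lia.
  have -> : (x == B.+1%:Z) = true by lia.
  have -> : (x == - B.+1%:Z) = false by lia.
  by rewrite !add0r addr0.
- have -> : (`|x| <= B%:Z) = false by lia.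
  have -> : (x == B.+1%:Z) = false by lia.
  have -> : (x == - B.+1%:Z) = true by lia.
  by rewrite !add0r addr0.
- have -> : (`|x| <= B%:Z) = false by lia.
  have -> : (x == B.+1%:Z) = false by lia.
  have -> : (x == - B.+1%:Z) = false by lia.
  by rewrite !add0r.
Qed.

Lemma core_above N B k : (B < N)%N -> - B%:Z <= k <= B%:Z ->
  above N (core B) k = upmass mu k - upmass mu (B%:Z + 1) + r B%:Z.
Proof.
move=> BN hk; rewrite -wsum_upmass //; last by lia.
rewrite -[r B%:Z in RHS]addr0 -(wsum_core_form _ _ _ BN); apply: eq_wsum => x _; rewrite /occ.
case: (core_cases B x) => -[h -> ->].
- rewrite h rD.
  have -> : (x == B.+1%:Z) = false by lia.
  have -> : (x == - B.+1%:Z) = false by lia.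
  by rewrite !addr0.
- have -> : (`|x| <= B%:Z) = false by lia.
  have -> : (x == B.+1%:Z) = true by lia.
  have -> : (x == - B.+1%:Z) = false by lia.
  have -> : (k <= x) = true by lia.
  by rewrite !add0r addr0.
- have -> : (`|x| <= B%:Z) = false by lia.
  have -> : (x == B.+1%:Z) = false by lia.
  have -> : (x == - B.+1%:Z) = true by lia.
  have -> : (k <= x) = false by lia.
  by rewrite !add0r.
- have -> : (`|x| <= B%:Z) = false by lia.
  have -> : (x == B.+1%:Z) = false by lia.
  have -> : (x == - B.+1%:Z) = false by lia.
  by rewrite !add0r; case: ifP.
Qed.

Lemma core_cost N B : (B < N)%N ->
  wcost p N (core B) <= M + K * (r B%:Z + r (- B.+1%:Z)).
Proof.
move=> BN; apply: le_trans (lerD (rcost B) (lexx _)).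
rewrite mulrDr -(wsum_core_form _ _ _ BN); apply: ler_wsum => x _.
have [ka kb] := hK x.
have K0 : 0 <= K.
  have /andP[p0 p1] := p01 x; apply: le_trans ka; rewrite oppr_ge0; apply: ln_le0; exact: ltW.
have Kr k : 0 <= K * r k by rewrite mulr_ge0.
case: (core_cases B x) => -[h -> ->].
- by rewrite h lerDl addr_ge0 //; case: ifP.
- have -> : (`|x| <= B%:Z) = false by clear -h; lia.
  have -> : (x == B.+1%:Z) = true by clear -h; lia.
  have -> : (x == - B.+1%:Z) = false by clear -h; lia.
  by rewrite add0r addr0; apply: le_trans (cost_bound (p01 x) _ _ ka kb) _; rewrite ?add0r.
- have -> : (`|x| <= B%:Z) = false by clear -h; lia.
  have -> : (x == B.+1%:Z) = false by clear -h; lia.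
  have -> : (x == - B.+1%:Z) = true by clear -h; lia.
  by rewrite !add0r; apply: le_trans (cost_bound (p01 x) _ _ ka kb) _; rewrite ?addr0.
- have -> : (`|x| <= B%:Z) = false by clear -h; lia.
  have -> : (x == B.+1%:Z) = false by clear -h; lia.
  have -> : (x == - B.+1%:Z) = false by clear -h; lia.
  by rewrite /cost !mul0r !addr0.
Qed.

End Core.

Section Bookkeeping.
Variable R : realType.

Lemma norm_four_le (x y z u h e : R) : 0 <= x <= h -> 0 <= y <= h -> 0 <= z <= 2 * h ->
  0 <= u <= h -> 7 * h <= e -> `|- x + y + z - u| <= e.
Proof.
move=> /andP[? ?] /andP[? ?] /andP[? ?] /andP[? ?] ?.
by rewrite ler_norml; apply/andP; split; lra.
Qed.

(** The arithmetic of [flux_approx], with [h] for [eta]: [a1] and [a2] bound the weighted main and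
    uniform fluxes, while [wc], [wp], [wm] are the costs of the core and of the two blocks. *)
Lemma cost_budget (a1 a2 w2 wc wp wm lp lm cp cm h K M e : R) :
  a1 <= w2 -> a2 <= 2 * h * K -> h * (lp + lm) <= h -> w2 <= wc + (wp + wm) ->
  wc <= M + K * h -> wp <= lp * (cp + h) + h * lp -> wm <= lm * (cm + h) + h * lm ->
  0 <= h * 5 -> h * (3 * K + 7) <= e ->
  a1 + a2 <= M + (lm * cm + lp * cp) + e.
Proof.
move=> h1 h2 h3 h4 h5 h6 h7 h8.
have -> : h * (3 * K + 7) = 3 * (K * h) + 2 * h + h * 5 by ring.
have e2 : 2 * h * K = 2 * (K * h) by ring.
have e3 : h * (lp + lm) = h * lp + h * lm by ring.
have e6 : lp * (cp + h) = lp * cp + h * lp by ring.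
have e7 : lm * (cm + h) = lm * cm + h * lm by ring.
rewrite e2 in h2; rewrite e3 in h3; rewrite e6 in h6; rewrite e7 in h7.
move: h1 h2 h3 h4 h5 h6 h7 h8.
move: (K * h) (h * lp) (h * lm) (lp * cp) (lm * cm) => *; lra.
Qed.

End Bookkeeping.

Section Approximation.
Variables (R : realType) (p : int -> R) (pm pp : R) (mu : zbar -> R) (M : R).
Hypothesis p01 : forall k, 0 < p k < 1.
Hypothesis hpm : forall e : R, 0 < e -> exists N : int, forall k : int, k <= N -> `|p k - pm| < e.
Hypothesis hpp : forall e : R, 0 < e -> exists N : int, forall k : int, N <= k -> `|p k - pp| < e.
Hypotheses (hpm01 : 0 < pm < 1) (hpp01 : 0 < pp < 1).
Hypothesis pmu : is_prob mu.
Hypothesis IM : (I_DV p (zmass mu) <= M%:E)%E.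
Implicit Types (e d : R) (k x m : int) (N B : nat).

Let cm := - logmgf pm (tilt0 pm).
Let cp := - logmgf pp (tilt0 pp).

Lemma diag_right e : 0 < e -> exists B : nat, forall x, B%:Z <= x ->
  - logmgf (p x) (tilt0 (p x)) <= cp + e.
Proof.
move=> e0; have [d d0 hd] := diag_cost_cont hpp01 e0; have [N hN] := hpp d0.
exists `|N|%N => x hx; apply: hd (p01 x) (hN x _); lia.
Qed.

Lemma diag_left e : 0 < e -> exists B : nat, forall x, x <= - B%:Z ->
  - logmgf (p x) (tilt0 (p x)) <= cm + e.
Proof.
move=> e0; have [d d0 hd] := diag_cost_cont hpm01 e0; have [N hN] := hpm d0.
exists `|N|%N => x hx; apply: hd (p01 x) (hN x _); lia.
Qed.

(* The masses [lm], [lp] that the flux keeps near the two ends may fall short of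
   those of [mu]: the missing mass [w] is left to a final escape. *)
Lemma flux_approx lm lp w e m (N0 : nat) (eps : R) :
  0 <= lm -> 0 <= lp -> 0 <= w -> lm + lp + w = mu ZNInf + mu ZPInf ->
  w * e = mu ZPInf - lp -> 0 <= e <= 1 -> 0 < eps ->
  exists a n (f : int -> R),
    [/\ (forall x, a <= x < a + n%:Z -> 0 < f x),
        (forall x, ~~ (a <= x < a + n%:Z) -> f x = 0), (0 < n)%N, site a n m &
        [/\ mass a n f <= 1, w = 0 -> mass a n f = 1,
            entropy_cost a n f p <= M + (lm * cm + lp * cp) + eps &
            forall k, - N0%:Z <= k <= N0%:Z ->
              `|mass_above a n f k + (1 - mass a n f) * e - upmass mu k| <= eps]].
Proof.
move=> lm0 lp0 w0 lw we /andP[e0 e1] eps0.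
have [K [K0 hK]] := log_bound hpm hpp hpm01 hpp01.
(* One constant for two estimates: the entropy error is at most [3 * K * eta + 2 * eta], and the
   tail error stays within [7 * eta]. *)
pose eta := Num.min (2^-1) (eps / (3 * K + 7)).
have K7 : 0 < 3 * K + 7 by lra.
have eta0 : 0 < eta by rewrite lt_min invr_gt0 ltr0n divr_gt0.
have eta1 : eta <= 2^-1 by rewrite ge_min lexx.
have etaE : eta * (3 * K + 7) <= eps by rewrite -ler_pdivlMr // ge_min lexx orbT.
have [B1 hB1] := diag_right eta0; have [B2 hB2] := diag_left eta0.
have [B3 hB3] := tail_small pmu eta0.
have [B [BB1 BB2 BB3 BN0 Bm]] : exists B : nat,
    [/\ (B1 <= B)%N, (B2 <= B)%N, (B3 <= B)%N, (N0 <= B)%N & (`|m| <= B)%N].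
  by clear; exists (maxn (maxn B1 B2) (maxn B3 (maxn N0 `|m|))); split; lia.
(* Blocks of [L] edges with flux [lp / (2 * L)] have mass [lp], and their end sites cost
   [K * lp / L], at most [eta * lp]. *)
have [L L0 LK] : exists2 L, (0 < L)%N & K / L%:R <= eta.
  exists (Num.truncn (K / eta)).+1 => //.
  rewrite ler_pdivrMr ?ltr0n // mulrC -ler_pdivrMr //.
  by apply: ltW; apply: real_truncnS_gt; exact: num_real.
have [N NE] : exists N, N = (B.+1 + L)%N by exists (B.+1 + L)%N.
have BN : (B < N)%N by clear -NE; lia.
have Npos : (0 < N)%N by clear -NE; lia.
pose r := mflux mu.
have r0 k : 0 <= r k := mflux_ge0 p01 pmu IM k.
have rD k : r k + r (k - 1) = zmass mu k := mfluxD pmu IM k.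
have rc B0 : wsum B0 (fun k => cost (p k) (r k) (r (k - 1))) <= M := cost_sum_le p01 pmu IM B0.
have rt : r B%:Z + r (- B.+1%:Z) <= tailmass mu B := mflux_tail p01 pmu IM B.
have hB : tailmass mu B < eta by exact: hB3.
have B0 : 0 <= tailmass mu B := tail_ge0 B pmu.
have Lp : 0 < L%:R :> R by rewrite ltr0n.
pose vp := lp / (2 * L%:R); pose vm := lm / (2 * L%:R).
have vp0 : 0 <= vp by rewrite divr_ge0 // mulr_ge0.
have vm0 : 0 <= vm by rewrite divr_ge0 // mulr_ge0.
(* Gives the uniform flux on the [2 * N] edges total mass [1]. *)
pose vs : R := (4 * N%:R)^-1.
have vs0 : 0 < vs by rewrite invr_gt0 mulr_gt0 // ltr0n.
pose bp := block B.+1%:Z N%:Z vp; pose bm := block (- N%:Z) (- B.+1%:Z) vm.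
pose bs := block (- N%:Z) N%:Z vs.
have NB : N%:Z - B.+1%:Z = L%:Z by clear -NE; lia.
have i1 : - N%:Z <= B.+1%:Z by clear -BN; lia.
have i2 : B.+1%:Z <= N%:Z by clear -BN; lia.
have i3 : - N%:Z <= - B.+1%:Z by clear -BN; lia.
have i4 : - B.+1%:Z <= N%:Z by clear -BN; lia.
have i5 : B.+1%:Z < N%:Z by clear -NE L0; lia.
have i6 : - N%:Z < - B.+1%:Z by clear -NE L0; lia.
have i7 : - N%:Z <= N%:Z by clear; lia.
have massp : wsum N (occ bp) = lp.
  rewrite block_mass //; rewrite NB /vp.
  by rewrite -pmulrn; field; lra.
have massm : wsum N (occ bm) = lm.
  rewrite block_mass //.
  have -> : - B.+1%:Z - - N%:Z = L%:Z by clear -NE; lia.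
  by rewrite /vm -pmulrn; field; lra.
have masss : wsum N (occ bs) = 1.
  rewrite block_mass //.
  have -> : N%:Z - - N%:Z = (2 * N)%N%:Z by clear; lia.
  have Np : N%:R != 0 :> R by rewrite pnatr_eq0 -lt0n.
  by rewrite /vs -pmulrn natrM; field.
have bp0 x : 0 <= bp x by exact: block_ge0.
have bm0 x : 0 <= bm x by exact: block_ge0.
have bs0 x : 0 <= bs x by apply: block_ge0; exact: ltW.
pose co := core r B; have co0 x : 0 <= co x by exact: core_ge0.
pose f1 x := 1 * bp x + 1 * bm x; pose f2 x := 1 * co x + 1 * f1 x.
pose lam := 1 - eta.
pose Q := r B%:Z + r (- B.+1%:Z).
have Q0 : 0 <= Q by rewrite addr_ge0.
pose mc := wsum B (zmass mu) + Q.
have massc : wsum N (occ co) = mc by apply: core_mass.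
(* The weight that makes the total mass exactly [1 - lam * w], hence [1] when nothing escapes. By
   [mflux_tail] the core is no heavier than [mu] on the integers, so [kap >= eta > 0]. *)
pose kap := 1 - lam * (mc + lp + lm + w).
pose f x := lam * f2 x + kap * bs x.
have tE : tailmass mu B = 1 - mu ZNInf - mu ZPInf - wsum B (zmass mu) by [].
have mcE : mc + lp + lm + w = 1 - (tailmass mu B - Q) by rewrite tE /mc; lra.
have lam0 : 0 < lam by rewrite subr_gt0; apply: le_lt_trans eta1 _; rewrite invf_lt1 ?ltr1n.
have lam1 : lam <= 1 by rewrite gerBl ltW.
have kapE : kap = eta + lam * (tailmass mu B - Q) by rewrite /kap mcE /lam; ring.
have tQ : 0 <= tailmass mu B - Q by rewrite subr_ge0.
have kt : 0 <= lam * (tailmass mu B - Q) <= eta.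
  rewrite mulr_ge0 ?(ltW lam0) //=; apply: le_trans (ler_piMl tQ lam1) _.
  by apply: le_trans (ltW hB); rewrite gerBl.
have /andP[kt1 kt2] := kt.
have kap0 : 0 < kap by rewrite kapE; exact: ltr_wpDr.
have kap2 : kap <= 2 * eta by rewrite kapE mulr_natl mulr2n lerD2l.
have f10 x : 0 <= f1 x by rewrite /f1 !mul1r addr_ge0.
have f20 x : 0 <= f2 x by rewrite /f2 !mul1r addr_ge0.
have f0 x : 0 <= f x by rewrite addr_ge0 // mulr_ge0 // ltW.
have massf : mass (- N%:Z) (2 * N) f = 1 - lam * w.
  rewrite /mass ssum_wsum /f occ_sum_lin /f2 occ_sum_lin /f1 occ_sum_lin.
  rewrite massp massm masss massc /kap; ring.
have K2 : 2 * (K * vp) <= eta * lp.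
  have -> : 2 * (K * vp) = K / L%:R * lp by rewrite /vp; field; lra.
  exact: ler_wpM2r.
have K3 : 2 * (K * vm) <= eta * lm.
  have -> : 2 * (K * vm) = K / L%:R * lm by rewrite /vm; field; lra.
  exact: ler_wpM2r.
have cp0 : 0 <= cp by exact: neg_logmgf_ge0.
have cm0 : 0 <= cm by exact: neg_logmgf_ge0.
have Wp : wcost p N bp <= lp * (cp + eta) + eta * lp.
  apply: le_trans (_ : wcost p N bp <= wsum N (occ bp) * (cp + eta) + 2 * (K * vp)) _; last first.
    by rewrite massp lerD2l.
  rewrite (block_mass vp i1 i2 (lexx _)).
  apply: (block_cost p01 i1 i5 (lexx _) vp0 _ hK); first by rewrite addr_ge0 // ltW.
  move=> x hx; apply: hB1; clear -hx BB1; lia.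
have Wm : wcost p N bm <= lm * (cm + eta) + eta * lm.
  apply: le_trans (_ : wcost p N bm <= wsum N (occ bm) * (cm + eta) + 2 * (K * vm)) _; last first.
    by rewrite massm lerD2l.
  rewrite (block_mass vm (lexx _) i3 i4).
  apply: (block_cost p01 (lexx _) i6 i4 vm0 _ hK); first by rewrite addr_ge0 // ltW.
  move=> x hx; apply: hB2; clear -hx BB2; lia.
have Ws : wcost p N bs <= K.
  by apply: le_trans (wcost_bound p01 N bs0 hK) _; rewrite masss mulr1.
have Wc : wcost p N co <= M + K * eta.
  apply: le_trans (core_cost p01 r0 rc hK BN) _; rewrite lerD2l.
  by apply: ler_wpM2l => //; apply: le_trans rt (ltW hB).
have C0 x : 0 <= cost (p x) (f2 x) (f2 (x - 1)) by apply: cost_ge0.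
have W2p : 0 <= wcost p N f2 by apply: wsum_ge0.
have W2 : wcost p N f2 <= wcost p N co + (wcost p N bp + wcost p N bm).
  apply: le_trans (wcost_lin p01 N co0 f10 ler01 ler01) _; rewrite !mul1r lerD2l.
  by apply: le_trans (wcost_lin p01 N bp0 bm0 ler01 ler01) _; rewrite !mul1r.
have lplm : lp + lm <= 1.
  have -> : lp + lm = mu ZNInf + mu ZPInf - w by rewrite -lw addrK addrC.
  apply: le_trans (_ : mu ZNInf + mu ZPInf <= _); first by rewrite gerBl.
  rewrite -subr_ge0 opprD addrA; apply: le_trans (zfin_le 0%N (prob_zfin pmu)).
  by apply: wsum_ge0 => k _; have [mu0 _] := pmu; exact: mu0.
have W : entropy_cost (- N%:Z) (2 * N) f p <= M + (lm * cm + lp * cp) + eps.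
  rewrite entropy_costE //.
  apply: le_trans (wcost_lin p01 N f20 bs0 (ltW lam0) (ltW kap0)) _.
  have g1 : lam * wcost p N f2 <= wcost p N f2 by exact: ler_piMl W2p lam1.
  have g2 : kap * wcost p N bs <= 2 * eta * K.
    apply: le_trans (_ : kap * K <= _); first by apply: ler_wpM2l => //; exact: ltW.
    by apply: ler_wpM2r.
  have g3 : eta * (lp + lm) <= eta by apply: ler_piMr lplm; exact: ltW.
  by apply: cost_budget g1 g2 g3 W2 Wc Wp Wm _ etaE; rewrite mulr_ge0 // ltW.
exists (- N%:Z), (2 * N)%N, f; split.
- move=> x hx; rewrite /f; apply: ltr_wpDl; first by rewrite mulr_ge0 // ltW.
  apply: mulr_gt0 => //; rewrite /bs /block ifT //; clear -hx; lia.
- move=> x hx.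
  have c1 : (- B.+1%:Z <= x) && (x < B.+1%:Z) = false by clear -hx BN; lia.
  have c2 : (B.+1%:Z <= x) && (x < N%:Z) = false by clear -hx BN; lia.
  have c3 : (- N%:Z <= x) && (x < - B.+1%:Z) = false by clear -hx BN; lia.
  have c4 : (- N%:Z <= x) && (x < N%:Z) = false by clear -hx BN; lia.
  by rewrite /f /f2 /f1 /co /core /bp /bm /bs /block c1 c2 c3 c4 !(mulr0, addr0).
- by clear -Npos; lia.
- by rewrite /site; clear -BN Bm; lia.
split => //.
- by rewrite massf gerBl mulr_ge0 // ltW.
- by move=> wz; rewrite massf wz mulr0 subr0.
move=> k hk; rewrite massf /mass_above ssum_wsum.
have hkB : - B%:Z <= k <= B%:Z by clear -hk BN0; lia.
have -> : wsum N (fun x => if k <= x then occ f x else 0) = above N f k by [].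
rewrite /f above_lin /f2 above_lin /f1 above_lin.
(* Seen from a level of the inner window, the right block lies entirely above and the left block
   entirely below. *)
rewrite above_block_right; last by clear -hkB; lia.
rewrite above_block_left; last by clear -hkB; lia.
rewrite massp (core_above pmu rD) //.
have /andP[s0 s1] := above_bound N k bs0; rewrite masss in s1.
have /andP[t0 t1] := upmass_top_close B pmu.
have u0 := upmass_ge0 k pmu; have u1 := upmass_le1 k pmu.
have rB : r B%:Z <= tailmass mu B by apply: le_trans rt; rewrite lerDl.
have rB0 := r0 B%:Z.
set U := upmass mu k in u0 u1 *; set A := above N bs k in s0 s1 *.
set T := upmass mu (B%:Z + 1) in t0 t1 *; set rr := r B%:Z in rB rB0 *.
have -> : lam * (1 * (U - T + rr) + 1 * (1 * lp + 1 * 0)) + kap * A + (1 - (1 - lam * w)) * e - U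
  = lam * (U + (mu ZPInf - T) + rr) + kap * A - U.
  have -> : (1 - (1 - lam * w)) * e = lam * (w * e) by ring.
  by rewrite we; ring.
have -> : lam * (U + (mu ZPInf - T) + rr) + kap * A - U =
  lam * (mu ZPInf - T) + lam * rr + kap * A - eta * U by rewrite /lam; ring.
have TP : 0 <= T - mu ZPInf by rewrite subr_ge0.
have x1 : 0 <= lam * (T - mu ZPInf) <= eta.
  rewrite mulr_ge0 ?(ltW lam0) //=; apply: le_trans (ler_piMl TP lam1) _.
  by rewrite lerBlDl; apply: le_trans t1 _; rewrite lerD2l ltW.
have x2 : 0 <= lam * rr <= eta.
  rewrite mulr_ge0 ?(ltW lam0) //=.
  exact: le_trans (ler_piMl rB0 lam1) (le_trans rB (ltW hB)).
have x3 : 0 <= kap * A <= 2 * eta.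
  rewrite mulr_ge0 ?(ltW kap0) //=; apply: le_trans kap2.
  exact: ler_piMr (ltW kap0) s1.
have x4 : 0 <= eta * U <= eta.
  by rewrite mulr_ge0 ?(ltW eta0) //=; exact: ler_piMr (ltW eta0) u1.
have x5 : 7 * eta <= eps.
  apply: le_trans etaE; rewrite mulrC; apply: ler_wpM2l; first exact: ltW.
  by rewrite lerDr mulr_ge0.
by rewrite -[mu ZPInf - T]opprB mulrN; exact: norm_four_le x1 x2 x3 x4 x5.
Qed.

End Approximation.

(** * Lower bound *)

Section LowerBound.
Variables (R : realType) (p : int -> R) (pm pp : R).
Hypothesis p01 : forall k, 0 < p k < 1.
Hypothesis hpm : forall e : R, 0 < e -> exists N : int, forall k : int, k <= N -> `|p k - pm| < e.
Hypothesis hpp : forall e : R, 0 < e -> exists N : int, forall k : int, N <= k -> `|p k - pp| < e.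
Hypotheses (hpm01 : 0 < pm < 1) (hpp01 : 0 < pp < 1).
Implicit Types (mu : zbar -> R) (U : set (zbar -> R)) (M e eps lm lp w : R) (m : int).

Let cm := - logmgf pm (tilt0 pm).
Let cp := - logmgf pp (tilt0 pp).

Lemma emp_prob_lower U mu M m lm lp w e eps :
  weak_open U -> U mu -> (I_DV p (zmass mu) <= M%:E)%E ->
  0 <= lm -> 0 <= lp -> 0 <= w -> lm + lp + w = mu ZNInf + mu ZPInf ->
  w * e = mu ZPInf - lp -> 0 <= e <= 1 -> w = 0 \/ escapes p e -> 0 < eps ->
  exists n0, forall n, (n0 <= n)%N ->
    expR (- (n%:R * (M + (lm * cm + lp * cp) + eps))) <= emp_prob p m n U.
Proof.
move=> oU Umu IM lm0 lp0 w0 lw we e01 hw eps0.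
have pmu : is_prob mu by case: oU => UP _; exact: UP.
have [N0 [d [d0 hd]]] := weak_open_basis oU Umu.
pose eta := Num.min (eps / 2) (d / 2).
have eta0 : 0 < eta by rewrite lt_min !divr_gt0.
have eta1 : eta + eta <= eps by rewrite [leRHS]splitr lerD // ge_min lexx.
have eta2 : eta + eta <= d by rewrite [leRHS]splitr lerD // ge_min lexx orbT.
have [a [n [f [fp fo n0 ms [t1 tw fc fu]]]]] :=
  flux_approx p01 hpm hpp hpm01 hpp01 pmu IM m N0 lm0 lp0 w0 lw we e01 eta0.
have ht : mass a n f = 1 \/ escapes p e by case: hw => [/tw|]; [left|right].
have [N1 hN1] := walk_lower_bound fp fo n0 p01 N0 ms eta0 e01 t1 ht.
exists (maxn N1 1) => N; rewrite geq_max => /andP[/hN1 h N_gt0].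
apply: le_trans (le_trans _ h) _.
  rewrite ler_expR lerN2; apply: ler_wpM2l => //.
  apply: le_trans (lerD fc (lexx eta)) _.
  by rewrite -[leLHS]addrA lerD2l.
rewrite /emp_prob path_probE; apply: walkE_le; first exact: p_stochastic.
move=> s y ss _; apply: pind_le => hs.
have s0 : s != [::] by rewrite -size_eq0 ss -lt0n.
apply: hd; first exact: empirical_prob.
move=> k hk; rewrite empirical_upmass // ss.
apply: le_trans eta2.
exact: le_trans (ler_distD _ _ _) (lerD (hs k hk) (fu k hk)).
Qed.

Lemma rate_lower_bound U mu r m eps : weak_open U -> U mu ->
  rate_I p pm pp mu = r%:E -> 0 < eps ->
  exists n0, forall n, (n0 <= n)%N -> expR (- (n%:R * (r + eps))) <= emp_prob p m n U.
Proof.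
move=> oU Umu Ir eps0.
have pmu : is_prob mu by case: oU => UP _; exact: UP.
have [mu0 _] := pmu.
have am0 := mu0 ZNInf; have ap0 := mu0 ZPInf.
move: Ir; rewrite rate_IE // -EFin_min.
set c1 := endcost _ _ _ _ _; set c2 := endcost _ _ _ _ _.
have I0 := I_DV_ge0 p01 (zmass mu).
case IE : (I_DV p (zmass mu)) I0 => [M| |] // _ [rE].
have IM : (I_DV p (zmass mu) <= M%:E)%E by rewrite IE.
(* The flux keeps the full masses of both ends, with [w = 0]; the value of [e] is then
   immaterial. *)
have none : exists n0, forall n, (n0 <= n)%N ->
    expR (- (n%:R * (M + (mu ZNInf * cm + mu ZPInf * cp) + eps))) <= emp_prob p m n U.
  apply: (emp_prob_lower (w := 0) (e := 0) m oU Umu IM am0 ap0 (lexx 0)) => //.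
  - by rewrite addr0.
  - by rewrite mul0r subrr.
  - by rewrite lexx ler01.
  - by left.
rewrite -rE; have [c12|c12] := leP c1 c2.
  rewrite /c1 /endcost; have [h|h] := leP pp 2^-1.
    by rewrite /tiltR max_l //; exact: tilt0_ge0.
  rewrite /tiltR max_r; last by apply: tilt0_le0 => //; exact: ltW.
  rewrite logmgf0 oppr0 mulr0 -(mul0r cp).
  apply: (emp_prob_lower (e := 1) m oU Umu IM am0 (lexx 0) ap0) => //.
  - by rewrite addr0.
  - by rewrite mulr1 subr0.
  - by rewrite lexx ler01.
  - by right; apply: escapes_right hpp _ => //; rewrite h; case/andP: hpp01.
rewrite /c2 /endcost; have [h|h] := leP 2^-1 pm.
  by rewrite /tiltL min_l //; exact: tilt0_le0.
rewrite /tiltL min_r; last by apply: tilt0_ge0 => //; exact: ltW.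
rewrite logmgf0 oppr0 mulr0 -(mul0r cm).
apply: (emp_prob_lower (e := 0) m oU Umu IM (lexx 0) ap0 am0) => //.
- by rewrite add0r addrC.
- by rewrite mulr0 subrr.
- by rewrite lexx ler01.
- by right; apply: escapes_left hpm _ => //; rewrite h andbT; case/andP: hpm01.
Qed.

Lemma lower_bound U m : weak_open U ->
  (- ereal_inf (rate_I p pm pp @` U) <= limn_einf (exp_rate (fun n => emp_prob p m n U)))%E.
Proof.
move=> oU; rewrite leeNl; apply: le_ereal_inf_tmp => _ [mu Umu <-].
have pmu : is_prob mu by case: oU => UP _; exact: UP.
have := rate_I_ge0 p01 hpm01 hpp01 pmu.
case Ir : (rate_I p pm pp mu) => [r| |] // _; last by rewrite leey.
rewrite leeNl; apply/lee_addgt0Pr => eps eps0.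
have [n0 hn0] := rate_lower_bound m oU Umu Ir eps0.
have := exp_rate_ge hn0; rewrite opprD EFinD EFinN => h.
by rewrite -leeBlDr.
Qed.

End LowerBound.

Theorem theorem1p1 (R : realType) (p : int -> R) (pm pp : R)
  (hp : forall k, 0 < p k < 1)
  (hpm : forall e : R, 0 < e -> exists N : int, forall k : int, k <= N -> `|p k - pm| < e)
  (hpp : forall e : R, 0 < e -> exists N : int, forall k : int, N <= k -> `|p k - pp| < e)
  (hpm01 : 0 < pm < 1) (hpp01 : 0 < pp < 1) :
  forall m : int, LDP p m (rate_I p pm pp).
Proof.
move=> m; split; first exact: rate_I_good.
split; first by move=> U oU; exact: (lower_bound hp hpm hpp hpm01 hpp01).
by move=> F cF; exact: (upper_bound hp hpm hpp hpm01 hpp01).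
Qed.
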